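(* Let $b\ge 7$ be an integer and $D\subset\{0,\dots,b-1\}$ with $\#D=b-1$. Let $K=K_{b,D}$ and $\kappa=\dim_{\mathrm H}(K)$. Then there is an effectively-computable $\varrho>0$ such that \[ \dim_{\mathrm H}(W_{\mathbb R}(\alpha)\cap K)=\frac{2}{\alpha}+\kappa-1\qquad\text{for all }\alpha\in[2,2+\varrho). \] In particular, $\dim_{\mathrm H}(\mathbf{VWA}\cap K)=\dim_{\mathrm H}(K)$.
   Context: $K_{b,D}$ is the set of real numbers in $[0,1]$ having at least one base-$b$ expansion with all digits in $D$. For $\alpha\ge1$, $W_{\mathbb R}(\alpha)$ is the set of $x\in\mathbb R$ for which $|x-p/q|<q^{-\alpha}$ has infinitely many solutions $(p,q)\in\mathbb Z\times\mathbb N$ (no restriction on $p/q$). $\mathbf{VWA}=\bigcup_{\alpha>2}W_{\mathbb R}(\alpha)$. $\dim_{\mathrm H}$ denotes Hausdorff dimension. *)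

(* Defs.v *)
From HB Require Import structures.
From mathcomp Require Import all_boot all_order all_algebra.
From mathcomp Require Import all_classical all_reals all_analysis.
Set Implicit Arguments.
Unset Strict Implicit.
Unset Printing Implicit Defensive.
Import Order.TTheory GRing.Theory Num.Theory.
Import numFieldNormedType.Exports.

Local Open Scope classical_set_scope.
Local Open Scope ring_scope.

(* Only the empty set has diameter -oo. *)
Definition diam (R : realType) (U : set R) : \bar R :=
  ereal_sup [set (`|xy.1 - xy.2|)%:E | xy in U `*` U].

(* The contribution diam(U)^s of a covering set.  The empty set contributes 0
   for every s, whereas a singleton contributes 0 `^ 0 = 1 when s = 0. *)
Definition diam_pow (R : realType) (s : R) (U : set R) : \bar R :=
  if `[< U = set0 >] then 0%E else (diam U `^ s)%E.

Definition delta_cover (R : realType) (delta : R) (E : set R)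
    (U : nat -> set R) : Prop :=
  (forall i, (diam (U i) <= delta%:E)%E) /\ E `<=` \bigcup_i U i.

Definition hausdorff_premeasure (R : realType) (s delta : R) (E : set R) :
    \bar R :=
  ereal_inf [set (\sum_(0 <= i <oo) diam_pow s (U i))%E
            | U in delta_cover delta E].

(* The supremum over delta > 0 is the limit as delta tends to 0. *)
Definition hausdorff_measure (R : realType) (s : R) (E : set R) : \bar R :=
  ereal_sup [set hausdorff_premeasure s delta E
            | delta in [set delta : R | 0 < delta]].

Definition hausdorff_dim (R : realType) (E : set R) : \bar R :=
  ereal_inf [set s%:E | s in [set s : R | 0 <= s /\ hausdorff_measure s E = 0%E]].

(* The term of index n is the digit of b^-(n+1). *)
Definition missing_digit_set (R : realType) (b : nat) (D : {set 'I_b}) :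
    set R :=
  [set x : R | 0 <= x <= 1 /\
    exists2 d : nat -> 'I_b, (forall n, d n \in D) &
      series (fun n => (d n)%:R / b%:R ^+ n.+1 : R) @ \oo --> x].

Arguments missing_digit_set R {b} D.

(* Pairs (p, q) are counted, not fractions: p and q need not be coprime, so
   every rational belongs to W alpha. *)
Definition W (R : realType) (alpha : R) : set R :=
  [set x : R | infinite_set
    [set pq : int * nat | (0 < pq.2)%N /\
      `|x - pq.1%:~R / pq.2%:R| < pq.2%:R `^ (- alpha)]].

Definition VWA (R : realType) : set R :=
  \bigcup_(alpha in [set alpha : R | 2 < alpha]) W alpha.

Arguments VWA R : clear implicits.

(* Total recursive functions: the smallest class containing the basic functions
   and closed under composition, primitive recursion and minimization of
   regular functions. *)
Inductive recursive : forall k : nat, (k.-tuple nat -> nat) -> Prop :=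
| recursive_zero (k : nat) : recursive (fun _ : k.-tuple nat => 0%N)
| recursive_succ : recursive (fun x : 1.-tuple nat => (thead x).+1)
| recursive_proj (k : nat) (i : 'I_k) :
    recursive (fun x : k.-tuple nat => tnth x i)
| recursive_comp (m k : nat) (f : m.-tuple nat -> nat)
    (g : 'I_m -> k.-tuple nat -> nat) :
    recursive f -> (forall i, recursive (g i)) ->
    recursive (fun x : k.-tuple nat => f [tuple g i x | i < m])
| recursive_primrec (k : nat) (f : k.-tuple nat -> nat)
    (g : k.+2.-tuple nat -> nat) (h : k.+1.-tuple nat -> nat) :
    recursive f -> recursive g ->
    (forall x : k.-tuple nat, h [tuple of 0%N :: x] = f x) ->
    (forall (n : nat) (x : k.-tuple nat), h [tuple of n.+1 :: x] =
                 g [tuple of n :: h [tuple of n :: x] :: x]) ->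
    recursive h
| recursive_min (k : nat) (f : k.+1.-tuple nat -> nat) (h : k.-tuple nat -> nat) :
    recursive f ->
    (forall x : k.-tuple nat, f [tuple of h x :: x] = 0%N) ->
    (forall (n : nat) (x : k.-tuple nat), (n < h x)%N -> f [tuple of n :: x] <> 0%N) ->
    recursive h.

Definition digits_code (b : nat) (D : {set 'I_b}) : nat :=
  (\sum_(d in D) 2 ^ d)%N.

(* rho is computable uniformly in (b, D), for (b, D) satisfying P: some
   algorithm with input b, (a code of) D and n returns an integer u - v such
   that (u - v) / 2^n is within 2^-n of rho b D.  For a single pair (b, D)
   computability would be no constraint on a number that may be decreased at
   will. *)
Definition effectively_computable (R : realType)
    (P : forall b : nat, {set 'I_b} -> Prop)
    (rho : forall b : nat, {set 'I_b} -> R) : Prop :=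
  exists u v : 3.-tuple nat -> nat,
    [/\ recursive u, recursive v &
      forall (b : nat) (D : {set 'I_b}), P b D -> forall n : nat,
        let t := [tuple b; digits_code D; n] in
        `|rho b D - ((u t)%:R - (v t)%:R) / 2 ^+ n| <= (2 ^+ n)^-1].

Definition one_missing_digit (b : nat) (D : {set 'I_b}) : Prop :=
  (7 <= b)%N /\ #|D| = (b - 1)%N.

(* Main.v *)
Require Import Defs.
From Stdlib Require Import ZArith.
From HB Require Import structures.
From mathcomp Require Import all_boot all_order all_algebra.
From mathcomp Require Import all_classical all_reals all_analysis.
From mathcomp Require Import complex.
From mathcomp Require Import zify ssrZ ring lra.
Set Implicit Arguments.
Unset Strict Implicit.
Unset Printing Implicit Defensive.
Import Order.TTheory GRing.Theory Num.Theory.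
Import numFieldNormedType.Exports.
Local Open Scope classical_set_scope.
Local Open Scope ring_scope.

(* Let B = b^k. A word v < B of length k over D is near a rational p/q when
   |q v - B p| < q; a tent function counts, with weights, the words near some
   rational with q in [Q, 2Q). Fourier analysis on Z/B expands the deviation of
   this count from its mean over the frequencies n q, and since an integer has few
   divisors, the deviation is governed by the l1 norm of the Fourier transform of
   the set of words. This norm factors over the digits and is at most Phi^k, where
   Phi^2 = 123/125 b (b - 1)^2: for b >= 12 one term of each fiber sum dominates
   and Cauchy-Schwarz bounds the others; for 7 <= b <= 11 the bound is checked
   numerically on a grid. As Phi < (b - 1) b^(1/2), the count is close to its mean
   Q (b - 1)^k / B times a constant for Q a little below B^(1/2), that is, for
   Q = B^(1/alpha) with alpha slightly larger than 2.

   Upper bound: cover the limsup set by the cylinders of the words near rationals.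
   Lower bound: delete from the words near rationals of denominator about Q those
   near a rational of small denominator and those with an overcrowded prefix; the
   others carry a weight with the Frostman bound at all levels of the scale. If v
   is near p/q, then below any word W of length M the word W v is near
   (W q + p)/(b^M q), so such scales can be stacked, each time avoiding the
   cylinders that meet a given cheap cover; the point obtained is well
   approximable and not covered. *)

(** * Words near rationals: variance of the tent count *)

(** The only gain is the factor 123/125 in Phi^2, and it dictates the shape of a scale. A word of
    length 12 m is cut into a prefix of length m and a suffix of length 11 m. The l1 bound is spent
    on the suffix and Parseval on the prefix, which controls the second moment of the count over
    prefixes: most prefixes of length m carry about the expected count. Compared with the mean this
    loses (b / (b - 1))^m <= (7/6)^m and gains (123/125)^(11 m). As 7/6 (123/125)^11 is below 1 by a
    factor of more than 1.01^2, there is room for a loss of 1.01^m in Q^2 and another in the square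
    of the divisor bound; the first is what allows alpha > 2.

    Past level m only the separation of fractions with denominator below 2 Q is available. The
    resulting bound misses the exponent kappa, by an amount that is harmless because 12 (1 - kappa)
    <= 1.

    No limit measure is built. Against a given cover the words are chosen one after the other by
    averaging, with the relative cost of the cover below the current cylinder kept under a fixed
    bound, so that finite sums suffice. *)

Section ComplexExponentials.
Context {R : realType}.
Implicit Types (x y : R) (z u : R[i]).

(* The modulus of R[i] takes its values in R[i]; [nm] is its real version. *)
Definition nm z : R := complex.Re `|z|.

Definition ee x : R[i] := Complex (cos (2 * pi * x)) (sin (2 * pi * x)).
Arguments ee : simpl never.

Lemma nmE z : (nm z)%:C%C = `|z|.
Proof. by rewrite /nm normc_def. Qed.

Lemma nm_sqrt z : nm z = Num.sqrt (complex.Re z ^+ 2 + complex.Im z ^+ 2).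
Proof. by rewrite /nm normc_def. Qed.

Lemma nm_ge0 z : 0 <= nm z.
Proof. by rewrite nm_sqrt sqrtr_ge0. Qed.

Lemma nm_sqr z : nm z ^+ 2 = complex.Re z ^+ 2 + complex.Im z ^+ 2.
Proof. by rewrite nm_sqrt sqr_sqrtr// addr_ge0// sqr_ge0. Qed.

Lemma nm0 : nm 0 = 0.
Proof. by rewrite /nm normr0. Qed.

Lemma nm1 : nm 1 = 1.
Proof. by rewrite /nm normr1. Qed.

Lemma nmN z : nm (- z) = nm z.
Proof. by rewrite /nm normrN. Qed.

Lemma nmM z u : nm (z * u) = nm z * nm u.
Proof. by apply: complexI; rewrite rmorphM/= !nmE normrM. Qed.

Lemma nmD z u : nm (z + u) <= nm z + nm u.
Proof. by rewrite -lecR rmorphD/= !nmE ler_normD. Qed.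

Lemma nmB_ge z u : nm z - nm u <= nm (z - u).
Proof. by rewrite lerBlDr (le_trans _ (nmD _ _))// subrK. Qed.

Lemma nm_dist z u : `|nm z - nm u| <= nm (z - u).
Proof.
rewrite ler_norml nmB_ge andbT lerNl opprB.
by rewrite -(nmN (z - u)) opprB nmB_ge.
Qed.

Lemma nm_real x : nm x%:C%C = `|x|.
Proof. by rewrite nm_sqrt/= expr0n/= addr0 sqrtr_sqr. Qed.

Lemma nm_nat n : nm n%:R = n%:R.
Proof. by rewrite -(rmorph_nat (real_complex R)) nm_real normr_nat. Qed.

Lemma nm_sum (I : Type) (r : seq I) (P : pred I) (F : I -> R[i]) :
  nm (\sum_(i <- r | P i) F i) <= \sum_(i <- r | P i) nm (F i).
Proof.
elim/big_ind2: _ => [|z a u b za ub|//]; first by rewrite nm0.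
by rewrite (le_trans (nmD _ _))// lerD.
Qed.

Lemma nm_conj z : nm (z^*)%C = nm z.
Proof. by rewrite !nm_sqrt; case: z => a b /=; rewrite sqrrN. Qed.

Lemma nm_sqrC z : (nm z ^+ 2)%:C%C = z * (z^*)%C.
Proof. by rewrite rmorphXn/= nmE sqr_normc. Qed.

Lemma conjcM z u : ((z * u)^*)%C = (z^*)%C * (u^*)%C.
Proof. exact: rmorphM. Qed.

Lemma conjc_sum (I : Type) (r : seq I) (P : pred I) (F : I -> R[i]) :
  ((\sum_(i <- r | P i) F i)^*)%C = \sum_(i <- r | P i) ((F i)^*)%C.
Proof. exact: rmorph_sum. Qed.

Lemma eeD x y : ee (x + y) = ee x * ee y.
Proof.
rewrite /ee mulrDr cosD sinD; apply/eqP; rewrite eq_complex/=.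
by apply/andP; split; apply/eqP; ring.
Qed.

Lemma ee0 : ee 0 = 1.
Proof. by rewrite /ee mulr0 cos0 sin0. Qed.

Lemma ee1 : ee 1 = 1.
Proof. by rewrite /ee mulr1 mulr_natl cos2pi sin2pi. Qed.

Lemma eeN x : ee (- x) = ((ee x)^*)%C.
Proof. by rewrite /ee mulrN cosN sinN. Qed.

Lemma ee_mulrn n x : ee (n%:R * x) = ee x ^+ n.
Proof.
elim: n => [|n ih]; first by rewrite mul0r ee0.
by rewrite -natr1 mulrDl eeD mul1r ih exprSr.
Qed.

Lemma ee_nat n : ee n%:R = 1.
Proof. by rewrite -(mulr1 n%:R) ee_mulrn ee1 expr1n. Qed.

Lemma ee_addn x n : ee (x + n%:R) = ee x.
Proof. by rewrite eeD ee_nat mulr1. Qed.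

Lemma nm_ee x : nm (ee x) = 1.
Proof. by rewrite nm_sqrt/= cos2Dsin2 sqrtr1. Qed.

Lemma nm_eeB1 x : nm (ee x - 1) = 2 * `|sin (pi * x)|.
Proof.
rewrite nm_sqrt /ee/= subr0.
have -> : 2 * pi * x = (pi * x) *+ 2 by rewrite mulr2n; ring.
rewrite cos_mulr2n sin_mulr2n.
have -> : (cos (pi * x) ^+ 2 *+ 2 - 1 - 1) ^+ 2 +
    (cos (pi * x) * sin (pi * x) *+ 2) ^+ 2 = (2 * sin (pi * x)) ^+ 2.
  by have := cos2Dsin2 (pi * x); move: (cos _) (sin _) => c s h; nra.
by rewrite sqrtr_sqr normrM ger0_norm.
Qed.

Lemma ee_neq1 x : 0 < `|x| < 1 -> ee x != 1.
Proof.
move=> /andP[x0 x1]; rewrite -subr_eq0; apply/eqP => e0.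
have := nm_eeB1 x; rewrite e0 nm0 => /esym/eqP.
rewrite mulf_eq0 pnatr_eq0/= normr_eq0 => /eqP s0.
have : sin (pi * `|x|) = 0.
  by case: (ler0P x) => _ //; rewrite mulrN sinN s0 oppr0.
apply/eqP; rewrite gt_eqF// sin_gt0_pi// mulr_gt0 ?pi_gt0//=.
by rewrite gtr_pMr ?pi_gt0.
Qed.

Lemma ee_modn B X : (0 < B)%N -> ee ((X %% B)%:R / B%:R) = ee (X%:R / B%:R).
Proof.
move=> B0; rewrite [in RHS](divn_eq X B) natrD natrM mulrDl mulfK ?pnatr_eq0 -?lt0n//.
by rewrite addrC ee_addn.
Qed.

Lemma ee_diff_eq1 B X Y : (0 < B)%N ->
  (ee (X%:R / B%:R - Y%:R / B%:R) == 1) = (X == Y %[mod B]).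
Proof.
move=> B0; rewrite eeD eeN -[in LHS](ee_modn X B0) -[in LHS](ee_modn Y B0) -eeN -eeD.
have Xlt := ltn_pmod X B0; have Ylt := ltn_pmod Y B0.
case: (eqVneq (X %% B)%N (Y %% B)%N) => [->|neq]; first by rewrite subrr ee0 eqxx.
have B0' : 0 < B%:R :> R by rewrite ltr0n.
apply/negbTE/ee_neq1; rewrite -mulrBl normrM normfV (ger0_norm (ltW B0')).
rewrite divr_gt0// ?normr_gt0 ?subr_eq0 ?eqr_nat//=.
rewrite ltr_pdivrMr// mul1r ltr_norml.
have : (X %% B)%:R < B%:R :> R by rewrite ltr_nat.
have : (Y %% B)%:R < B%:R :> R by rewrite ltr_nat.
have := ler0n R (X %% B); have := ler0n R (Y %% B).
by move=> *; apply/andP; split; lra.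
Qed.

Lemma sum_root_of_unity z n : z ^+ n = 1 ->
  \sum_(i < n) z ^+ i = if z == 1 then n%:R else 0.
Proof.
move=> zn; case: eqVneq => [->|z1].
  by under eq_bigr do rewrite expr1n; rewrite sumr_const card_ord.
have /eqP := subrX1 z n; rewrite zn subrr eq_sym mulf_eq0 subr_eq0 (negbTE z1).
by move/eqP.
Qed.

Lemma sum_ee_diff B X Y : (0 < B)%N ->
  \sum_(n < B) ee (n%:R * (X%:R / B%:R - Y%:R / B%:R)) =
  if X == Y %[mod B] then B%:R else 0.
Proof.
move=> B0; under eq_bigr do rewrite ee_mulrn.
rewrite sum_root_of_unity ?ee_diff_eq1// -ee_mulrn mulrBr.
have B0' : B%:R != 0 :> R by rewrite pnatr_eq0 -lt0n.
by rewrite ![B%:R * _]mulrC !divfK// eeD eeN !ee_nat conjc1 mulr1.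
Qed.

(** Serves twice: with [B] = b for the energy of a fiber, with [B] = b^m for the variance over
    prefixes. *)
Lemma parseval B (u : 'I_B -> R[i]) : (0 < B)%N ->
  \sum_(w < B) nm (\sum_(a < B) u a * ee (a%:R * w%:R / B%:R)) ^+ 2 =
  B%:R * \sum_(a < B) nm (u a) ^+ 2.
Proof.
move=> B0; apply: complexI; rewrite rmorph_sum/= rmorphM rmorph_nat rmorph_sum/=.
under eq_bigr => w _.
  rewrite nm_sqrC conjc_sum big_distrlr/=.
  under eq_bigr => a _.
    under eq_bigr => c _.
      rewrite conjcM mulrACA -eeN -eeD.
      rewrite (_ : _ + _ = w%:R * (a%:R / B%:R - c%:R / B%:R)); last by ring.
      over.
    over.
  over.
rewrite exchange_big/= mulr_sumr; apply: eq_bigr => a _.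
rewrite exchange_big/= (bigD1 a)//= -mulr_sumr sum_ee_diff// eqxx.
rewrite nm_sqrC mulrC big1 ?addr0// => c ca.
rewrite -mulr_sumr sum_ee_diff// !modn_small//.
by rewrite eq_sym (inj_eq val_inj) (negbTE ca) mulr0.
Qed.

End ComplexExponentials.
Arguments ee : simpl never.

(** * Taylor bounds for sine and cosine, rational bounds for pi *)

Section TrigonometricBounds.
Context {R : realType}.
Implicit Types x y : R.

(** Drives the chain of Taylor bounds below: the derivative of each difference is the difference of
    the preceding bound. *)
Lemma ge0_from_derive (f df : R -> R) :
  (forall x, is_derive x 1 f (df x)) -> 0 <= f 0 ->
  (forall x, 0 <= x -> 0 <= df x) -> forall x, 0 <= x -> 0 <= f x.
Proof.
move=> fdf f0 df0 x; rewrite le_eqVlt => /predU1P[<- //|x0].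
have cf : {within `[0, x], continuous f}.
  apply: derivable_within_continuous => y _.
  by have [] := fdf y.
have [y /andP[y0 _] E] := MVT x0 (fun y _ => fdf y) cf.
rewrite -(subrK (f 0) (f x)) E addr_ge0// mulr_ge0 ?df0 ?subr0 ?(ltW x0)//.
exact: ltW.
Qed.

Lemma sin_le_id x : 0 <= x -> sin x <= x.
Proof.
move=> x0; rewrite -subr_ge0; move: x x0.
have d y : is_derive y 1 (fun x => x - sin x) ((fun x => 1 - cos x) y).
  exact: is_deriveB.
apply: (ge0_from_derive d); first by rewrite sin0 subrr lexx.
by move=> y _; rewrite subr_ge0 cos_le1.
Qed.

Lemma cos_ge2 x : 0 <= x -> 1 - x ^+ 2 / 2 <= cos x.
Proof.
move=> x0; rewrite -subr_ge0; move: x x0.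
have d y : is_derive y 1 (fun x => cos x - (1 - x ^+ 2 / 2))
  ((fun x => x - sin x) y).
  by apply: is_derive_eq; rewrite /GRing.scale/=; field.
apply: (ge0_from_derive d); first by rewrite cos0 expr0n/= mul0r subr0 subrr lexx.
by move=> y y0; rewrite subr_ge0 sin_le_id.
Qed.

Lemma sin_ge3 x : 0 <= x -> x - x ^+ 3 / 6 <= sin x.
Proof.
move=> x0; rewrite -subr_ge0; move: x x0.
have d y : is_derive y 1 (fun x => sin x - (x - x ^+ 3 / 6))
  ((fun x => cos x - (1 - x ^+ 2 / 2)) y).
  by apply: is_derive_eq; rewrite /GRing.scale/=; field.
apply: (ge0_from_derive d); first by rewrite sin0 expr0n/= mul0r subr0 subrr lexx.
by move=> y y0; rewrite subr_ge0 cos_ge2.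
Qed.

Lemma cos_le4 x : 0 <= x -> cos x <= 1 - x ^+ 2 / 2 + x ^+ 4 / 24.
Proof.
move=> x0; rewrite -subr_ge0; move: x x0.
have d y : is_derive y 1 (fun x => 1 - x ^+ 2 / 2 + x ^+ 4 / 24 - cos x)
  ((fun x => sin x - (x - x ^+ 3 / 6)) y).
  by apply: is_derive_eq; rewrite /GRing.scale/=; field.
apply: (ge0_from_derive d); first by rewrite cos0 !expr0n/= !mul0r subr0 addr0 subrr lexx.
by move=> y y0; rewrite subr_ge0 sin_ge3.
Qed.

Lemma sin_le5 x : 0 <= x -> sin x <= x - x ^+ 3 / 6 + x ^+ 5 / 120.
Proof.
move=> x0; rewrite -subr_ge0; move: x x0.
have d y : is_derive y 1 (fun x => x - x ^+ 3 / 6 + x ^+ 5 / 120 - sin x)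
  ((fun x => 1 - x ^+ 2 / 2 + x ^+ 4 / 24 - cos x) y).
  by apply: is_derive_eq; rewrite /GRing.scale/=; field.
apply: (ge0_from_derive d); first by rewrite sin0 !expr0n/= !mul0r subr0 addr0 subrr lexx.
by move=> y y0; rewrite subr_ge0 cos_le4.
Qed.

Lemma cos_ge6 x : 0 <= x -> 1 - x ^+ 2 / 2 + x ^+ 4 / 24 - x ^+ 6 / 120 / 6 <= cos x.
Proof.
move=> x0; rewrite -subr_ge0; move: x x0.
have d y : is_derive y 1 (fun x => cos x - (1 - x ^+ 2 / 2 + x ^+ 4 / 24 - x ^+ 6 / 120 / 6))
  ((fun x => x - x ^+ 3 / 6 + x ^+ 5 / 120 - sin x) y).
  by move: (120^-1 : R) => c; apply: is_derive_eq; rewrite /GRing.scale/=; field.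
apply: (ge0_from_derive d); first by rewrite cos0 !expr0n/= !mul0r subr0 addr0 subr0 subrr lexx.
by move=> y y0; rewrite subr_ge0 sin_le5.
Qed.

Lemma sin_ge7 x : 0 <= x -> x - x ^+ 3 / 6 + x ^+ 5 / 120 - x ^+ 7 / 120 / 6 / 7 <= sin x.
Proof.
move=> x0; rewrite -subr_ge0; move: x x0.
have d y : is_derive y 1 (fun x => sin x - (x - x ^+ 3 / 6 + x ^+ 5 / 120 - x ^+ 7 / 120 / 6 / 7))
  ((fun x => cos x - (1 - x ^+ 2 / 2 + x ^+ 4 / 24 - x ^+ 6 / 120 / 6)) y).
  rewrite (_ : 24^-1 = 5 * 120^-1); last by field.
  by move: (120^-1 : R) => c; apply: is_derive_eq; rewrite /GRing.scale/=; field.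
apply: (ge0_from_derive d); first by rewrite sin0 !expr0n/= !mul0r subr0 addr0 subr0 subrr lexx.
by move=> y y0; rewrite subr_ge0 cos_ge6.
Qed.

(* If the chord bound failed at x, the mean value theorem on both sides of x
   would contradict the monotonicity of the cosine. *)
Lemma jordan_ineq x : 0 <= x <= 2^-1 -> 2 * x <= sin (pi * x).
Proof.
move=> /andP[]; rewrite le_eqVlt => /predU1P[<- _|x0]; first by rewrite !mulr0 sin0.
rewrite le_eqVlt => /predU1P[->|x1]; first by rewrite divff// sin_pihalf.
rewrite leNgt; apply/negP => sx.
have d y : is_derive y 1 (fun y => sin (pi * y)) (pi * cos (pi * y)).
  by apply: is_derive_eq; rewrite /GRing.scale/=; ring.
have c u v : {within `[u, v], continuous (fun y => sin (pi * y))}.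
  by apply: derivable_within_continuous => y _; have [] := d y.
have [y + E] := MVT x0 (fun y _ => d y) (c _ _).
have [z + F] := MVT x1 (fun y _ => d y) (c _ _).
rewrite !in_itv/= => /andP[zx z1] /andP[y0 yx].
have p0 := @pi_gt0 R.
have : cos (pi * z) < cos (pi * y).
  have I (t : R) : 0 < t < 1 -> pi * t \in `[0, pi].
    move=> /andP[t0 t1]; rewrite in_itv/=.
    have a := mulr_gt0 p0 t0; have c1 : pi * t < pi * 1 by rewrite ltr_pM2l.
    by apply/andP; split; lra.
  have zI : pi * z \in `[0, pi] by apply: I; apply/andP; split; lra.
  have yI : pi * y \in `[0, pi] by apply: I; apply/andP; split; lra.
  by rewrite ltr_cos// ltr_pM2l// (lt_trans yx).
move: E F; rewrite mulr0 sin0 !subr0 sin_pihalf => E F.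
set u := cos (pi * z) in F *; set v := cos (pi * y) in E * => uv.
have : pi * v < 2 by rewrite -(ltr_pM2r x0) -E.
have : 2 < pi * u by rewrite -(@ltr_pM2r _ (2^-1 - x)) ?subr_gt0// -F; lra.
have : pi * u < pi * v by rewrite ltr_pM2l.
lra.
Qed.

Lemma sin_pi6 : sin (pi / 6) = 2^-1 :> R.
Proof.
set t := pi / 6; have s0 : 0 < sin t.
  by apply: sin_gt0_pi; rewrite /t; have := @pi_gt0 R; lra.
have : sin (t + (t + t)) = 1.
  by rewrite -sin_pihalf; congr (sin _); rewrite /t; lra.
rewrite !(sinD, cosD); have := cos2Dsin2 t.
move: (sin t) (cos t) s0 => s c s0 cs E.
have c2 : c ^+ 2 = 1 - s ^+ 2 by rewrite -cs addrK.
(* The triple angle formula gives 3 s - 4 s^3 = sin (pi / 2) = 1, and 4 s^3 - 3 s + 1 factors in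
   this way. *)
have : (s + 1) * (2 * s - 1) ^+ 2 = 0.
  have -> : (s + 1) * (2 * s - 1) ^+ 2 =
    1 - (s * (c * c - s * s) + c * (s * c + c * s)) + 3 * s * (c ^+ 2 - (1 - s ^+ 2)).
    by ring.
  by rewrite E c2 !subrr mulr0 addr0.
move/eqP; rewrite mulf_eq0 gt_eqF ?addr_gt0//= sqrf_eq0 subr_eq0 => /eqP h.
by apply: (@mulfI _ 2) => //; rewrite h divff.
Qed.

(** Both fractions are continued fraction convergents of pi. A sixth of each is compared with pi /
    6, whose sine is exactly 1/2, by Taylor polynomials of degree 5 and 7. *)
Lemma pi_bounds : 333 / 106 < (pi : R) < 355 / 113.
Proof.
have p0 := @pi_gt0 R; have p4 := @pihalf_lt2 R.
apply/andP; split; rewrite ltNge; apply/negP => h.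
- pose x : R := 333 / 636.
  have x0 : 0 <= x by rewrite /x; lra.
  have p6 : (pi / 6 : R) \in `[- (pi / 2), pi / 2]%R by rewrite in_itv/=; apply/andP; split; lra.
  have : sin (pi / 6) <= sin x.
    have xI : x \in `[- (pi / 2), pi / 2]%R.
      by rewrite in_itv/=; apply/andP; split; rewrite /x; have := @pi_ge2 R; lra.
    by rewrite leNgt ltr_sin// -leNgt /x; lra.
  rewrite sin_pi6; have := sin_le5 x0; rewrite /x; lra.
- pose x : R := 355 / 678.
  have x0 : 0 <= x by rewrite /x; lra.
  have p6 : (pi / 6 : R) \in `[- (pi / 2), pi / 2]%R by rewrite in_itv/=; apply/andP; split; lra.
  have : sin x <= sin (pi / 6).
    have xI : x \in `[- (pi / 2), pi / 2]%R.
      by rewrite in_itv/=; apply/andP; split; rewrite /x; have := @pi_ge2 R; lra.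
    by rewrite leNgt ltr_sin// -leNgt /x; lra.
  rewrite sin_pi6; have := sin_ge7 x0; rewrite /x; lra.
Qed.

End TrigonometricBounds.

Lemma sum_ord_mul (V : nmodType) m n (f : nat -> V) :
  \sum_(t < m * n) f t = \sum_(a < n) \sum_(i < m) f (a * m + i)%N.
Proof.
elim: n => [|n ih]; first by rewrite muln0 !big_ord0.
by rewrite big_ord_recr/= -ih mulnSr big_split_ord/= mulnC.
Qed.

Lemma sum_inv_sqr (R : realFieldType) n :
  \sum_(j < n) (j.+1%:R ^+ 2)^-1 <= 2 :> R.
Proof.
case: n => [|n]; first by rewrite big_ord0.
suff H : \sum_(j < n.+1) (j.+1%:R ^+ 2)^-1 <= 2 - (n.+1%:R)^-1 :> R.
  by rewrite (le_trans H)// gerBl invr_ge0 ler0n.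
elim: n => [|n ih]; first by rewrite big_ord_recl big_ord0 expr1n invr1 addr0; lra.
rewrite big_ord_recr/= (le_trans (lerD ih (lexx _)))//.
have x0 : 0 < n.+1%:R :> R by rewrite ltr0n.
rewrite -(natr1 n.+1); move: (n.+1%:R : R) x0 => x x0.
have x10 : 0 < x + 1 by lra.
have -> : x^-1 = (x + 1)^-1 + (x * (x + 1))^-1 by field; rewrite !gt_eqF.
suff : ((x + 1) ^+ 2)^-1 <= (x * (x + 1))^-1 by lra.
by rewrite lef_pV2 ?posrE ?exprn_gt0 ?mulr_gt0// expr2 ler_pM2r//; lra.
Qed.

(** * Exponential sums over words and Fourier expansion of tents *)

Section ExponentialSums.
Context {R : realType}.
Variables (b : nat) (Dl : seq nat).
Hypothesis b_gt1 : (1 < b)%N.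

(** A word is stored as the integer with these base b digits, first letter most significant;
    prefixes are then quotients by powers of b. *)
Fixpoint words l : seq nat :=
  if l is l'.+1 then [seq (v * b + d)%N | v <- words l', d <- Dl] else [:: 0%N].

Definition digit_sum (y : R) : R[i] := \sum_(d <- Dl) ee (d%:R * y).
Definition word_sum l (y : R) : R[i] := \sum_(v <- words l) ee (v%:R * y).

Lemma size_words l : size (words l) = (size Dl ^ l)%N.
Proof. by elim: l => //= l ih; rewrite size_allpairs ih expnSr. Qed.

Lemma word_sumS l y : word_sum l.+1 y = word_sum l (b%:R * y) * digit_sum y.
Proof.
rewrite /word_sum /= big_allpairs_dep big_distrl/=; apply: eq_bigr => v _.
rewrite big_distrr/=; apply: eq_bigr => d _.
by rewrite natrD natrM mulrDl eeD mulrA.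
Qed.

Lemma word_sum0 l : word_sum l 0 = (size Dl ^ l)%:R.
Proof.
rewrite /word_sum; under eq_bigr do rewrite mulr0 ee0.
by rewrite big_const_seq count_predT iter_addr_0 size_words.
Qed.

Lemma word_sum_addn l y n : word_sum l (y + n%:R) = word_sum l y.
Proof.
by apply: eq_bigr => v _; rewrite mulrDr -natrM ee_addn.
Qed.

Lemma word_sumN l y : word_sum l (- y) = ((word_sum l y)^*)%C.
Proof. by rewrite conjc_sum; apply: eq_bigr => v _; rewrite mulrN eeN. Qed.

Variable Phi : R.
Hypothesis digit_sum_le : forall x : R,
  \sum_(a < b) nm (digit_sum ((x + a%:R) / b%:R)) <= Phi.

Lemma Phi_ge0 : 0 <= Phi.
Proof. by apply: le_trans (digit_sum_le 0); apply: sumr_ge0 => a _; exact: nm_ge0. Qed.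

(** Peel off the last letter and write t = a b^l + t'. The factor of the first l letters does not
    see a, by periodicity, so the sum over a is a sum over one fiber. The shift x makes the bound
    available for every residue class of frequencies. *)
Lemma word_sum_l1 l x :
  \sum_(t < b ^ l) nm (word_sum l ((x + t%:R) / (b ^ l)%:R)) <= Phi ^+ l.
Proof.
have b0 : b%:R != 0 :> R by rewrite pnatr_eq0; case: b b_gt1.
elim: l x => [|l ih] x.
  rewrite expn0 big_ord_recl big_ord0 addr0 expr0 /word_sum/= big_seq1 mul0r ee0.
  by rewrite nm1.
rewrite expnSr (sum_ord_mul (b ^ l) b
  (fun t => nm (word_sum l.+1 ((x + t%:R) / (b ^ l * b)%:R)))).
rewrite exchange_big/= exprSr.
apply: le_trans (ler_wpM2r Phi_ge0 (ih x)); rewrite mulr_suml.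
apply: ler_sum => t _.
apply: le_trans (ler_wpM2l (nm_ge0 _) (digit_sum_le ((x + t%:R) / (b ^ l)%:R))).
rewrite mulr_sumr; apply: ler_sum => a _; rewrite word_sumS nmM.
have bl0 : (b ^ l)%:R != 0 :> R by rewrite natrX expf_neq0.
have -> : (x + (a * b ^ l + t)%:R) / (b ^ l * b)%:R =
    ((x + t%:R) / (b ^ l)%:R + a%:R) / b%:R.
  by rewrite natrD !natrM; field; apply/andP.
by rewrite [b%:R * _]mulrC divfK// word_sum_addn.
Qed.

Definition geom_sum H (y : R) : R[i] := \sum_(i < H) ee (i%:R * y).

(* The number of ways to write X as i - j modulo B with i, j < H: a discrete
   tent around the multiples of B, whose Fourier coefficients are squares of
   geometric sums. *)
Definition tent H B X : nat :=
  (\sum_(i < H) \sum_(j < H) (i == X + j %[mod B]))%N.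

Lemma geom_sum0 H : geom_sum H 0 = H%:R.
Proof.
rewrite /geom_sum; under eq_bigr do rewrite mulr0 ee0.
by rewrite sumr_const card_ord.
Qed.

Lemma nm_geom_sum_le H y : nm (geom_sum H y) <= H%:R.
Proof.
apply: le_trans (nm_sum _ _ _) _; under eq_bigr do rewrite nm_ee.
by rewrite sumr_const card_ord.
Qed.

Lemma geom_sumN H y : geom_sum H (- y) = ((geom_sum H y)^*)%C.
Proof. by rewrite conjc_sum; apply: eq_bigr => v _; rewrite mulrN eeN. Qed.

Lemma geom_sum_addn H y n : geom_sum H (y + n%:R) = geom_sum H y.
Proof. by apply: eq_bigr => v _; rewrite mulrDr -natrM ee_addn. Qed.

(** Characters detect the congruence; the sums over i and j then combine into a squared modulus, as
    for a Fejer kernel. *)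
Lemma tentE H B X : (0 < B)%N ->
  (tent H B X)%:R = B%:R^-1 *
    \sum_(n < B) ee (n%:R * (X%:R / B%:R)) *
                 ((nm (geom_sum H (n%:R / B%:R))) ^+ 2)%:C%C :> R[i].
Proof.
move=> B0; apply: (@mulfI _ B%:R); first by rewrite pnatr_eq0 -lt0n.
rewrite mulVKf ?pnatr_eq0 -?lt0n// /tent natr_sum mulr_sumr.
have E n : ee (n%:R * (X%:R / B%:R)) * ((nm (geom_sum H (n%:R / B%:R))) ^+ 2)%:C%C =
    \sum_(i < H) \sum_(j < H) ee (n%:R * ((X + j)%:R / B%:R - i%:R / B%:R)).
  rewrite nm_sqrC [geom_sum H _ * _]mulrC -geom_sumN /geom_sum big_distrlr/= mulr_sumr.
  apply: eq_bigr => i _; rewrite mulr_sumr; apply: eq_bigr => j _.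
  by rewrite -!eeD; congr (ee _); rewrite natrD; ring.
under [RHS]eq_bigr do rewrite E.
rewrite exchange_big/=; apply: eq_bigr => i _.
rewrite exchange_big/= natr_sum mulr_sumr; apply: eq_bigr => j _.
by rewrite sum_ee_diff// eq_sym; case: eqP; rewrite ?mulr1 ?mulr0.
Qed.

Lemma nm_geom_sum_small H (y : R) : 0 < y <= 2^-1 -> nm (geom_sum H y) <= (2 * y)^-1.
Proof.
move=> /andP[y0 y1].
have E : geom_sum H y * (ee y - 1) = ee (H%:R * y) - 1.
  rewrite /geom_sum; under eq_bigr do rewrite ee_mulrn.
  by rewrite mulrC -subrX1 ee_mulrn.
have : nm (geom_sum H y) * nm (ee y - 1) <= 2.
  rewrite -nmM E (le_trans (nmD _ _))// nmN nm_ee nm1; lra.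
have : 4 * y <= nm (ee y - 1).
  rewrite nm_eeB1 ger0_norm ?jordan_ineq ?(ltW y0)//.
    by have := @jordan_ineq R y; rewrite (ltW y0) y1 => /(_ isT); lra.
  by apply: le_trans (jordan_ineq _); rewrite ?mulr_ge0 ?(ltW y0).
have := nm_ge0 (geom_sum H y); move: (nm _) (nm _) => g e g0 h1 h2.
rewrite -[leRHS]mul1r ler_pdivlMr ?mulr_gt0//; nra.
Qed.

(* The decay of the square of the Fourier coefficients of [tent (h * q) B], in
   terms of the frequency N = n q. *)
Definition kern h B N : R := if (N < B)%N then h%:R ^+ 2 else (B%:R / N%:R / 2) ^+ 2.

Lemma kern_ge0 h B N : 0 <= kern h B N.
Proof. by rewrite /kern; case: ifP => _; rewrite sqr_ge0. Qed.

(** For half-width h q, both the trivial bound and the decay of the geometric sum, once divided by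
    q, depend on n and q only through n q. This is what allows the pairs to be regrouped by their
    product. *)
Lemma nm_geom_sum_kern h q B n : (0 < q)%N -> (0 < n)%N -> (n.*2 <= B)%N ->
  (nm (geom_sum (h * q) (n%:R / B%:R)) / q%:R) ^+ 2 <= kern h B (n * q).
Proof.
move=> q0 n0 nB; have q0' : 0 < q%:R :> R by rewrite ltr0n.
have n0' : 0 < n%:R :> R by rewrite ltr0n.
have B0 : 0 < B%:R :> R by rewrite ltr0n; lia.
rewrite /kern; case: ifP => _; rewrite lerXn2r ?nnegrE ?divr_ge0 ?nm_ge0 ?ler0n//.
  by rewrite ler_pdivrMr// -natrM nm_geom_sum_le.
rewrite ler_pdivrMr// (le_trans (nm_geom_sum_small _ _))//.
  rewrite divr_gt0//= ler_pdivrMr// ler_pdivlMl// -natrM ler_nat; lia.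
rewrite natrM le_eqVlt; apply/orP; left; apply/eqP; field.
by rewrite !gt_eqF.
Qed.

Section Count.
Variables (m l h L : nat) (Qs : seq nat) (Delta : R).
Hypothesis Qs_uniq : uniq Qs.
Hypothesis Qs_bd : forall q, q \in Qs -> (0 < q <= L)%N.
Let M := (b ^ m)%N.
Let B := (b ^ (m + l))%N.
Hypothesis Delta_ge : forall N, (0 < N < B * L)%N -> (size (divisors N))%:R <= Delta.

Hypothesis Delta_ge0 : 0 <= Delta.

Let b0 : (0 < b)%N. Proof. exact: ltnW. Qed.
Let M0 : (0 < M)%N. Proof. by rewrite expn_gt0 b0. Qed.
Let B0 : (0 < B)%N. Proof. by rewrite expn_gt0 b0. Qed.

(** A tent of half-width h q has mean (h q)^2 / B over Z/B, so the division by q^2 gives every q the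
    same share h^2 / B of the mean. *)
Definition tent_count w : R := \sum_(q <- Qs)
  \sum_(v <- words l) (tent (h * q) B (q * (w * b ^ l + v)))%:R / q%:R ^+ 2.

Definition mean_count : R := h%:R ^+ 2 * (size Qs)%:R * (size Dl)%:R ^+ l / B%:R.

Let g N : R := nm (word_sum l (N%:R / B%:R)) * kern h B N.

Let g_ge0 N : 0 <= g N.
Proof. by rewrite mulr_ge0 ?nm_ge0 ?kern_ge0. Qed.

Let Mbl : B = (M * b ^ l)%N. Proof. exact: expnD. Qed.

(** In a block of length B, the N congruent to a mod M are j B + t M + a with t < b^l, and N / B is
    (a / M + t) / b^l up to an integer: the l1 bound applies to each block. The kernel on block j >
    0 is at most 1 / j^2, and these sum to at most 2. *)
Let sum_residue a : (a < M)%N ->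
  \sum_(N < B * L | (N %% M == a)%N) g N <= (h%:R ^+ 2 + 2) * Phi ^+ l.
Proof.
move=> aM; pose f N : R := if (N %% M == a)%N then g N else 0.
have -> : \sum_(N < B * L | (N %% M == a)%N) g N = \sum_(N < B * L) f N.
  by rewrite big_mkcond.
pose c j : R := if j is j'.+1 then (j'.+1%:R ^+ 2)^-1 else h%:R ^+ 2.
have c0 j : 0 <= c j by case: j => [|j]; rewrite ?invr_ge0 sqr_ge0.
have BR : 0 < B%:R :> R by rewrite ltr0n.
have K j N : kern h B (j * B + N) <= c j \/ (j = 0%N /\ (B <= N)%N).
  case: j => [|j]; rewrite /kern/=.
    by rewrite mul0n; case: ltnP => h1; [left|right].
  left; rewrite ifF; last by apply/negbTE; rewrite -leqNgt; nia.
  have j0 : 0 < j.+1%:R :> R by rewrite ltr0n.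
  rewrite -exprVn lerXn2r ?nnegrE ?divr_ge0 ?invr_ge0 ?ler0n//.
  have T0 : 0 < (j.+1 * B + N)%:R :> R by rewrite ltr0n; nia.
  have T1 : j.+1%:R * B%:R <= (j.+1 * B + N)%:R :> R by rewrite -natrM ler_nat; lia.
  rewrite -[leRHS]mul1r ler_pdivlMr// mulrAC ler_pdivrMr// mulrAC ler_pdivrMr//.
  by rewrite mul1r mulrC (le_trans T1)// ler_pMl// ler1n.
rewrite sum_ord_mul.
have -> : (h%:R ^+ 2 + 2) * Phi ^+ l = h%:R ^+ 2 * Phi ^+ l + 2 * Phi ^+ l.
  by rewrite mulrDl.
have P0 : 0 <= Phi ^+ l by rewrite exprn_ge0// Phi_ge0.
have SB (F : nat -> R) : \sum_(i < B) F i = \sum_(t < b ^ l) \sum_(i < M) F (t * M + i)%N.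
  by rewrite -(sum_ord_mul M (b ^ l) F) Mbl.
have S j : \sum_(i < B) f (j * B + i)%N <= c j * Phi ^+ l.
  rewrite (SB (fun i => f (j * B + i)%N)).
  apply: le_trans (ler_wpM2l (c0 j) (word_sum_l1 l (a%:R / M%:R))).
  rewrite mulr_sumr; apply: ler_sum => t _.
  have EN i : (j * B + (t * M + i) = (j * b ^ l + t) * M + i)%N by rewrite Mbl; ring.
  rewrite (bigD1 (Ordinal aM))//= big1 ?addr0; last first.
    move=> i ia; rewrite /f ifF// EN modnMDl modn_small//.
    by apply/negbTE; move: ia; rewrite -val_eqE.
  rewrite /f ifT; last by rewrite EN modnMDl modn_small.
  rewrite /g mulrC ler_pM ?nm_ge0 ?kern_ge0//.
    case: (K j (t * M + a)%N) => // -[_]; rewrite leqNgt => /negP; case.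
    rewrite Mbl [(M * _)%N]mulnC; have := ltn_ord t; nia.
  rewrite le_eqVlt; apply/orP; left; apply/eqP; congr nm.
  rewrite -[RHS](word_sum_addn l _ j); congr word_sum.
  have Mn : M%:R != 0 :> R by rewrite pnatr_eq0 -lt0n.
  have bn : (b ^ l)%:R != 0 :> R by rewrite pnatr_eq0 -lt0n expn_gt0 b0.
  by rewrite !natrD !natrM Mbl natrM; field; apply/andP.
apply: (@le_trans _ _ (\sum_(j < L) c j * Phi ^+ l)).
  by apply: ler_sum => j _; exact: S.
rewrite -mulr_suml -mulrDl ler_wpM2r//.
suff H L' : \sum_(j < L') c j <= h%:R ^+ 2 + 2 by exact: H.
case: L' => [|L']; first by rewrite big_ord0 addr_ge0 ?sqr_ge0.
by rewrite big_ord_recl lerD//= sum_inv_sqr.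
Qed.

(** Regrouping by N = n q costs a divisor count, since q divides N and determines n. *)
Let pair_sum a : (a < M)%N ->
  \sum_(q <- Qs) \sum_(n < B | (0 < n)%N && ((n * q) %% M == a)%N) g (n * q) <=
  Delta * ((h%:R ^+ 2 + 2) * Phi ^+ l).
Proof.
move=> aM.
have cnt N : (0 < N)%N ->
    (\sum_(q <- Qs) \sum_(n < B) ((0 < n) && (N == n * q)) <= size (divisors N))%N.
  move=> N0; apply: (@leq_trans (\sum_(q <- Qs) (q \in divisors N))%N).
    rewrite !big_seq; apply: leq_sum => q /Qs_bd /andP[q0 _].
    case: (pickP (fun n : 'I_B => (0 < n)%N && (N == n * q)%N)) => [n /andP[n0 /eqP E]|none].
      rewrite (bigD1 n)//= n0 E eqxx big1 => [|i ni].
        by rewrite -E -dvdn_divisors// E dvdn_mull.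
      by rewrite eqn_pmul2r// eq_sym (inj_eq val_inj) (negbTE ni) andbF.
    by rewrite big1// => i _; rewrite none.
  rewrite -big_mkcond/= sum1_count -size_filter uniq_leq_size ?filter_uniq//.
  by move=> q; rewrite mem_filter => /andP[].
have E q (n : 'I_B) : q \in Qs ->
    (if (0 < n)%N && ((n * q) %% M == a)%N then g (n * q) else 0) =
    \sum_(N < B * L | (N %% M == a)%N) ((0 < n)%N && (N == n * q :> nat)%N)%:R * g N.
  move=> /Qs_bd /andP[q0 qL].
  case: posnP => [n0|n0]; first by rewrite big1// => N _; rewrite mul0r.
  have nqL : (n * q < B * L)%N by have := ltn_ord n; nia.
  case: ifP => /= nqa; last first.
    rewrite big1// => N /eqP Na; case: eqP => [Nnq|]; last by rewrite mul0r.
    by move: nqa; rewrite -Nnq Na eqxx.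
  rewrite (bigD1 (Ordinal nqL))//= eqxx mul1r big1 ?addr0// => N /andP[_].
  by rewrite -val_eqE/= => /negbTE ->; rewrite mul0r.
rewrite big_seq; under eq_bigr => q qQ.
  rewrite big_mkcond; under eq_bigr => n _ do rewrite E//.
  over.
rewrite -big_seq; under eq_bigr do rewrite exchange_big.
rewrite exchange_big/=; apply: le_trans (ler_wpM2l Delta_ge0 (sum_residue aM)).
rewrite mulr_sumr; apply: ler_sum => N _.
under eq_bigr do rewrite -mulr_suml -natr_sum.
rewrite -mulr_suml -natr_sum ler_wpM2r//.
have [N0|N0] := posnP N; last first.
  apply: (@le_trans _ _ (size (divisors N))%:R); first by rewrite ler_nat cnt.
  by apply: Delta_ge; rewrite N0 ltn_ord.
rewrite big_seq big1 // => q /Qs_bd /andP[q0 _]; rewrite big1// => n _.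
by rewrite N0; case: posnP => //= n0; rewrite eq_sym muln_eq0 !gtn_eqF.
Qed.

Let coef a : R[i] := \sum_(q <- Qs) \sum_(n < B | (0 < n)%N && ((n * q) %% M == a)%N)
  word_sum l ((n * q)%:R / B%:R) *
  ((nm (geom_sum (h * q) (n%:R / B%:R)) / q%:R) ^+ 2 / B%:R)%:C%C.

(** The kernel bound needs n <= B / 2. The other frequencies are reflected to B - n, which
    conjugates both exponential sums and exchanges the class of a with that of -a; hence the factor
    2. *)
Let coef_le a : (a < M)%N ->
  nm (coef a) <= 2 * (Delta * ((h%:R ^+ 2 + 2) * Phi ^+ l)) / B%:R.
Proof.
move=> aM; pose a' := ((M - a) %% M)%N.
have a'M : (a' < M)%N by rewrite ltn_mod.
have BR : 0 < B%:R :> R by rewrite ltr0n.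
rewrite ler_pdivlMr// mulrC mulrDl mul1r.
apply: le_trans (lerD (pair_sum aM) (pair_sum a'M)); rewrite -big_split/=.
apply: (@le_trans _ _ (\sum_(q <- Qs) B%:R *
  nm (\sum_(n < B | (0 < n)%N && ((n * q) %% M == a)%N)
  word_sum l ((n * q)%:R / B%:R) *
  ((nm (geom_sum (h * q) (n%:R / B%:R)) / q%:R) ^+ 2 / B%:R)%:C%C))).
  by rewrite -mulr_sumr ler_wpM2l ?ler0n// nm_sum.
rewrite !big_seq; apply: ler_sum => q /Qs_bd /andP[q0 qL].
have Rv : \sum_(n < B | (0 < n)%N && ((n * q) %% M == a)%N) g ((B - n) * q) <=
          \sum_(n < B | (0 < n)%N && ((n * q) %% M == a')%N) g (n * q).
  have phi_lt (n : 'I_B) : ((B - n) %% B < B)%N by rewrite ltn_mod.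
  pose phi (n : 'I_B) := Ordinal (phi_lt n).
  have phiE (n : 'I_B) : (0 < n)%N -> phi n = (B - n)%N :> nat.
    by move=> n0; rewrite /= modn_small//; lia.
  have phi_inj : injective phi.
    apply: (can_inj (g := phi)) => n; apply: val_inj => /=.
    have nB := ltn_ord n; have [n0|n0] := posnP n.
      by rewrite n0 subn0 modnn subn0 modnn.
    by rewrite [((B - n) %% B)%N]modn_small ?modn_small; lia.
  rewrite [leRHS](reindex_inj phi_inj) [leLHS]big_mkcond [leRHS]big_mkcond/=.
  apply: ler_sum => n _; case: ifP => [/andP[n0 na]|_]; last by case: ifP.
  have nB := ltn_ord n; have := phiE n n0; rewrite /= => ->.
  rewrite ifT// subn_gt0 nB/= /a'.
  rewrite -[X in _ == X]/((M - a) %% M)%N -(eqn_modDr (n * q)) -mulnDl subnK ?(ltnW nB)//.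
  by rewrite -modnDmr (eqP na) subnK ?(ltnW aM)// modnn Mbl mulnAC -mulnA modnMr.
apply: le_trans (lerD (lexx _) Rv); rewrite -big_split/=.
apply: le_trans (ler_wpM2l _ (nm_sum _ _ _)) _; first exact: ltW.
rewrite mulr_sumr; apply: ler_sum => n /andP[n0 _].
rewrite nmM nm_real ger0_norm ?divr_ge0 ?sqr_ge0 ?ler0n//.
rewrite mulrCA [B%:R * _]mulrC divfK ?gt_eqF//.
have [nB|Bn] := leqP n.*2 B.
  by rewrite -[leLHS]addr0 lerD// ler_wpM2l ?nm_ge0// nm_geom_sum_kern.
have nB := ltn_ord n.
rewrite -[leLHS]add0r lerD// /g.
have Bn0 : B%:R != 0 :> R by rewrite gt_eqF.
have -> : n%:R / B%:R = - ((B - n)%:R / B%:R) + 1%:R :> R.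
  by rewrite natrB ?(ltnW nB)//; field.
have -> : (n * q)%:R / B%:R = - (((B - n) * q)%:R / B%:R) + q%:R :> R.
  by rewrite !natrM natrB ?(ltnW nB)//; field.
rewrite word_sum_addn word_sumN nm_conj geom_sum_addn geom_sumN nm_conj.
rewrite ler_wpM2l ?nm_ge0// nm_geom_sum_kern//; lia.
Qed.

(** The frequency n = 0 is the mean. In the others the prefix enters only through e(n q w / M), so
    terms are collected by the residue of n q mod M. *)
Let tent_countE w : (tent_count w - mean_count)%:C%C =
  \sum_(a < M) coef a * ee (a%:R * w%:R / M%:R).
Proof.
have BC : B%:R != 0 :> R[i] by rewrite pnatr_eq0 -lt0n.
have BR : B%:R != 0 :> R by rewrite pnatr_eq0 -lt0n.
have BE : B%:R = M%:R * (b ^ l)%:R :> R by rewrite -natrM -Mbl.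
have MR : M%:R != 0 :> R by rewrite pnatr_eq0 -lt0n.
have bl0 : (b ^ l)%:R != 0 :> R by rewrite pnatr_eq0 -lt0n expn_gt0 b0.
pose S q (n : nat) : R[i] := word_sum l ((n * q)%:R / B%:R) *
  ((nm (geom_sum (h * q) (n%:R / B%:R)) / q%:R) ^+ 2 / B%:R)%:C%C.
have E q : q \in Qs ->
    (\sum_(v <- words l) (tent (h * q) B (q * (w * b ^ l + v)))%:R / q%:R ^+ 2)%:C%C =
    (h%:R ^+ 2 * (size Dl)%:R ^+ l / B%:R)%:C%C +
    \sum_(n < B | (0 < n)%N) S q n * ee ((n * q)%:R * w%:R / M%:R).
  move=> /Qs_bd /andP[q0 _].
  have qR : q%:R != 0 :> R by rewrite pnatr_eq0 -lt0n.
  have -> : (h%:R ^+ 2 * (size Dl)%:R ^+ l / B%:R)%:C%C =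
      S q 0%N * ee ((0 * q)%:R * w%:R / M%:R).
    rewrite /S mul0n !mul0r word_sum0 ee0 mulr1 geom_sum0 nm_nat natrM.
    rewrite -(rmorph_nat (real_complex R)) -rmorphM; congr (_%:C%C).
    by rewrite natrX; field; apply/andP.
  transitivity (\sum_(n < B) S q n * ee ((n * q)%:R * w%:R / M%:R)); last first.
    rewrite (bigD1 (Ordinal B0))//=; congr (_ + _); apply: eq_bigl => n.
    by rewrite -val_eqE/= lt0n.
  have T v : ((tent (h * q) B (q * (w * b ^ l + v)))%:R / q%:R ^+ 2)%:C%C =
      \sum_(n < B) ee (v%:R * ((n * q)%:R / B%:R)) *
        (((nm (geom_sum (h * q) (n%:R / B%:R)) / q%:R) ^+ 2 / B%:R)%:C%C *
         ee ((n * q)%:R * w%:R / M%:R)).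
    rewrite rmorphM rmorph_nat tentE// -mulrA mulr_suml mulr_sumr.
    apply: eq_bigr => n _.
    have -> : n%:R * ((q * (w * b ^ l + v))%:R / B%:R) =
        v%:R * ((n * q)%:R / B%:R) + (n * q)%:R * w%:R / M%:R :> R.
      by rewrite !(natrM, natrD) BE; field; apply/andP.
    rewrite eeD; set e1 := ee _; set e2 := ee _; set G := nm _.
    have -> : ((G / q%:R) ^+ 2 / B%:R)%:C%C =
        B%:R^-1 * (G ^+ 2)%:C%C * (q%:R ^- 2)%:C%C :> R[i].
      rewrite -(rmorph_nat (real_complex R) B) -fmorphV -!rmorphM; congr (_%:C%C).
      by rewrite /=; field; apply/andP.
    by ring.
  transitivity (\sum_(v <- words l) \sum_(n < B) ee (v%:R * ((n * q)%:R / B%:R)) *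
        (((nm (geom_sum (h * q) (n%:R / B%:R)) / q%:R) ^+ 2 / B%:R)%:C%C *
         ee ((n * q)%:R * w%:R / M%:R))).
    by rewrite rmorph_sum; apply: eq_bigr => v _; exact: T.
  rewrite exchange_big/=.
  by apply: eq_bigr => n _; rewrite -mulr_suml mulrA.
transitivity ((tent_count w)%:C%C - (mean_count)%:C%C); first exact: rmorphB.
have -> : (tent_count w)%:C%C =
    \sum_(q <- Qs) ((h%:R ^+ 2 * (size Dl)%:R ^+ l / B%:R)%:C%C +
      \sum_(n < B | (0 < n)%N) S q n * ee ((n * q)%:R * w%:R / M%:R)).
  by rewrite rmorph_sum big_seq [RHS]big_seq; apply: eq_bigr => q qQ; exact: E.
rewrite big_split/=.
have -> : (mean_count)%:C%C = \sum_(q <- Qs) (h%:R ^+ 2 * (size Dl)%:R ^+ l / B%:R)%:C%C.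
  rewrite big_const_seq count_predT iter_addr_0 /mean_count -rmorphMn; congr (_%:C%C).
  by rewrite -mulr_natr; ring.
rewrite addrAC subrr add0r /coef.
under [RHS]eq_bigr do rewrite mulr_suml.
rewrite [RHS]exchange_big/=; apply: eq_bigr => q _.
rewrite (partition_big (fun n : 'I_B => Ordinal (ltn_pmod (n * q) M0)) xpredT)//=.
apply: eq_bigr => a _; rewrite mulr_suml; apply: eq_big => [n|n /andP[_]].
  by rewrite -val_eqE.
rewrite -val_eqE/= => /eqP <-; congr (_ * _).
by rewrite -!natrM -[LHS]ee_modn// -[RHS]ee_modn// modnMml.
Qed.

(** Parseval on Z/M, then the uniform bound on each of the M coefficients. For m = 0 this bounds the
    deviation of a single count; heavy words and the covers of the upper bound are counted in that
    way. *)
Theorem tent_count_l2 : \sum_(w < M) (tent_count w - mean_count) ^+ 2 <=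
  (M%:R * (2 * (Delta * ((h%:R ^+ 2 + 2) * Phi ^+ l)) / B%:R)) ^+ 2.
Proof.
have E (w : 'I_M) : (tent_count w - mean_count) ^+ 2 =
    nm (\sum_(a < M) coef a * ee (a%:R * w%:R / M%:R)) ^+ 2.
  by rewrite -tent_countE nm_real real_normK// num_real.
rewrite (eq_bigr _ (fun w _ => E w)) parseval//.
rewrite exprMn expr2 -mulrA ler_wpM2l ?ler0n//.
apply: (@le_trans _ _ (\sum_(a < M)
  (2 * (Delta * ((h%:R ^+ 2 + 2) * Phi ^+ l)) / B%:R) ^+ 2)).
  apply: ler_sum => a _.
  have := coef_le (ltn_ord a); have := nm_ge0 (coef a).
  by move=> h1 h2; rewrite lerXn2r ?nnegrE// (le_trans h1).
by rewrite sumr_const card_ord -[leLHS]mulr_natl.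
Qed.

End Count.
End ExponentialSums.

Section Tent.

Lemma sum_ltn_ord n q : (q <= n)%N -> (\sum_(j < n) (j < q))%N = q.
Proof.
move=> qn; transitivity (\sum_(j < q) 1)%N; last by rewrite sum_nat_const card_ord muln1.
rewrite (big_ord_widen n (fun=> 1%N) qn) [RHS]big_mkcond/=.
by apply: eq_bigr => j _; case: ltnP.
Qed.

Lemma tent_le H B X : (H <= B)%N -> (tent H B X <= H)%N.
Proof.
move=> HB; rewrite /tent exchange_big -[leqRHS]card_ord -sum1_card.
apply: leq_sum => j _.
case: (pickP (fun i : 'I_H => (i == X + j %[mod B])%N)) => [i iE|none]; last first.
  by rewrite big1// => i _; rewrite none.
rewrite (bigD1 i)//= iE big1// => k ki; rewrite -(eqP iE) !modn_small ?(leq_trans _ HB)//.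
by rewrite -val_eqE/= in ki; rewrite (negbTE ki).
Qed.

Lemma tent_gt0 H B X : (H <= B)%N -> (0 < tent H B X)%N ->
  exists p, (X < B * p + H)%N /\ (B * p < X + H)%N.
Proof.
move=> HB; case: (pickP (fun ij : 'I_H * 'I_H => (ij.1 == X + ij.2 %[mod B])%N)).
  2: by move=> none; rewrite /tent big1// => i _; rewrite big1// => j _; rewrite (none (i, j)).
move=> [i j]/= /eqP + _.
have iH := ltn_ord i; have jH := ltn_ord j.
rewrite modn_small ?(leq_trans iH)// => E; exists ((X + j) %/ B)%N.
have := divn_eq (X + j) B; rewrite -E mulnC; lia.
Qed.

(** At distance less than 2 q from its peak, a tent of half-width 3 q still has height at least q.
    Hence h = 3 wherever no word near a fraction may be missed, and h = 1 where words near fractions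
    are to be produced. *)
Lemma tent_ge q B X p : (X < B * p + 2 * q)%N -> (B * p < X + 2 * q)%N ->
  (q <= tent (3 * q) B X)%N.
Proof.
move=> h1 h2; have le3 : (q <= 3 * q)%N by lia.
have [Xp|Xp] := leqP (B * p) X.
- rewrite /tent exchange_big -[leqLHS](sum_ltn_ord le3).
  apply: leq_sum => j _; case: ltnP => // jq.
  have iH : (X - B * p + j < 3 * q)%N by lia.
  have E : (X + j = p * B + (X - B * p + j))%N by lia.
  by rewrite (bigD1 (Ordinal iH))//= E modnMDl eqxx.
- rewrite /tent -[leqLHS](sum_ltn_ord le3).
  apply: leq_sum => i _; case: ltnP => // iq.
  have jH : (B * p - X + i < 3 * q)%N by lia.
  have E : (X + (B * p - X + i) = p * B + i)%N by lia.
  by rewrite (bigD1 (Ordinal jH))//= E modnMDl eqxx.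
Qed.

End Tent.

(** * Words, prefixes and concatenation *)

Section Words.
Variables (b : nat) (Dl : seq nat).
Hypothesis b_gt1 : (1 < b)%N.
Hypothesis Dl_uniq : uniq Dl.
Hypothesis Dl_lt : forall d, d \in Dl -> (d < b)%N.
Let b0 : (0 < b)%N. Proof. exact: ltnW. Qed.
Let words := words b Dl.

Lemma mem_wordsS l v : (v \in words l.+1) = (v %/ b \in words l)%N && (v %% b \in Dl)%N.
Proof.
apply/allpairsP/andP => [[[u d]/= [ul dD ->]]|[vl vD]].
  have dlt := Dl_lt dD; rewrite divnMDl// divn_small// addn0.
  by rewrite modnMDl modn_small.
by exists (v %/ b, v %% b)%N; split=> //=; rewrite -divn_eq.
Qed.

Lemma words_lt l v : v \in words l -> (v < b ^ l)%N.
Proof.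
elim: l v => [|l ih] v; first by rewrite inE => /eqP ->.
rewrite mem_wordsS => /andP[/ih vl _].
by rewrite expnSr -ltn_divLR// b0.
Qed.

Lemma words_uniq l : uniq (words l).
Proof.
elim: l => //= l ih; apply: allpairs_uniq => // -[u d] [u' d'].
move=> /allpairsP[[x y]/= [_ yD [-> ->]]] /allpairsP[[x' y']/= [_ yD' [-> ->]]] /= E.
have := congr1 (modn^~ b) E; rewrite /= !modnMDl !modn_small ?Dl_lt// => ->.
have := congr1 (divn^~ b) E; rewrite /= !divnMDl// !divn_small ?Dl_lt// !addn0.
by move=> ->.
Qed.

Lemma big_words_add (V : nmodType) m l (f : nat -> V) :
  \sum_(v <- words (m + l)) f v =
  \sum_(w <- words m) \sum_(v <- words l) f (w * b ^ l + v)%N.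
Proof.
elim: l f => [|l ih] f.
  rewrite addn0; apply: eq_bigr => w _; rewrite big_seq1 expn0 muln1 addn0//.
rewrite addnS /words/= big_allpairs_dep ih; apply: eq_bigr => w _.
rewrite big_allpairs_dep; apply: eq_bigr => v _; apply: eq_bigr => d _.
by congr f; rewrite expnS; ring.
Qed.

Lemma mem_words_cat m l w v :
  w \in words m -> v \in words l -> (w * b ^ l + v)%N \in words (m + l).
Proof.
move=> wm; elim: l v => [|l ih] v.
  by rewrite inE => /eqP ->; rewrite addn0 expn0 muln1 addn0.
rewrite mem_wordsS => /andP[vl vd].
have -> : (w * b ^ l.+1 + v = (w * b ^ l + v %/ b) * b + v %% b)%N.
  by rewrite {1}(divn_eq v b) expnS; ring.
by rewrite addnS; apply/allpairsP; exists (w * b ^ l + v %/ b, v %% b)%N; split => //=; exact: ih.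
Qed.

Lemma words_prefix m l v : v \in words (m + l) -> (v %/ b ^ l)%N \in words m.
Proof.
elim: l v => [|l ih] v; first by rewrite addn0 expn0 divn1.
by rewrite addnS mem_wordsS expnS divnMA => /andP[/ih].
Qed.

End Words.

(** * The divisor bound *)

Section Divisors.

Lemma size_divisors_pfactor p a M : prime p -> (0 < M)%N ->
  (size (divisors (p ^ a * M)) <= a.+1 * size (divisors M))%N.
Proof.
move=> pp M0; have N0 : (0 < p ^ a * M)%N by rewrite muln_gt0 expn_gt0 prime_gt0.
rewrite -[a.+1 in leqRHS](size_iota 0) -(size_allpairs (fun i d => p ^ i * d)%N).
apply: uniq_leq_size => [|d]; first exact: divisors_uniq.
rewrite -dvdn_divisors// => dN.
have d0 : (0 < d)%N by exact: dvdn_gt0 dN.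
(* d = p^i e: distribute p^(min i a) to the first factor *)
have [e pe dE] := pfactor_coprime pp d0.
set i := logn p d in dE.
apply/allpairsP; exists (minn i a, p ^ (i - a) * e)%N; split=> /=.
- by change (minn i a \in iota 0 a.+1); rewrite mem_iota/= add0n ltnS geq_minr.
- rewrite -dvdn_divisors//; move: dN; rewrite dE.
  case: (leqP i a) => [ia|ai].
    move=> h; rewrite (eqP (_ : i - a == 0)%N) ?subn_eq0// expn0 mul1n.
    have : (e %| p ^ a * M)%N by apply: dvdn_trans h; rewrite dvdn_mulr.
    by rewrite Gauss_dvdr// coprime_sym coprimeXl.
  rewrite -{1}(subnKC (ltnW ai)) expnD mulnCA dvdn_pmul2l ?expn_gt0 ?prime_gt0//.
  by rewrite mulnC.
- rewrite dE mulnA -expnD mulnC; congr (_ ^ _ * _)%N; case: (leqP i a); lia.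
Qed.

Context {R : realType}.

(** A prime power p^a contributes a + 1. If p^eps >= 2 then a + 1 <= 2^a <= p^(a eps) at no cost;
    each of the finitely many smaller primes costs one factor [C0]. *)
Lemma divisor_bound (eps : R) : 0 < eps -> exists2 C : R, 0 <= C &
  forall N, (0 < N)%N -> (size (divisors N))%:R <= C * N%:R `^ eps.
Proof.
move=> e0.
have l2 : 0 < ln (2 : R) by rewrite ln_gt0// ltr1n.
pose C0 : R := Num.max 1 (eps * ln 2)^-1.
have C01 : 1 <= C0 by rewrite le_max lexx.
have two_pow n a : (1 < n)%N -> 1 + a%:R * (eps * ln 2) <= (n ^ a)%:R `^ eps.
  move=> n1; apply: (@le_trans _ _ (2 `^ eps ^+ a)).
    rewrite /powR pnatr_eq0/= -expRM_natl.
    apply: le_trans (expR_ge1Dx _) _; rewrite ler_expR; lra.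
  rewrite natrX -powR_mulrn ?powR_ge0// -powRrM mulrC powRrM powR_mulrn//.
  by rewrite ge0_ler_powR ?nnegrE ?exprn_ge0 ?(ltW e0)// lerXn2r ?nnegrE ?ler_nat.
have small n a : (1 < n)%N -> a.+1%:R <= C0 * (n ^ a)%:R `^ eps.
  move=> n1; apply: le_trans (ler_wpM2l (le_trans ler01 C01) (two_pow n a n1)).
  rewrite -natr1 mulrDr mulr1 addrC lerD// mulrCA -[leLHS]mulr1 ler_wpM2l//.
  by rewrite -ler_pdivrMr ?mulr_gt0// mul1r le_max lexx orbT.
have [P PP] : exists P : nat, forall n, (P <= n)%N -> 2 <= n%:R `^ eps.
  exists (Num.trunc (2 `^ eps^-1 : R)).+1 => n Pn.
  have h : 2 `^ eps^-1 <= n%:R :> R.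
    by rewrite (le_trans (ltW (truncnS_gt _)))// ler_nat.
  have : (2 `^ eps^-1) `^ eps <= n%:R `^ eps.
    by rewrite ge0_ler_powR ?nnegrE ?powR_ge0// ltW.
  by rewrite -powRrM mulVf ?gt_eqF// powRr1.
have large n a : (P <= n)%N -> a.+1%:R <= (n ^ a)%:R `^ eps.
  move=> Pn; apply: (@le_trans _ _ (2 ^+ a)).
    by rewrite -natrX ler_nat ltn_expl.
  rewrite natrX -powR_mulrn// -powRrM mulrC powRrM powR_mulrn ?powR_ge0//.
  by rewrite lerXn2r ?nnegrE ?powR_ge0//; exact: PP.
(* Induction on a strict bound for the prime factors; [minn n P] bounds how many of them can cost a
   factor [C0]. *)
have S n : forall N, (0 < N)%N -> (forall p, prime p -> (p %| N)%N -> (p < n)%N) ->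
    (size (divisors N))%:R <= C0 ^+ minn n P * N%:R `^ eps.
  elim: n => [|n ih] N N0 Np.
    have -> : N = 1%N.
      apply/eqP; apply: contraT => N1.
      have N2 : (1 < N)%N by case: N N0 N1 {Np} => [|[]].
      by have := Np _ (pdiv_prime N2) (pdiv_dvd N).
    by rewrite min0n expr0 mul1r powR1.
  have [pn|npn] := boolP (prime n); last first.
    apply: le_trans (ih N N0 _) _.
      move=> p pp pN; have := Np p pp pN; rewrite ltnS leq_eqVlt => /predU1P[E|//].
      by rewrite -E pp in npn.
    rewrite ler_wpM2r ?powR_ge0// ler_weXn2l//; lia.
  have [M pM NE] := pfactor_coprime pn N0.
  set a := logn n N in NE.
  have M0 : (0 < M)%N by rewrite lt0n; apply: contraTneq N0 => M0; rewrite NE M0.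
  have h : (size (divisors M))%:R <= C0 ^+ minn n P * M%:R `^ eps.
    apply: ih => // p pp pM'.
    have : (p < n.+1)%N by apply: Np => //; rewrite NE dvdn_mulr.
    rewrite ltnS leq_eqVlt => /predU1P[E|//]; move: pM; rewrite -E.
    by rewrite prime_coprime// pM'.
  have NE' : N = (n ^ a * M)%N by rewrite NE mulnC.
  have h2 : (size (divisors N))%:R <= a.+1%:R * (size (divisors M))%:R :> R.
    by rewrite -natrM ler_nat NE' size_divisors_pfactor.
  apply: le_trans h2 _; rewrite NE' natrM powRM//.
  have [nP|Pn] := ltnP n P.
    have -> : minn n.+1 P = (minn n P).+1 by lia.
    rewrite exprS; set K := C0 ^+ _ in h *.
    rewrite mulrACA ler_pM//.
    by apply: small; exact: prime_gt1.
  have -> : minn n.+1 P = minn n P by lia.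
  by rewrite mulrCA ler_pM//; exact: large.
exists (C0 ^+ P) => [|N N0]; first by rewrite exprn_ge0// (le_trans ler01).
apply: le_trans (S N.+1 N N0 _) _.
  by move=> p _ pN; rewrite ltnS dvdn_leq.
by rewrite ler_wpM2r ?powR_ge0// ler_weXn2l//; lia.
Qed.

End Divisors.

(** * The l1 norm of a digit sum along a fiber *)

Section DigitSums.
Context {R : realType}.

Lemma sqr_sum_le (I : finType) (P : pred I) (f : I -> R) :
  (\sum_(i | P i) f i) ^+ 2 <= #|P|%:R * \sum_(i | P i) f i ^+ 2.
Proof.
rewrite -sum1_card -!(big_filter _ P) natr_sum.
elim: [seq _ <- _ | _] => [|i r ih]; first by rewrite !big_nil expr0n mul0r.
rewrite !big_cons; move: ih.
have : 0 <= \sum_(j <- r) f j ^+ 2 by apply: sumr_ge0 => j _; exact: sqr_ge0.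
have : 0 <= \sum_(j <- r) 1 :> R by apply: sumr_ge0.
move: (\sum_(j <- r) f j) (\sum_(j <- r) f j ^+ 2) (\sum_(j <- r) 1) (f i).
move=> s q n x; rewrite le_eqVlt => /predU1P[<- q0|n0 q0] h.
  have : s = 0 by apply/eqP; rewrite -sqrf_eq0; nra.
  by move=> ->; nra.
have h1 : s ^+ 2 / n <= q by rewrite ler_pdivrMr// mulrC.
have : 0 <= n * (x - s / n) ^+ 2 by rewrite mulr_ge0 ?sqr_ge0 ?ltW.
have -> : n * (x - s / n) ^+ 2 = n * x ^+ 2 - 2 * x * s + s ^+ 2 / n.
  by field; rewrite gt_eqF.
move: (s ^+ 2 / n) h1 => w; nra.
Qed.

Variables (b : nat) (D : {set 'I_b}).
Hypothesis b_gt1 : (1 < b)%N.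

Definition digits : seq nat := [seq val i | i <- enum D].

Let b0 : (0 < b)%N. Proof. exact: ltnW. Qed.
Let bR : 0 < b%:R :> R. Proof. by rewrite ltr0n. Qed.
Let bn0 : b%:R != 0 :> R. Proof. by rewrite gt_eqF. Qed.

Lemma digits_uniq : uniq digits.
Proof. by rewrite map_inj_uniq ?enum_uniq//; exact: val_inj. Qed.

Lemma digits_lt d : d \in digits -> (d < b)%N.
Proof. by case/mapP => i _ ->; exact: ltn_ord. Qed.

Lemma size_digits : size digits = #|D|.
Proof. by rewrite size_map cardE. Qed.

Lemma digit_sumE (y : R) : digit_sum digits y = \sum_(d in D) ee (d%:R * y).
Proof. by rewrite /digit_sum big_map big_enum. Qed.

Lemma energy (c : 'I_b -> R[i]) :
  \sum_(a < b) nm (\sum_(d in D) c d * ee (d%:R * a%:R / b%:R)) ^+ 2 =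
  b%:R * \sum_(d in D) nm (c d) ^+ 2.
Proof.
pose u d := if d \in D then c d else 0.
have := parseval u b0; rewrite [in X in _ = X -> _]big_mkcond/=.
have -> : \sum_(d < b) nm (u d) ^+ 2 = \sum_(d in D) nm (c d) ^+ 2.
  rewrite [RHS]big_mkcond; apply: eq_bigr => d _.
  by rewrite /u; case: ifP => _ //; rewrite nm0 expr0n.
move=> <-; apply: eq_bigr => a _; congr (nm _ ^+ 2).
rewrite big_mkcond; apply: eq_bigr => d _.
by rewrite /u; case: ifP; rewrite ?mul0r.
Qed.

Definition fiber_sum (x : R) : R :=
  \sum_(a < b) nm (digit_sum digits ((x + a%:R) / b%:R)).

Lemma digit_sum_addn y n : digit_sum digits (y + n%:R) = digit_sum digits y :> R[i].
Proof. by apply: eq_bigr => d _; rewrite mulrDr -natrM ee_addn. Qed.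

Lemma digit_sumN y : digit_sum digits (- y) = ((digit_sum digits y)^*)%C :> R[i].
Proof. by rewrite conjc_sum; apply: eq_bigr => d _; rewrite mulrN eeN. Qed.

Lemma fiber_sumD1 x : fiber_sum (x + 1) = fiber_sum x.
Proof.
pose h (a : nat) := nm (digit_sum digits ((x + a%:R) / b%:R)).
have hb : h b = h 0%N.
  by rewrite /h addr0 mulrDl divff// -[1]/(1%:R) digit_sum_addn.
transitivity (\sum_(a < b) h a.+1).
  by apply: eq_bigr => a _; rewrite /h -natr1 -addrA [1 + _]addrC.
apply: (@addrI _ (h 0%N)).
rewrite -(big_ord_recl b (fun a : 'I_b.+1 => h a))/= big_ord_recr/= hb addrC.
by [].
Qed.

Lemma fiber_sum_addn x n : fiber_sum (x + n%:R) = fiber_sum x.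
Proof.
elim: n => [|n ih]; first by rewrite addr0.
by rewrite -natr1 addrA fiber_sumD1.
Qed.

Lemma fiber_sumN x : fiber_sum (- x) = fiber_sum x.
Proof.
rewrite -[RHS]fiber_sumD1 /fiber_sum (reindex_inj rev_ord_inj)/=.
apply: eq_bigr => a _.
rewrite -nm_conj -digit_sumN -(digit_sum_addn _ 1); congr (nm (digit_sum _ _)).
by rewrite natrB ?ltn_ord// -natr1; field.
Qed.

(** The fiber sum is even and 1-periodic. *)
Lemma fiber_sum_reduce (Phi : R) :
  (forall x, 0 <= x <= 2^-1 -> fiber_sum x <= Phi) -> forall x, fiber_sum x <= Phi.
Proof.
move=> H x.
suff H1 y : 0 <= y < 1 -> fiber_sum y <= Phi.
  have f1 : (Num.floor x)%:~R <= x := Num.Theory.ge_floor x.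
  have f2 : x < (Num.floor x)%:~R + 1 by rewrite -intrD1 floorD1_gt.
  have y01 : 0 <= x - (Num.floor x)%:~R < 1 by apply/andP; split; lra.
  have := H1 _ y01; case: (Num.floor x) => n.
    by rewrite -[X in _ -> fiber_sum X <= _](subrK (Posz n)%:~R) fiber_sum_addn.
  by rewrite NegzE mulrNz opprK fiber_sum_addn.
move=> /andP[y0 y1]; have [yh|yh] := leP y 2^-1; first by apply: H; rewrite y0.
rewrite -fiber_sumN -fiber_sumD1; apply: H; apply/andP; split; lra.
Qed.

(** Cauchy-Schwarz over the fiber and Parseval reduce the difference to the l2 norm of the
    differences of the coefficients. A unimodular factor first recentres the digits at (b - 1) / 2;
    moduli are unchanged and the Lipschitz constant is about halved. *)
Lemma fiber_sum_dist x x' : `|fiber_sum x - fiber_sum x'| <=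
  2 * pi * `|x - x'| * Num.sqrt (\sum_(d in D) (d%:R - (b%:R - 1) / 2) ^+ 2).
Proof.
pose c : R := (b%:R - 1) / 2.
pose u x (d : 'I_b) : R[i] := ee ((d%:R - c) * x / b%:R).
have E y a : nm (digit_sum digits ((y + a%:R) / b%:R)) =
    nm (\sum_(d in D) u y d * ee (d%:R * a%:R / b%:R)).
  rewrite digit_sumE -[LHS]mul1r -[X in X * _](nm_ee (- c * y / b%:R)) -nmM mulr_sumr.
  congr nm; apply: eq_bigr => d _; rewrite /u -!eeD; congr ee.
  by field.
have h (a : 'I_b) : `|nm (digit_sum digits ((x + a%:R) / b%:R)) -
    nm (digit_sum digits ((x' + a%:R) / b%:R))| <=
    nm (\sum_(d in D) (u x d - u x' d) * ee (d%:R * a%:R / b%:R)).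
  rewrite !E (le_trans (nm_dist _ _))// -sumrB.
  by under eq_bigr do rewrite -mulrBl.
rewrite /fiber_sum -sumrB (le_trans (ler_norm_sum _ _ _))//.
apply: (le_trans (ler_sum _ (fun a _ => h a))).
have S0 : 0 <= \sum_(d in D) (d%:R - c) ^+ 2 by apply: sumr_ge0 => d _; exact: sqr_ge0.
have r0 : 0 <= 2 * pi * `|x - x'| * Num.sqrt (\sum_(d in D) (d%:R - c) ^+ 2).
  by rewrite !mulr_ge0 ?pi_ge0 ?sqrtr_ge0.
rewrite -(@ler_pXn2r _ 2)// ?nnegrE//; last by apply: sumr_ge0 => a _; exact: nm_ge0.
apply: (le_trans (sqr_sum_le _ _)); rewrite energy card_ord.
rewrite mulrA exprMn sqr_sqrtr// !mulr_sumr; apply: ler_sum => d _.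
have -> : nm (u x d - u x' d) = nm (ee ((d%:R - c) * (x - x') / b%:R) - 1).
  rewrite -[RHS]mulr1 -[X in _ = _ * X](nm_ee ((d%:R - c) * x' / b%:R)) -nmM mulrBl mul1r -eeD.
  by congr (nm (ee _ - _)); field.
rewrite nm_eeB1.
set t := (d%:R - c) * (x - x') / b%:R.
have st : `|sin (pi * t)| <= pi * `|t|.
  have : sin (pi * `|t|) <= pi * `|t| by rewrite sin_le_id// mulr_ge0// pi_ge0.
  have : - (pi * `|t|) <= sin (pi * `|t|).
    rewrite -subr_ge0 opprK.
    have dz (z : R) : is_derive z 1 (fun x => sin x + x) (cos z + 1).
      exact: is_deriveD.
    apply: (ge0_from_derive dz); first by rewrite sin0 addr0 lexx.
      by move=> z _; have := cos_geN1 z; lra.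
    by rewrite mulr_ge0// pi_ge0.
  rewrite ler_norml; case: (ler0P t) => _; rewrite ?mulrN ?sinN; lra.
apply: (@le_trans _ _ (b%:R * b%:R * (2 * (pi * `|t|)) ^+ 2)).
  by rewrite ler_wpM2l ?mulr_ge0// lerXn2r ?nnegrE ?mulr_ge0 ?pi_ge0// ler_wpM2l.
rewrite le_eqVlt; apply/orP; left; apply/eqP.
by rewrite !exprMn !real_normK ?num_real// /t /c; field.
Qed.

End DigitSums.

(** Here C = b - 1, C t is the dominant term of the fiber and S the sum of the others, bounded by
    the energy left over. If the claim failed, squaring would give t^2 - 358/625 t - 2/125 < 0,
    which is false for t >= 6/10 with almost nothing to spare. *)
Lemma large_base_arith (R : realFieldType) (C t F S : R) : 11 <= C -> 6 / 10 <= t -> 0 <= F -> 0 <= S ->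
  F ^+ 2 = 123 / 125 * (C + 1) -> S ^+ 2 <= C * ((C + 1) * C - (C * t) ^+ 2) ->
  C * t + S <= C * F.
Proof.
move=> C11 t6 F0 S0 F2 Sq'; rewrite leNgt; apply/negP => lt.
have C0 : 0 < C by lra.
have q0 : 0 <= (C + 1) * C - (C * t) ^+ 2.
  by rewrite -(pmulr_rge0 _ C0) (le_trans (sqr_ge0 S)).
have tle : C * t ^+ 2 <= C + 1.
  by rewrite -(ler_pM2l C0); move: q0; rewrite exprMn; lra.
have Ft : t < F.
  have : 11 * t ^+ 2 <= C * t ^+ 2 by rewrite ler_wpM2r ?sqr_ge0.
  by rewrite -(@ltr_pXn2r _ 2)// ?nnegrE// ?F2; lra.
have lt2 : (C * (F - t)) ^+ 2 < S ^+ 2.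
  by rewrite ltrXn2r ?nnegrE// ?mulr_ge0//; lra.
have {lt2 Sq'} := lt_le_trans lt2 Sq'.
have -> : (C * (F - t)) ^+ 2 = C ^+ 2 * (F ^+ 2 - 2 * F * t + t ^+ 2) by ring.
have -> : C * ((C + 1) * C - (C * t) ^+ 2) = C ^+ 2 * ((C + 1) - C * t ^+ 2) by ring.
rewrite ltr_pM2l ?exprn_gt0// F2 => h.
(* The constant is chosen so that this just holds from C + 1 = 12 on, the threshold between large
   and small bases. *)
have Fle : F <= 179 / 625 * (C + 1).
  have C12 : 12 * (C + 1) <= (C + 1) ^+ 2 by rewrite expr2 ler_wpM2r//; lra.
  by rewrite -(@ler_pXn2r _ 2)// ?nnegrE ?F2 ?exprMn; lra.
have t0 : 0 <= t by lra.
have Ft' : F * t <= 179 / 625 * (C + 1) * t by rewrite ler_wpM2r.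
have t1 : 0 <= (t - 6 / 10) * t by rewrite mulr_ge0// subr_ge0.
have : (C + 1) * (t ^+ 2 - 358 / 625 * t - 2 / 125) < 0 by clear -h Ft'; lra.
by rewrite pmulr_rlt0; clear -t1 t6 C0; lra.
Qed.

(** * The fiber bound for bases at least 12 *)

Section LargeBase.
Context {R : realType}.
Variables (b : nat) (D : {set 'I_b}).
Hypothesis D_card : #|D| = (b - 1)%N.

Lemma missing_digit : (0 < b)%N -> exists d0 : 'I_b, D = ~: [set d0].
Proof.
move=> b0; have : #|~: D| == 1%N by rewrite cardsCs finset.setCK card_ord D_card subKn.
by move=> /cards1P[d0 E]; exists d0; rewrite -E finset.setCK.
Qed.

Lemma digit_sum_missing (d0 : 'I_b) (y : R) : D = ~: [set d0] ->
  digit_sum (digits D) y = geom_sum b y - ee (d0%:R * y).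
Proof.
move=> DE; rewrite digit_sumE DE /geom_sum [in RHS](bigD1 d0)//= [ee _ + _]addrC addrK.
by apply: eq_bigl => d; rewrite !inE.
Qed.

(** For 0 <= x <= 1/2 the dominant term is a = 0: the geometric sum over all digits is there at
    least 2 b / pi, and the missing digit removes at most 1. The energy of the fiber is b (b - 1),
    as the b - 1 coefficients are unimodular. *)
Lemma fiber_sum_large (x : R) : (12 <= b)%N ->
  fiber_sum D x <= (b%:R - 1) * Num.sqrt (123 / 125 * b%:R).
Proof.
move=> b12; have b1 : (1 < b)%N by lia.
have bR : 12 <= b%:R :> R by rewrite (ler_nat _ 12).
move: x; apply: fiber_sum_reduce => // x /andP[x0 x1].
have b0 : (0 < b)%N by lia.
have [d0 DE] := missing_digit b0.
pose g (a : 'I_b) := nm (digit_sum (digits D) ((x + a%:R) / b%:R)).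
pose o := Ordinal b0.
have main : 6 / 10 * (b%:R - 1) <= g o.
  rewrite /g addr0 (digit_sum_missing _ DE).
  apply: le_trans (nmB_ge _ _); rewrite nm_ee.
  suff : 2 * 113 / 355 * b%:R <= nm (geom_sum b (x / b%:R)) by lra.
  have [->|xn0] := eqVneq x 0; first by rewrite mul0r geom_sum0 nm_nat; lra.
  have xp : 0 < x by rewrite lt_neqAle eq_sym xn0.
  set y := x / b%:R; have yp : 0 < y by rewrite divr_gt0//; lra.
  have E : nm (geom_sum b y) * nm (ee y - 1) = nm (ee x - 1).
    rewrite -nmM /geom_sum; under eq_bigr do rewrite ee_mulrn.
    rewrite mulrC -subrX1 -ee_mulrn /y mulrC divfK// gt_eqF//; lra.
  have pib := @pi_bounds R.
  have yle : nm (ee y - 1) <= 2 * pi * y.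
    rewrite nm_eeB1 -mulrA ler_wpM2l// ger0_norm ?sin_le_id//.
      by rewrite mulr_ge0 ?pi_ge0// ltW.
    apply: le_trans (jordan_ineq _); first by rewrite mulr_ge0// ltW.
    by rewrite (ltW yp)/= /y ler_pdivrMr; nra.
  have xge : 4 * x <= nm (ee x - 1).
    rewrite nm_eeB1 ger0_norm; have := @jordan_ineq R x; rewrite x0 x1 => /(_ isT); lra.
  have yE : x = b%:R * y by rewrite /y mulrC divfK// gt_eqF//; lra.
  have h3 : 4 * b%:R * y <= 2 * pi * nm (geom_sum b y) * y.
    have := ler_wpM2l (nm_ge0 (geom_sum b y)) yle; rewrite E.
    by move: xge; rewrite {1}yE; lra.
  move: (nm_ge0 (geom_sum b y)) h3; move: (nm (geom_sum b y)) => G G0 h3.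
  have : 4 * b%:R <= 2 * pi * G by rewrite -(ler_pM2r yp).
  case/andP: pib => _ pi2 h4.
  have : 2 * pi * G <= 2 * (355 / 113) * G by rewrite ler_wpM2r//; lra.
  lra.
have En : \sum_(a < b) g a ^+ 2 = b%:R * (b%:R - 1).
  have := energy D b1 (fun d => ee (d%:R * x / b%:R)).
  under [X in _ = _ * X -> _]eq_bigr do rewrite nm_ee expr1n.
  rewrite sumr_const D_card natrB// => <-; apply: eq_bigr => a _; congr (nm _ ^+ 2).
  rewrite digit_sumE; apply: eq_bigr => d _; rewrite -eeD; congr ee.
  by field; rewrite gt_eqF//; lra.
have Sq := sqr_sum_le (fun a => a != o) g.
rewrite cardC1 card_ord -subn1 natrB// in Sq.
move: En; rewrite (bigD1 o)//= => En.
rewrite (_ : fiber_sum D x = \sum_(a < b) g a)// (bigD1 o)//=.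
have S0 : 0 <= \sum_(i < b | i != o) g i by apply: sumr_ge0 => a _; exact: nm_ge0.
move: main S0 En Sq; set G0 := g o; set S := \sum_(i < b | i != o) g i.
set q := \sum_(i < b | i != o) g i ^+ 2 => main S0 Eq Sq.
set F := Num.sqrt _.
have F2 : F ^+ 2 = 123 / 125 * b%:R by rewrite sqr_sqrtr// mulr_ge0//; lra.
have F0 : 0 <= F by rewrite sqrtr_ge0.
have Sq' : S ^+ 2 <= (b%:R - 1) * (b%:R * (b%:R - 1) - G0 ^+ 2) by rewrite -Eq addrAC subrr add0r; exact: Sq.
pose C : R := b%:R - 1; have C11 : 11 <= C by rewrite /C; lra.
pose t := G0 / C; have C0 : 0 < C by lra.
have GE : G0 = C * t by rewrite /t mulrC divfK// gt_eqF.
have t6 : 6 / 10 <= t by rewrite ler_pdivlMr.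
have BE : b%:R = C + 1 :> R by rewrite /C subrK.
move: Sq' F2; rewrite -/C GE BE => Sq' F2.
exact: large_base_arith Sq'.
Qed.

End LargeBase.

(* The fiber bound for bases 7 to 11, by fixed point arithmetic *)
Delimit Scope Z_scope with BZ.

Section Numerics.

(** This is 2^30: an integer z stands for z / 2^30, and a pair for a complex number. *)
Definition scale : Z := 1073741824%BZ.

Definition rot (c s : Z) (z : Z * Z) : Z * Z :=
  ((z.1 * c - z.2 * s) / scale, (z.1 * s + z.2 * c) / scale)%BZ.

(* [scale] times the second order approximation of exp(2 i pi / N), with 355/113
   in place of pi *)
Definition unit_im (N : Z) : Z := (scale * 710 / (113 * N))%BZ.
Definition unit_re (N : Z) : Z := (scale - scale * (710 * 710) / (2 * (113 * N) * (113 * N)))%BZ.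

Definition rot_table (n : nat) : seq (Z * Z) :=
  traject (rot (unit_re (Z.of_nat n)) (unit_im (Z.of_nat n))) (scale, 0%BZ) n.

Definition zadd (p q : Z * Z) : Z * Z := (p.1 + q.1, p.2 + q.2)%BZ.
Definition zsub (p q : Z * Z) : Z * Z := (p.1 - q.1, p.2 - q.2)%BZ.
(** The modulus of a complex number, rounded up because the integer square root truncates. *)
Definition zmod (p : Z * Z) : Z := (Z.sqrt (p.1 * p.1 + p.2 * p.2) + 1)%BZ.

Definition table_row (b : nat) (tab : seq (Z * Z)) (t : nat) : seq (Z * Z) :=
  [seq nth (0%BZ, 0%BZ) tab ((d * t) %% (64 * b)) | d <- iota 0 b].

Definition row_total (d0 : nat) (tv : (Z * Z) * seq (Z * Z)) : Z :=
  zmod (zsub tv.1 (nth (0%BZ, 0%BZ) tv.2 d0)).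

(** Above the grid point j / 64 the fiber consists of the (j + 64 a) / (64 b), so every exponential
    is a root of unity of order 64 b and is read from a table. The grid stops at j = 32, that is at
    1/2; [d0] runs over the possible missing digits. *)
Definition fiber_check (b : nat) (T : Z) : bool :=
  let tab := rot_table (64 * b) in
  all (fun j =>
    let rows := [seq table_row b tab (j + 64 * a) | a <- iota 0 b] in
    let trows := [seq (foldr zadd (0%BZ, 0%BZ) r, r) | r <- rows] in
    all (fun d0 => Z.leb (foldr Z.add 0%BZ [seq row_total d0 tv | tv <- trows]) T)
      (iota 0 b)) (iota 0 33).

Lemma fiber_check7 : fiber_check 7 16428000000.
Proof. by vm_compute. Qed.
Lemma fiber_check8 : fiber_check 8 20390000000.
Proof. by vm_compute. Qed.
Lemma fiber_check9 : fiber_check 9 24500000000.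
Proof. by vm_compute. Qed.
Lemma fiber_check10 : fiber_check 10 28700000000.
Proof. by vm_compute. Qed.
Lemma fiber_check11 : fiber_check 11 33000000000.
Proof. by vm_compute. Qed.

End Numerics.

Section NumericsCorrect.
Context {R : realType}.

Definition zr (z : Z) : R := (int_of_Z z)%:~R.

Lemma zrD x y : zr (x + y)%BZ = zr x + zr y.
Proof. by rewrite /zr -intrD -rmorphD. Qed.

Lemma zrN x : zr (- x)%BZ = - zr x.
Proof. by rewrite /zr -intrN -rmorphN. Qed.

Lemma zrB x y : zr (x - y)%BZ = zr x - zr y.
Proof. by rewrite -zrN -zrD. Qed.

Lemma zrM x y : zr (x * y)%BZ = zr x * zr y.
Proof. by rewrite /zr -intrM -rmorphM. Qed.

Lemma zr_pos p : zr (Z.pos p) = (Pos.to_nat p)%:R.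
Proof. by []. Qed.

Lemma zr_nat n : zr (Z.of_nat n) = n%:R.
Proof. by case: n => [|n] //; rewrite [LHS]zr_pos SuccNat2Pos.id_succ. Qed.

Lemma zr_ge0 x : (0 <= x)%BZ -> 0 <= zr x.
Proof. by case: x => [|p|p] h; rewrite ?[zr _]zr_pos ?ler0n//; lia. Qed.

Lemma zr_le x y : (x <= y)%BZ -> zr x <= zr y.
Proof. by move=> h; rewrite -subr_ge0 -zrB zr_ge0//; lia. Qed.

Lemma zr_lt x y : (x < y)%BZ -> zr x < zr y.
Proof.
move=> h; rewrite (lt_le_trans _ (zr_le (_ : (x + 1 <= y)%BZ)))//; last by lia.
by rewrite zrD ltrDl ltr01.
Qed.

Lemma zr_div x k : (0 < k)%BZ -> zr x / zr k - 1 <= zr (x / k)%BZ <= zr x / zr k.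
Proof.
move=> k0; have kR : 0 < zr k by apply: (zr_lt k0).
have m := Z.mod_pos_bound x k k0.
have E : zr x = zr k * zr (x / k)%BZ + zr (x mod k)%BZ.
  by rewrite -zrM -zrD -Z_div_mod_eq_full.
have m0 := zr_ge0 m.1; have m1 := zr_lt m.2.
rewrite lerBlDr ler_pdivrMr// ler_pdivlMr// E; lra.
Qed.

(* Sealed, because unifying [zr scale] may unfold a unary number. *)
Fact scale_sig : {s : R | s = zr scale}. Proof. by exists (zr scale). Qed.
Definition S : R := sval scale_sig.
Lemma SE : zr scale = S. Proof. by rewrite /S; case: scale_sig. Qed.
Lemma S_gt0 : 0 < S. Proof. by rewrite -SE; exact: (@zr_lt 0%BZ). Qed.

Definition cz (p : Z * Z) : R[i] := Complex (zr p.1 / S) (zr p.2 / S).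

Lemma nm_le_abs (z : R[i]) : nm z <= `|complex.Re z| + `|complex.Im z|.
Proof.
rewrite -(@ler_pXn2r _ 2)// ?nnegrE ?nm_ge0 ?addr_ge0// nm_sqr sqrrD.
by rewrite !real_normK ?num_real// addrAC lerDl mulrn_wge0// mulr_ge0.
Qed.

Lemma czD p q : cz (zadd p q) = cz p + cz q.
Proof. by rewrite /cz /zadd/= !zrD !mulrDl. Qed.

Lemma czB p q : cz (zsub p q) = cz p - cz q.
Proof. by rewrite /cz /zsub/= !zrB !mulrBl. Qed.

Lemma cz_foldr s : cz (foldr zadd (0%BZ, 0%BZ) s) = \sum_(p <- s) cz p.
Proof.
elim: s => [|p s ih]; last by rewrite big_cons/= czD ih.
by rewrite big_nil /cz/= !mul0r.
Qed.

Lemma zr_foldr s : zr (foldr Z.add 0%BZ s) = \sum_(x <- s) zr x.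
Proof. by elim: s => [|x s ih]; rewrite ?big_nil// big_cons/= zrD ih. Qed.

Lemma nm_cz_le p : nm (cz p) <= zr (zmod p) / S.
Proof.
have S0 := S_gt0; set m := zmod p.
have m0 : (0 <= m)%BZ by rewrite /m /zmod; have := Z.sqrt_nonneg (p.1 * p.1 + p.2 * p.2); lia.
rewrite -(@ler_pXn2r _ 2)// ?nnegrE ?nm_ge0 ?divr_ge0 ?zr_ge0 ?(ltW S0)//.
rewrite nm_sqr/= !expr_div_n -mulrDl ler_wpM2r ?invr_ge0 ?sqr_ge0//.
rewrite !expr2 -!zrM -zrD; apply: zr_le.
have := Z.sqrt_spec (p.1 * p.1 + p.2 * p.2); rewrite /m /zmod; nia.
Qed.

Lemma S_val : S = 1024 * 1024 * 1024.
Proof.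
rewrite -SE (_ : scale = (Z.of_nat 1024 * Z.of_nat 1024 * Z.of_nat 1024)%BZ)//.
by rewrite !zrM zr_nat.
Qed.

(** Error of one rotation step, with w = 1 / n: [tau] is the angle computed from 355/113 and [th]
    the true one, [s] and [c] its sine and cosine, [x] and [y] the stored values, [e] the rounding
    unit. *)
Lemma approx_arith (tau th w e x y s c : R) :
  0 <= tau - th -> tau - th <= w / 50 / 100 -> tau <= 70^-1 -> 0 < th -> th <= 7 * w ->
  th ^+ 3 <= th / 70 / 70 -> th ^+ 4 <= th / 70 / 70 / 70 -> e <= w / 1000 / 100 ->
  s <= th -> th - th ^+ 3 / 6 <= s ->
  1 - th ^+ 2 / 2 <= c -> c <= 1 - th ^+ 2 / 2 + th ^+ 4 / 24 ->
  tau - e <= x -> x <= tau -> 1 - tau ^+ 2 / 2 <= y -> y <= 1 - tau ^+ 2 / 2 + e ->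
  `|x - s| + `|y - c| <= w / 1000.
Proof.
move=> t1 t2 tau70 th0 thw th3 th4 ew s1 s2 c1 c2 x1 x2 y1 y2.
have tt : tau ^+ 2 - th ^+ 2 <= w / 50 / 100 / 35.
  have -> : tau ^+ 2 - th ^+ 2 = (tau - th) * (tau + th) by ring.
  apply: (@le_trans _ _ ((tau - th) * 35^-1)).
    by apply: ler_wpM2l => //; clear -tau70 t1; lra.
  by rewrite ler_wpM2r// invr_ge0.
have tt0 : 0 <= tau ^+ 2 - th ^+ 2.
  have -> : tau ^+ 2 - th ^+ 2 = (tau - th) * (tau + th) by ring.
  by rewrite mulr_ge0//; clear -t1 th0; lra.
have im : `|x - s| <= w / 1000 / 2.
  rewrite ler_norml; clear tt tt0 c1 c2 y1 y2 th4 tau70; apply/andP; split; lra.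
have re : `|y - c| <= w / 1000 / 2.
  rewrite ler_norml; clear s1 s2 th3 x1 x2 im tau70; apply/andP; split; lra.
clear -im re; lra.
Qed.

(** The range is that of n = 64 b for 7 <= b <= 11. *)
Lemma unit_approx (n : nat) : (448 <= n)%N -> (n <= 704)%N ->
  nm (cz (unit_re (Z.of_nat n), unit_im (Z.of_nat n)) - ee (n%:R^-1)) <= n%:R^-1 / 1000.
Proof.
move=> n1 n2.
have k1 : (0 < 113 * Z.of_nat n)%BZ by lia.
have k2 : (0 < 2 * (113 * Z.of_nat n) * (113 * Z.of_nat n))%BZ by nia.
set N : R := n%:R.
have N1 : 448 <= N by rewrite (ler_nat _ 448).
have N2 : N <= 704 by rewrite (ler_nat _ n 704).
have N0 : 0 < N by clear -N1; lra.
set w := N^-1; have w0 : 0 < w by rewrite invr_gt0.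
have wN : w * N = 1 by rewrite mulVf// gt_eqF.
have S0 := S_gt0; pose e := S^-1; have e0 : 0 < e by rewrite invr_gt0.
have eS : e * S = 1 by rewrite mulVf// gt_eqF.
have ew : e <= w / 1000 / 100.
  rewrite -(ler_pM2r S0) eS -(ler_pM2r N0) mul1r.
  have -> : w / 1000 / 100 * S * N = (w * N) * S / 1000 / 100 by ring.
  rewrite wN mul1r S_val; lra.
have w448 : w * 448 <= 1 by have := ler_wpM2l (ltW w0) N1; rewrite wN.
have /andP[p1 p2] := @pi_bounds R.
have z113 : zr 113%BZ = 113 by rewrite -(zr_nat 113).
have z710 : zr 710%BZ = 710 by rewrite -(zr_nat 710).
have z2 : zr 2%BZ = 2 by rewrite -(zr_nat 2).
pose tau := 710 / 113 * w; pose th := 2 * pi * w.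
have thtau : 0 <= tau - th <= w / 50 / 100.
  by rewrite /tau /th -mulrBl; clear -p1 p2 w0; apply/andP; split; nra.
have th0 : 0 < th by rewrite !mulr_gt0 ?pi_gt0.
have tau70 : tau <= 70^-1 by rewrite /tau; clear -w448; lra.
have th70 : th <= 70^-1 by clear -thtau tau70; lra.
have thw : th <= 7 * w by move: thtau; rewrite /tau; clear -w0; lra.
have th2 : th ^+ 2 <= th / 70 by rewrite expr2 ler_wpM2l// ltW.
have th3 : th ^+ 3 <= th / 70 / 70.
  by rewrite exprSr; apply: ler_pM => //; rewrite ?exprn_ge0// ltW.
have th4 : th ^+ 4 <= th / 70 / 70 / 70.
  by rewrite exprSr; apply: ler_pM => //; rewrite ?exprn_ge0// ltW.
apply: le_trans (nm_le_abs _) _; rewrite /cz /ee /= -/w -/th -/e.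
have s1 := sin_le_id (ltW th0); have s2 := sin_ge3 (ltW th0).
have c1 := cos_ge2 (ltW th0); have c2 := cos_le4 (ltW th0).
have im : tau - e <= zr (unit_im (Z.of_nat n)) * e <= tau.
  have := zr_div (scale * 710) k1; rewrite -/(unit_im _) !zrM zr_nat z113 z710 SE.
  have -> : S * 710 / (113 * n%:R) = S * tau by rewrite /tau /w; field; rewrite gt_eqF.
  move=> /andP[h1 h2]; apply/andP; split.
    by have := ler_wpM2r (ltW e0) h1; rewrite mulrBl mul1r mulrAC [S * e]mulrC eS mul1r.
  have := ler_wpM2r (ltW e0) h2; rewrite mulrAC [S * e]mulrC eS; clear; lra.
have re : 1 - tau ^+ 2 / 2 <= zr (unit_re (Z.of_nat n)) * e <= 1 - tau ^+ 2 / 2 + e.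
  have := zr_div (scale * (710 * 710)) k2.
  rewrite /unit_re zrB; set Q := zr (Z.div _ _); rewrite !zrM zr_nat z113 z710 z2 SE.
  have -> : S * (710 * 710) / (2 * (113 * n%:R) * (113 * n%:R)) = S * (tau ^+ 2 / 2).
    by rewrite /tau /w; field; rewrite gt_eqF.
  move=> /andP[h1 h2]; rewrite mulrBl [S * e]mulrC eS; apply/andP; split.
    have := ler_wpM2r (ltW e0) h2; rewrite mulrAC [S * e]mulrC eS; clear; lra.
  have := ler_wpM2r (ltW e0) h1; rewrite mulrBl mul1r mulrAC [S * e]mulrC eS; clear; lra.
case/andP: im => x1 x2; case/andP: re => y1 y2; case/andP: thtau => t1 t2.
rewrite addrC; exact: (@approx_arith tau th w e).
Qed.

Definition rot_orbit (n s : nat) : Z * Z :=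
  iter s (rot (unit_re (Z.of_nat n)) (unit_im (Z.of_nat n))) (scale, 0%BZ).

Lemma rot_approx c s z :
  nm (cz (rot c s z) - cz z * cz (c, s)) <= 2 / S.
Proof.
have S0 := S_gt0; have k0 : (0 < scale)%BZ by [].
have Sn : S != 0 by rewrite gt_eqF.
have D X Y : X = zr Y / S -> `|zr (Y / scale)%BZ / S - X / S| <= S^-1.
  move=> ->; rewrite -mulrBl normrM normfV (gtr0_norm S0) ler_piMl ?invr_ge0 ?(ltW S0)//.
  by have := zr_div Y k0; rewrite SE ler_norml => /andP[h1 h2]; apply/andP; split; lra.
apply: le_trans (nm_le_abs _) _; rewrite /cz/= mulr_natl mulr2n lerD//.
  have -> : zr z.1 / S * (zr c / S) - zr z.2 / S * (zr s / S) =
      (zr (z.1 * c - z.2 * s)%BZ / S) / S by rewrite zrB !zrM; field.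
  exact: D.
have -> : zr z.1 / S * (zr s / S) + zr z.2 / S * (zr c / S) =
    (zr (z.1 * s + z.2 * c)%BZ / S) / S by rewrite zrD !zrM; field.
exact: D.
Qed.

(** Multiplication by a unimodular number preserves the error already made, so errors only add up:
    at most 1 / (400 n) per step and 1/400 over a full turn. *)
Lemma rot_orbit_approx (n s : nat) : (448 <= n)%N -> (n <= 704)%N -> (s <= n)%N ->
  nm (cz (rot_orbit n s) - ee (s%:R / n%:R)) <= s%:R / n%:R / 400.
Proof.
move=> n1 n2; set N : R := n%:R.
have N1 : 448 <= N by rewrite (ler_nat _ 448).
have N2 : N <= 704 by rewrite (ler_nat _ n 704).
have N0 : 0 < N by lra.
have S0 := S_gt0.
have e1 : 2 / S <= N^-1 / 1000 / 4.
  rewrite ler_pdivrMr// -(ler_pM2r N0).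
  have -> : N^-1 / 1000 / 4 * S * N = S / 1000 / 4 by field; rewrite gt_eqF.
  rewrite S_val; lra.
elim: s => [|s ih] sn.
  rewrite !mul0r ee0 /cz/= SE mul0r divff ?gt_eqF//.
  by rewrite (_ : Complex 1 0 = 1 :> R[i])// subrr nm0.
have sN : s%:R / N <= 1 by rewrite ler_pdivrMr// mul1r ler_nat ltnW.
have := ih (ltnW sn); set E := cz (rot_orbit n s); set u := ee _ => h.
have u1 : nm u = 1 by rewrite nm_ee.
have E2 : nm E <= 401 / 400.
  rewrite -(subrK u E) (le_trans (nmD _ _))// u1; lra.
have ua := unit_approx n1 n2; rewrite -/N in ua.
set U := cz (_, _) in ua.
have ra := rot_approx (unit_re (Z.of_nat n)) (unit_im (Z.of_nat n)) (rot_orbit n s).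
rewrite -/(rot_orbit n s.+1) -/E -/U in ra.
have -> : ee (s.+1%:R / N) = u * ee N^-1.
  by rewrite -natr1 mulrDl eeD mul1r.
set F := cz (rot_orbit n s.+1) in ra *.
have -> : F - u * ee N^-1 = (F - E * U) + (E * (U - ee N^-1) + (E - u) * ee N^-1) by ring.
apply: le_trans (nmD _ _) _.
have h3 : nm (E * (U - ee N^-1) + (E - u) * ee N^-1) <= 401 / 400 * (N^-1 / 1000) + s%:R / N / 400.
  rewrite (le_trans (nmD _ _))// !nmM nm_ee mulr1 lerD// ler_pM ?nm_ge0//.
have -> : s.+1%:R / N / 400 = N^-1 / 400 + s%:R / N / 400 by rewrite -natr1; ring.
have Ni : 0 < N^-1 by rewrite invr_gt0.
by apply: (le_trans (lerD ra h3)); clear -e1 Ni; lra.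
Qed.


Variables (b : nat) (D : {set 'I_b}).
Hypothesis D_card : #|D| = (b - 1)%N.

(** The last term allows 1/400 for each of the b - 1 exponentials in each of the b digit sums. *)
Lemma fiber_check_correct T j : (7 <= b <= 11)%N -> fiber_check b T -> (j <= 32)%N ->
  fiber_sum D (j%:R / 64) <= zr T / S + b%:R * (b%:R - 1) / 400.
Proof.
move=> /andP[b7 b11] chk j32.
have b0 : (0 < b)%N by lia.
have [d0 DE] := missing_digit D_card b0.
set n := (64 * b)%N; have n0 : (0 < n)%N by lia.
have nR : n%:R != 0 :> R by rewrite pnatr_eq0; lia.
have bR : b%:R != 0 :> R by rewrite pnatr_eq0; lia.
have tabE s : (s < n)%N -> nth (0%BZ, 0%BZ) (rot_table n) s = rot_orbit n s.
  by move=> sn; rewrite /rot_table (set_nth_default (scale, 0%BZ)) ?size_traject// nth_traject.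
have S0 := S_gt0.
pose row a := table_row b (rot_table n) (j + 64 * a).
pose tot a := row_total d0 (foldr zadd (0%BZ, 0%BZ) (row a), row a).
have main : \sum_(a < b) zr (tot a) <= zr T.
  move: chk => /allP /(_ j); rewrite mem_iota/= add0n ltnS => /(_ j32).
  move=> /allP /(_ d0); rewrite mem_iota/= add0n ltn_ord => /(_ isT).
  move=> /Z.leb_le /zr_le; rewrite zr_foldr -!map_comp big_map.
  have -> : iota 0 b = index_iota 0 b by rewrite /index_iota subn0.
  by rewrite big_mkord.
have err (a : 'I_b) : nm (digit_sum (digits D) ((j%:R / 64 + a%:R) / b%:R)) <=
    zr (tot a) / S + (b%:R - 1) / 400.
  set t := (j + 64 * a)%N.
  have -> : (j%:R / 64 + a%:R) / b%:R = t%:R / n%:R :> R.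
    by rewrite /t /n natrD !natrM; field.
  have orb d : nm (cz (rot_orbit n ((d * t) %% n)) - ee (d%:R * (t%:R / n%:R))) <= 1 / 400.
    rewrite mulrA -natrM -ee_modn//.
    apply: le_trans (rot_orbit_approx _ _ _) _; [by lia|by lia|by rewrite ltnW// ltn_mod|].
    have : ((d * t) %% n)%:R / n%:R <= 1 :> R.
      by rewrite ler_pdivrMr ?ltr0n// mul1r ler_nat ltnW// ltn_mod.
    by clear; lra.
  have totE : cz (zsub (foldr zadd (0%BZ, 0%BZ) (row a)) (nth (0%BZ, 0%BZ) (row a) d0)) =
      \sum_(d in D) cz (rot_orbit n ((d * t) %% n)).
    rewrite czB cz_foldr /row /table_row big_map.
    rewrite (nth_map 0%N) ?size_iota// nth_iota//= add0n tabE ?ltn_mod//.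
    have -> : iota 0 b = index_iota 0 b by rewrite /index_iota subn0.
    rewrite big_mkord (bigD1 d0)//= tabE ?ltn_mod// addrC addrK DE.
    apply: eq_big => [d|d _]; first by rewrite !inE.
    by rewrite tabE ?ltn_mod.
  apply: (@le_trans _ _ (nm (\sum_(d in D) cz (rot_orbit n ((d * t) %% n))) +
     \sum_(d in D) 1 / 400)); last first.
    rewrite -totE; apply: lerD; first exact: nm_cz_le.
    by rewrite sumr_const D_card -[_ *+ _]mulr_natl natrB// div1r.
  rewrite digit_sumE -lerBlDl (le_trans (nmB_ge _ _))// -sumrB.
  apply: (le_trans (nm_sum _ _ _)); apply: ler_sum => d _.
  by rewrite -nmN opprB orb.
apply: (@le_trans _ _ (\sum_(a < b) (zr (tot a) / S + (b%:R - 1) / 400))).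
  by apply: ler_sum => a _; exact: err.
rewrite big_split/= -mulr_suml sumr_const card_ord -[_ *+ b]mulr_natl mulrA lerD//.
by rewrite ler_wpM2r// invr_ge0 ltW.
Qed.

Lemma sum_sqr_dev (c : R) n :
  \sum_(d < n) (d%:R - c) ^+ 2 =
  n%:R * (n%:R - 1) * (2 * n%:R - 1) / 6 - c * n%:R * (n%:R - 1) + n%:R * c ^+ 2.
Proof.
elim: n => [|n ih]; first by rewrite big_ord0; ring.
by rewrite big_ord_recr/= ih -natr1; field.
Qed.

(** The nearest grid point is within 1/128, and the Lipschitz bound then costs 355 / 113 / 64 times
    [s]. Here [s] bounds the l2 norm of the centred digits, whose square over all digits is b (b^2 -
    1) / 12; [t] rounds the checked maximum up and [f] the square root down. *)
Lemma fiber_sum_small_aux T (x t s f : R) : (7 <= b <= 11)%N -> fiber_check b T ->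
  0 <= s -> 0 <= f ->
  zr T <= t * S -> b%:R * (b%:R ^+ 2 - 1) / 12 <= s ^+ 2 -> f ^+ 2 <= 123 / 125 * b%:R ->
  t + b%:R * (b%:R - 1) / 400 + 355 / 113 / 64 * s <= (b%:R - 1) * f ->
  fiber_sum D x <= (b%:R - 1) * Num.sqrt (123 / 125 * b%:R).
Proof.
move=> bb chk s0 f0 Tt ss ff fin.
have b1 : (1 < b)%N by case/andP: bb => + _; exact: leq_trans.
move: x; apply: fiber_sum_reduce => // x /andP[x0 x1].
pose j := Num.trunc (64 * x + 2^-1 : R).
have j0 : 0 <= 64 * x + 2^-1 :> R by rewrite addr_ge0 ?mulr_ge0.
have /andP[jl ju] := trunc_itv j0; rewrite -/j in jl ju.
have j32 : (j <= 32)%N.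
  rewrite -ltnS -(ltr_nat R) (le_lt_trans jl)//; lra.
have xj : `|x - j%:R / 64| <= 64^-1 / 2.
  move: ju; rewrite -[j.+1%:R]natr1 => ju; rewrite ler_norml; apply/andP; split; lra.
have h1 := fiber_check_correct bb chk j32.
have := fiber_sum_dist D b1 x (j%:R / 64).
set dev := \sum_(d in D) _.
have dev_le : Num.sqrt dev <= s.
  rewrite -(ger0_norm s0) -sqrtr_sqr ler_wsqrtr//; apply: le_trans ss.
  apply: (@le_trans _ _ (\sum_(d < b) (d%:R - (b%:R - 1) / 2) ^+ 2)).
    rewrite /dev big_mkcond; apply: ler_sum => d _.
    by case: ifP => // _; exact: sqr_ge0.
  by rewrite sum_sqr_dev le_eqVlt; apply/orP; left; apply/eqP; field.
have /andP[_ p2] := @pi_bounds R.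
have h2 : 2 * pi * `|x - j%:R / 64| * Num.sqrt dev <= 355 / 113 / 64 * s.
  have -> : 355 / 113 / 64 * s = (2 * (355 / 113)) * (64^-1 / 2) * s by field.
  apply: ler_pM; rewrite ?sqrtr_ge0 ?mulr_ge0 ?pi_ge0//.
  by apply: ler_pM; rewrite ?mulr_ge0 ?pi_ge0// ler_wpM2l// ltW.
move=> h3.
have h4 : fiber_sum D x <= fiber_sum D (j%:R / 64) + 355 / 113 / 64 * s.
  by rewrite -lerBlDl (le_trans _ (le_trans h3 h2))// ler_norm.
have h5 : zr T / S <= t by rewrite ler_pdivrMr// S_gt0.
have h6 : f <= Num.sqrt (123 / 125 * b%:R).
  by rewrite -(ger0_norm f0) -sqrtr_sqr ler_wsqrtr.
apply: (@le_trans _ _ ((b%:R - 1) * f)).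
  apply: le_trans fin; apply: (le_trans h4); rewrite lerD2r; apply: (le_trans h1).
  by rewrite lerD2r.
by rewrite ler_wpM2l// subr_ge0 ler1n ltnW.
Qed.

Lemma zr_scaleM k T : (T * Z.of_nat 10 <= Z.of_nat k * scale)%BZ -> zr T <= k%:R / 10 * S.
Proof.
move/zr_le; rewrite !zrM !zr_nat SE => h.
by rewrite mulrAC ler_pdivlMr ?ltr0n.
Qed.

Lemma fiber_sum_small (x : R) : (7 <= b <= 11)%N ->
  fiber_sum D x <= (b%:R - 1) * Num.sqrt (123 / 125 * b%:R).
Proof.
move=> bb.
have [E|] := eqVneq b 7%N.
  have chk : fiber_check b 16428000000 by rewrite E fiber_check7.
  apply: (@fiber_sum_small_aux _ x (153 / 10) (53 / 10) (262 / 100) bb chk); rewrite ?E; try lra.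
  by apply: zr_scaleM.
have [E _|] := eqVneq b 8%N.
  have chk : fiber_check b 20390000000 by rewrite E fiber_check8.
  apply: (@fiber_sum_small_aux _ x (190 / 10) (65 / 10) (280 / 100) bb chk); rewrite ?E; try lra.
  by apply: zr_scaleM.
have [E _ _|] := eqVneq b 9%N.
  have chk : fiber_check b 24500000000 by rewrite E fiber_check9.
  apply: (@fiber_sum_small_aux _ x (229 / 10) (78 / 10) (297 / 100) bb chk); rewrite ?E; try lra.
  by apply: zr_scaleM.
have [E _ _ _|] := eqVneq b 10%N.
  have chk : fiber_check b 28700000000 by rewrite E fiber_check10.
  apply: (@fiber_sum_small_aux _ x (268 / 10) (91 / 10) (313 / 100) bb chk); rewrite ?E; try lra.
  by apply: zr_scaleM.
move=> n10 n9 n8 n7; have E : b = 11%N by lia.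
have chk : fiber_check b 33000000000 by rewrite E fiber_check11.
apply: (@fiber_sum_small_aux _ x (308 / 10) (105 / 10) (328 / 100) bb chk); rewrite ?E; try lra.
by apply: zr_scaleM.
Qed.

End NumericsCorrect.

Theorem fiber_sum_le (R : realType) (b : nat) (D : {set 'I_b}) (x : R) :
  (7 <= b)%N -> #|D| = (b - 1)%N ->
  fiber_sum D x <= (b%:R - 1) * Num.sqrt (123 / 125 * b%:R).
Proof.
move=> b7 cD; have [b12|b12] := leqP 12 b; first exact: fiber_sum_large.
by apply: fiber_sum_small => //; rewrite b7.
Qed.

(** * Hausdorff measure of limsup sets in missing digit sets *)

Section Avoidance.
Context {R : realType}.
Variables (b : nat) (Dl : seq nat) (s A : R).
Hypothesis b_gt1 : (1 < b)%N.
Hypothesis Dl_uniq : uniq Dl.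
Hypothesis Dl_lt : forall d, d \in Dl -> (d < b)%N.
Hypothesis A_ge1 : 1 <= A.
Let words := words b Dl.
Let b0 : (0 < b)%N. Proof. exact: ltnW. Qed.
Let bl0 l : (0 < b ^ l)%N. Proof. by rewrite expn_gt0 b0. Qed.

Definition cyl l : R := ((b ^ l)%:R^-1) `^ s.

Lemma cyl_gt0 l : 0 < cyl l.
Proof. by rewrite powR_gt0// invr_gt0 ltr0n. Qed.

Lemma cylD l m : cyl (l + m) = cyl l * cyl m.
Proof. by rewrite /cyl expnD natrM invfM powRM ?invr_ge0. Qed.

Lemma cyl0 : cyl 0 = 1.
Proof. by rewrite /cyl expn0 invr1 powR1. Qed.

Variables (Good : nat -> nat -> nat -> Prop) (l h : nat -> nat).

Hypothesis scale_step : forall M, exists k (om : nat -> R),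
  [/\ (0 < k)%N, forall v, 0 <= om v,
      0 < \sum_(v <- words k) om v,
      forall j z, (j <= k)%N -> \sum_(v <- words k | (v %/ b ^ (k - j) == z)%N) om v <=
         A * (\sum_(v <- words k) om v) * cyl j &
      forall v, v \in words k -> om v <= (\sum_(v <- words k) om v) * cyl k / 4 /\
        (0 < om v -> Good M k v)].

(* The bad words attached to n: those within 2 of h n at level l n. *)
Let bad n c := (h n + c - 2)%N.

Let below M W n c : bool := (M <= l n)%N && (bad n c %/ b ^ (l n - M) == W)%N.

(** The cost, relative to the cylinder of [W], of the bad words extending [W], as a partial sum over
    the cover. *)
Let weight M W N : R :=
  \sum_(n < N) \sum_(c < 5) (below M W n c)%:R * cyl (l n - M).

Let eps : R := (4 * A)^-1.

(** The invariant of the construction: no prefix of [W] is bad, and the bad words still to come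
    below [W] are cheap. *)
Let clean M W :=
  (forall n (c : 'I_5), (l n <= M)%N -> (W %/ b ^ (M - l n) != bad n c)%N) /\
  (forall N, weight M W N <= eps).

Let cyl_ge0 j : 0 <= cyl j. Proof. exact: ltW (cyl_gt0 j). Qed.
Let A_gt0 : 0 < A. Proof. exact: lt_le_trans A_ge1. Qed.

Let term_ge0 M W n : 0 <= \sum_(c < 5) (below M W n c)%:R * cyl (l n - M) :> R.
Proof. by apply: sumr_ge0 => c _; rewrite mulr_ge0 ?ler0n. Qed.

Let weight_le M W N N' : (N <= N')%N -> weight M W N <= weight M W N'.
Proof.
move=> NN; rewrite /weight (big_ord_widen N' (fun n => \sum_(c < 5) (below M W n c)%:R * cyl (l n - M)) NN).
rewrite big_mkcond; apply: ler_sum => n _; case: ifP => // _; exact: term_ge0.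
Qed.

(** Finitely many continuations are compared at a time, so one partial sum decides for all of them
    whether some partial sum fails. *)
Lemma common_bound (X : eqType) (r : seq X) (P : X -> nat -> Prop) :
  (forall x N N', (N <= N')%N -> P x N -> P x N') ->
  exists N0, forall x, x \in r -> (exists N, P x N) -> P x N0.
Proof.
move=> mono; elim: r => [|x r [N0 ih]]; first by exists 0%N.
have [[N xN]|no] := pselect (exists N, P x N).
  exists (maxn N N0) => y; rewrite inE => /predU1P[-> _|yr ey].
    by apply: mono xN; rewrite leq_maxl.
  by apply: mono (ih _ yr ey); rewrite leq_maxr.
by exists N0 => y; rewrite inE => /predU1P[-> //|]; exact: ih.
Qed.

(** Averaging against [om]. If every v of positive weight failed, the total T would be at most the
    mass caught by bad words of levels M to M + k plus, by Markov, the sum of the new weights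
    against [om] divided by [eps]. The Frostman bound makes the first at most A T [eps] = T / 4; the
    second is at most T / 4 because om v <= T cyl k / 4 and relative costs rescale by [cyl k]. *)
Lemma avoid_step M W : clean M W -> exists k v,
  [/\ (0 < k)%N, v \in words k, Good M k v & clean (M + k) (W * b ^ k + v)].
Proof.
move=> [nobad wle]; have [k [om [k0 om0 T0 frost omP]]] := scale_step M.
set T := \sum_(v <- words k) om v in T0 frost omP.
pose W' v := (W * b ^ k + v)%N.
pose hit v n := [exists c : 'I_5, (M <= l n <= M + k)%N &&
   (W' v %/ b ^ (M + k - l n) == bad n c)%N].
pose P v N := (exists2 n, (n < N)%N & hit v n) \/ eps < weight (M + k) (W' v) N.
have [N0 NP] : exists N0, forall v, v \in words k -> (exists N, P v N) -> P v N0.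
  apply: common_bound => v N N' NN [[n nN hn]|h1]; [left|right].
    by exists n => //; exact: leq_trans NN.
  exact: lt_le_trans (weight_le _ _ NN).
have [[v [vk omv nP]]|no] :=
    pselect (exists v, [/\ v \in words k, 0 < om v & ~ P v N0]).
  have nPN N : ~ P v N by move=> PN; apply: nP; apply: NP => //; exists N.
  exists k, v; split=> //; first by have [_] := omP v vk; apply.
  split=> [n c lM|N]; last first.
    by rewrite leNgt; apply/negP => h1; apply: (nPN N); right.
  have [lM'|Ml] := ltnP (l n) M.
    have -> : ((W * b ^ k + v) %/ b ^ (M + k - l n) = W %/ b ^ (M - l n))%N.
      have -> : (M + k - l n = k + (M - l n))%N by lia.
      rewrite expnD divnMA divnMDl// [(v %/ _)%N]divn_small ?addn0//.
      exact: words_lt vk.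
    by apply: nobad; exact: ltnW.
  apply/negP => bd; apply: (nPN n.+1); left; exists n => //.
  by apply/existsP; exists c; rewrite Ml lM bd.
exfalso.
have all v : v \in words k -> om v <=
    \sum_(n < N0) \sum_(c < 5) ((M <= l n <= M + k)%N &&
      (W' v %/ b ^ (M + k - l n) == bad n c)%N)%:R * om v +
    om v * weight (M + k) (W' v) N0 / eps.
  move=> vk; have e0 : 0 < eps by rewrite invr_gt0 mulr_gt0.
  have w0 : 0 <= weight (M + k) (W' v) N0.
    by apply: sumr_ge0 => n _; exact: term_ge0.
  have := om0 v; rewrite le_eqVlt => /predU1P[<-|ov].
    by rewrite !mul0r addr0; apply: sumr_ge0 => n _; apply: sumr_ge0 => c _; rewrite mulr0.
  have [[n nN /existsP[c hc]]|h1] : P v N0.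
    by apply: contrapT => nP; apply: no; exists v.
  - rewrite -[leLHS]addr0 lerD//; last by rewrite divr_ge0 ?mulr_ge0 ?(ltW e0).
    rewrite (bigD1 (Ordinal nN))//= (bigD1 c)//= hc mul1r -addrA lerDl addr_ge0//.
      by apply: sumr_ge0 => c' _; rewrite mulr_ge0.
    by apply: sumr_ge0 => n' _; apply: sumr_ge0 => c' _; rewrite mulr_ge0.
  - rewrite -[leLHS]add0r lerD//.
      by apply: sumr_ge0 => n' _; apply: sumr_ge0 => c' _; rewrite mulr_ge0.
    by rewrite ler_pdivlMr// ler_wpM2l// ltW.
have hits : \sum_(v <- words k) \sum_(n < N0) \sum_(c < 5) ((M <= l n <= M + k)%N &&
      (W' v %/ b ^ (M + k - l n) == bad n c)%N)%:R * om v <= A * T * weight M W N0.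
  rewrite exchange_big mulr_sumr; apply: ler_sum => n _.
  rewrite exchange_big mulr_sumr; apply: ler_sum => c _.
  have [/andP[Ml lM]|out] := boolP (M <= l n <= M + k)%N; last first.
    rewrite big1 ?mulr_ge0 ?ler0n ?(ltW A_gt0) ?(ltW T0)// => v _.
    by rewrite mul0r.
  set j := (l n - M)%N; have jk : (j <= k)%N by lia.
  have -> : (M + k - l n = k - j)%N by lia.
  have dvE v : v \in words k -> (W' v %/ b ^ (k - j) = W * b ^ j + v %/ b ^ (k - j))%N.
    by move=> _; rewrite /W' -{1}(subnKC jk) expnD mulnA divnMDl.
  rewrite /below Ml/=; case: eqVneq => [WE|Wne] /=.
    rewrite mul1r; apply: le_trans (frost j (bad n c - W * b ^ j)%N jk).
    rewrite [leRHS]big_mkcond big_seq [leRHS]big_seq; apply: ler_sum => v vk.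
    rewrite dvE//; case: eqVneq => [E|_]; last first.
      by rewrite mul0r; case: ifP.
    by rewrite -E addKn eqxx mul1r.
  rewrite mul0r mulr0 big_seq big1// => v vk.
  rewrite dvE//; case: eqVneq => [E|_]; last by rewrite mul0r.
  move: Wne; rewrite -/j -E divnMDl// divn_small ?addn0 ?eqxx//.
  rewrite ltn_divLR// -expnD subnKC//; exact: words_lt vk.
have wts : \sum_(v <- words k) om v * weight (M + k) (W' v) N0 <= T / 4 * weight M W N0.
  apply: (@le_trans _ _ (\sum_(v <- words k) T * cyl k / 4 * weight (M + k) (W' v) N0)).
    rewrite big_seq [leRHS]big_seq; apply: ler_sum => v vk.
    rewrite ler_wpM2r//; first by apply: sumr_ge0 => n _; exact: term_ge0.
    by have [] := omP v vk.
  have T4 : 0 <= T / 4 by rewrite divr_ge0 ?(ltW T0).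
  rewrite -mulr_sumr [T * cyl k / 4]mulrAC -[leLHS]mulrA; apply: (ler_wpM2l T4).
  rewrite exchange_big mulr_sumr; apply: ler_sum => n _.
  rewrite exchange_big mulr_sumr; apply: ler_sum => c _.
  rewrite -mulr_suml.
  have [lM|Ml] := leqP (M + k) (l n); last first.
    rewrite big1 ?mul0r ?mulr0 ?mulr_ge0// => v _.
    by rewrite /below leqNgt Ml.
  have cE : cyl k * cyl (l n - (M + k)) = cyl (l n - M).
    by rewrite -cylD; congr cyl; lia.
  rewrite mulrCA cE ler_wpM2r//.
  have divE : (bad n c %/ b ^ (l n - M) = bad n c %/ b ^ (l n - (M + k)) %/ b ^ k)%N.
    by rewrite -divnMA -expnD; congr (_ %/ b ^ _)%N; lia.
  rewrite /below lM/= (leq_trans (leq_addr k M) lM)/= divE.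
  set p := (bad n c %/ b ^ (l n - (M + k)))%N.
  have [[v vk pE]|none] := pselect (exists2 v, v \in words k & p = W' v).
    have vlt := words_lt b_gt1 Dl_lt vk.
    rewrite pE {1}/W' divnMDl// divn_small// addn0 eqxx.
    rewrite (bigD1_seq v)//=; last exact: words_uniq.
    rewrite eqxx big1 ?addr0// => v' nv.
    by rewrite /W' eqn_add2l eq_sym (negbTE nv).
  rewrite big_seq big1 ?ler0n// => v vk.
  by case: eqVneq => // pE; case: none; exists v.
have e0 : 0 < eps by rewrite invr_gt0 mulr_gt0.
have : T <= A * T * weight M W N0 + T / 4 * weight M W N0 / eps.
  rewrite {1}/T.
  apply: (@le_trans _ _ (\sum_(v <- words k) (\sum_(n < N0) \sum_(c < 5) ((M <= l n <= M + k)%N &&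
      (W' v %/ b ^ (M + k - l n) == bad n c)%N)%:R * om v +
    om v * weight (M + k) (W' v) N0 / eps))).
    by rewrite big_seq [leRHS]big_seq; apply: ler_sum.
  by rewrite big_split/= lerD// -mulr_suml ler_wpM2r// invr_ge0 ltW.
have AE : A * eps = 4^-1 by rewrite /eps; field; rewrite gt_eqF.
have h1 : A * T * weight M W N0 <= T / 4.
  by rewrite [A * T]mulrC -mulrA ler_wpM2l ?(ltW T0)// -AE ler_wpM2l ?(ltW A_gt0).
have h2 : T / 4 * weight M W N0 / eps <= T / 4.
  by rewrite ler_pdivrMr// ler_wpM2l// divr_ge0// ltW.
lra.
Qed.

Lemma avoid : (forall N, \sum_(n < N) cyl (l n) <= eps / 5) ->
  exists st : nat -> nat * nat, [/\ st 0%N = (0, 0)%N,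
    forall i, exists k v, [/\ (0 < k)%N, v \in words k, Good (st i).1 k v &
       st i.+1 = ((st i).1 + k, (st i).2 * b ^ k + v)%N] &
    forall i n (c : 'I_5), (l n <= (st i).1)%N ->
      ((st i).2 %/ b ^ ((st i).1 - l n) != bad n c)%N].
Proof.
move=> sumle.
have e0 : 0 < eps by rewrite invr_gt0 mulr_gt0.
have e1 : eps < 1.
  have A4 : 1 < 4 * A by have := A_ge1; lra.
  by rewrite /eps invf_lt1 ?mulr_gt0.
have c0 : clean 0 0.
  have w N : weight 0 0 N <= eps.
    apply: (@le_trans _ _ (\sum_(n < N) 5 * cyl (l n))).
      apply: ler_sum => n _; apply: (@le_trans _ _ (\sum_(c < 5) cyl (l n))).
        by apply: ler_sum => c _; rewrite subn0 -[leRHS]mul1r ler_wpM2r// lern1 leq_b1.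
      by rewrite sumr_const card_ord -[leLHS]mulr_natl.
    by rewrite -mulr_sumr mulrC -ler_pdivlMr.
  split=> // n c; rewrite leqn0 => /eqP ln0; rewrite sub0n expn0 divn1.
  (* A bad word of level 0 would by itself cost 1, more than [eps]. *)
  apply/eqP => E; have := w n.+1; rewrite leNgt => /negP; apply.
  apply: (lt_le_trans e1); rewrite /weight big_ord_recr/= -[leLHS]add0r lerD//.
    by apply: sumr_ge0 => i _; exact: term_ge0.
  rewrite (bigD1 c)//= /below ln0 sub0n expn0 divn1 -E eqxx mul1r cyl0 lerDl.
  by apply: sumr_ge0 => i _; rewrite mulr_ge0.
pose nxt (x y : nat * nat) := exists k v, [/\ (0 < k)%N, v \in words k, Good x.1 k v &
       y = (x.1 + k, x.2 * b ^ k + v)%N].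
have step (x : {x : nat * nat | clean x.1 x.2}) :
    {y : {x : nat * nat | clean x.1 x.2} | nxt (sval x) (sval y)}.
  apply: cid; case: x => -[M W] /= cl.
  have [k [v [k0 vk g cl']]] := avoid_step cl.
  by exists (exist _ (M + k, W * b ^ k + v)%N cl'), k, v.
pose f i := iter i (fun x => sval (step x)) (exist _ (0, 0)%N c0).
exists (fun i => sval (f i)); split=> // [i|i n c].
  exact: (svalP (step (f i))).
by case: (svalP (f i)) => nb _; exact: nb.
Qed.

End Avoidance.

(** * Hausdorff measure: limsup covers, and cylinders replacing arbitrary sets *)

Section HausdorffMeasure.
Context {R : realType}.
Implicit Types (s : R) (U E : set R).

Lemma diam_le U (r : R) : (forall x y, U x -> U y -> `|x - y| <= r) ->
  (diam U <= r%:E)%E.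
Proof.
move=> h; apply: ge_ereal_sup => _ [[x y] [/= Ux Uy] <-].
by rewrite lee_fin; exact: h.
Qed.

Lemma diam_ge U x y : U x -> U y -> ((`|x - y|)%:E <= diam U)%E.
Proof. by move=> Ux Uy; apply: ereal_sup_ubound; exists (x, y). Qed.

Lemma diam_ge0 U : U !=set0 -> (0 <= diam U)%E.
Proof. by move=> [x Ux]; have := diam_ge Ux Ux; rewrite subrr normr0. Qed.

Lemma diam_pow_ge0 s U : (0 <= diam_pow s U)%E.
Proof. by rewrite /diam_pow; case: asboolP => // _; exact: poweR_ge0. Qed.

Lemma diam_pow_le s U (r : R) : 0 <= s -> 0 <= r ->
  (forall x y, U x -> U y -> `|x - y| <= r) -> (diam_pow s U <= (r `^ s)%:E)%E.
Proof.
move=> s0 r0 h; rewrite /diam_pow; case: asboolP => [_|/eqP/set0P U0].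
  by rewrite lee_fin powR_ge0.
rewrite -poweR_EFin; apply: gt0_ler_poweR => //.
- by rewrite in_itv/= diam_ge0//= leey.
- by rewrite in_itv/= leey andbT lee_fin.
- exact: diam_le.
Qed.

Lemma hausdorff_premeasure_ge0 s d E : (0 <= hausdorff_premeasure s d E)%E.
Proof.
apply: le_ereal_inf_tmp => _ [U _ <-].
by apply: nneseries_ge0 => n _ _; exact: diam_pow_ge0.
Qed.

Lemma sum_geom_tail (r : R) i0 N : 0 <= r < 1 ->
  \sum_(i < N) r ^+ (i0 + i) <= r ^+ i0 / (1 - r).
Proof.
move=> /andP[r0 r1]; have d0 : 0 < 1 - r by rewrite subr_gt0.
rewrite ler_pdivlMr//; under eq_bigr do rewrite exprD.
rewrite -mulr_sumr -mulrA ler_piMr ?exprn_ge0// mulrC.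
have := subrX1 r N; rewrite -opprB -[in X in _ = X -> _]opprB mulNr => /oppr_inj <-.
by rewrite gerBl exprn_ge0.
Qed.

Lemma expr_small (r e : R) : 0 <= r < 1 -> 0 < e -> exists i0, forall i, (i0 <= i)%N -> r ^+ i <= e.
Proof.
move=> /andP[r0 r1] e0.
have := @cvg_expr R r; rewrite ger0_norm// => /(_ r1) /cvgrPdist_le /(_ e e0).
case=> N _ h; exists N => i Ni; have := h i Ni.
by rewrite sub0r normrN ger0_norm// exprn_ge0.
Qed.

(** The convergence half of Borel-Cantelli: the sets of index at least i0 cover [E], and their total
    cost is a geometric tail. *)
Lemma hausdorff_measure_limsup0 s E (L : nat -> seq nat) (I : nat -> nat -> set R)
    (rad : nat -> R) (C r : R) : 0 < s -> 0 <= C -> 0 <= r < 1 ->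
  (forall i, 0 <= rad i) ->
  (forall i v x y, I i v x -> I i v y -> `|x - y| <= rad i) ->
  (forall d : R, 0 < d -> exists i0, forall i, (i0 <= i)%N -> rad i <= d) ->
  (forall i, (size (L i))%:R * rad i `^ s <= C * r ^+ i) ->
  (forall x, E x -> forall i0, exists2 i, (i0 <= i)%N & exists2 v, v \in L i & I i v x) ->
  hausdorff_measure s E = 0%E.
Proof.
move=> s0 C0 r01 rad0 radI radc sumL cov.
suff H d e : 0 < d -> 0 < e -> (hausdorff_premeasure s d E <= e%:E)%E.
  apply/eqP; rewrite eq_le; apply/andP; split; last first.
    apply: le_trans (hausdorff_premeasure_ge0 s 1 E) _.
    by apply: ereal_sup_ubound; exists 1 => //; exact: ltr01.
  apply: ge_ereal_sup => _ [d /= d0 <-]; apply/lee_addgt0Pr => e e0.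
  by rewrite add0e; exact: H.
move=> d0 e0; have [/andP[r0 r1]] := (r01, r01); case=> _.
have d1 : 0 < 1 - r by rewrite subr_gt0.
have [i1 h1] := radc d d0.
have [i2 h2] : exists i0, forall i, (i0 <= i)%N -> C * (r ^+ i / (1 - r)) <= e.
  have e'0 : 0 < e * (1 - r) / (C + 1) by rewrite divr_gt0 ?mulr_gt0// ltr_wpDl.
  have [i0 h] := expr_small r01 e'0; exists i0 => i /h.
  rewrite ler_pdivlMr ?ltr_wpDl// => h'.
  rewrite mulrA ler_pdivrMr//; apply: le_trans h'; rewrite mulrC ler_wpM2l ?exprn_ge0//.
  by rewrite lerDl.
pose i0 := maxn i1 i2.
(* The finite families are concatenated into one sequence. The empty set that opens each block makes
   [F n] at least n long even if the families are empty, so entry n is already settled in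
   [F n.+1]. *)
pose F := fix F n : seq (set R * R) := if n is n'.+1 then
   F n' ++ (set0, 0) :: [seq (I (i0 + n')%N v, rad (i0 + n')%N `^ s) | v <- L (i0 + n')%N]
   else [::].
have sF n : (n <= size (F n))%N.
  by elim: n => //= n ih; rewrite size_cat/= addnS ltnS (leq_trans ih)// leq_addr.
have FS n : F n.+1 = F n ++ (set0, 0) ::
    [seq (I (i0 + n)%N v, rad (i0 + n)%N `^ s) | v <- L (i0 + n)%N] by [].
have Fle n m j : (j < size (F n))%N -> (n <= m)%N ->
    (j < size (F m))%N /\ nth (set0, 0) (F m) j = nth (set0, 0) (F n) j.
  move=> jn; elim: m => [|m ih]; first by rewrite leqn0 => /eqP <-.
  rewrite leq_eqVlt => /predU1P[<-//|]; rewrite ltnS => /ih [jm <-].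
  by rewrite FS nth_cat jm size_cat (leq_trans jm) ?leq_addr.
have FP n m : (n < m)%N -> nth (set0, 0) (F m) n = nth (set0, 0) (F n.+1) n.
  by move=> nm; exact: (Fle n.+1 m n (sF _) nm).2.
pose V n := nth (set0, 0) (F n.+1) n.
have Fin n p : List.In p (F n) ->
    p = (set0, 0) \/ exists i v, [/\ (i0 <= i)%N, v \in L i & p = (I i v, rad i `^ s)].
  elim: n => //= n ih /(@List.in_app_or _ _ _ _) [/ih//|/= [<-|]]; first by left.
  move=> /List.in_map_iff [v [<- vL]]; right; exists (i0 + n)%N, v; split => //.
    exact: leq_addr.
  by elim: (L _) vL => //= a l ihl [->|h]; rewrite inE ?eqxx ?(ihl h) ?orbT.
have VP n : V n = (set0, 0) \/ exists i v, [/\ (i0 <= i)%N, v \in L i & V n = (I i v, rad i `^ s)].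
  apply: (Fin n.+1); rewrite /V; have := sF n.+1.
  move: (F n.+1) => L0; elim: L0 n => // a l ih [|m] /=; first by move=> _; left.
  by rewrite ltnS => /ih ?; right.
have V20 n : 0 <= (V n).2.
  by case: (VP n) => [->//|[i [v [_ _ ->]]]]; rewrite powR_ge0.
have F20 n p : List.In p (F n) -> 0 <= p.2.
  by move=> /Fin [->//|[i [v [_ _ ->]]]]; rewrite powR_ge0.
have VN N : \sum_(n < N) (V n).2 <= e.
  apply: (@le_trans _ _ (\sum_(p <- F N) p.2)).
    rewrite (big_nth (set0, 0)) (big_cat_nat (leq0n N) (sF N))/= -[leLHS]addr0 lerD//.
      rewrite big_mkord le_eqVlt; apply/orP; left; apply/eqP; apply: eq_bigr => n _.
      by rewrite (FP n N).
    rewrite big_nat_cond; apply: sumr_ge0 => j /andP[/andP[_ jl] _].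
    apply: (F20 N); elim: (F N) j jl => // a l ih [|j] /=; first by move=> _; left.
    by rewrite ltnS => /ih ?; right.
  apply: (@le_trans _ _ (\sum_(i < N) C * r ^+ (i0 + i))).
    elim: N => [|n ih]; first by rewrite /= big_nil big_ord0.
    rewrite /= big_cat/= big_ord_recr/= lerD// big_cons add0r big_map/=.
    apply: le_trans (sumL _); rewrite big_const_seq count_predT iter_addr_0 mulrC.
    by rewrite mulr_natr.
  rewrite -mulr_sumr (le_trans _ (h2 i0 _)) ?leq_maxr//.
  by rewrite ler_wpM2l// sum_geom_tail// r0.
apply: (@le_trans _ _ (\sum_(0 <= n <oo) diam_pow s (V n).1)%E).
  apply: ereal_inf_lbound; exists (fun n => (V n).1) => //; split.
    move=> n; case: (VP n) => [->|[i [v [ii _ ->]]]]/=; apply: diam_le.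
      by move=> x y [].
    move=> x y Ix Iy; apply: le_trans (radI _ _ _ _ Ix Iy) _.
    by apply: h1; rewrite (leq_trans _ ii)// leq_maxl.
  move=> x Ex; have [i ii [v vL Iv]] := cov x Ex i0.
  have [n nE] : exists n, V n = (I i v, rad i `^ s).
    pose m := (i - i0)%N; have mE : (i0 + m = i)%N by rewrite subnKC.
    exists (size (F m) + (index v (L i)).+1)%N.
    set n := (size (F m) + _)%N.
    have nl : (n < size (F m.+1))%N.
      by rewrite /= size_cat/= size_map ltn_add2l mE ltnS index_mem.
    have -> : V n = nth (set0, 0) (F (maxn m n).+1) n by rewrite FP// ltnS leq_maxr.
    have [] := Fle _ (maxn m n).+1 _ nl; first by rewrite ltnS leq_maxl.
    move=> _ ->; rewrite FS nth_cat ltnNge leq_addr/= /n addKn/= mE.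
    by rewrite (nth_map 0%N) ?index_mem// nth_index.
  by exists n => //; rewrite nE.
apply: lime_le; first by apply: is_cvg_nneseries => n _ _; exact: diam_pow_ge0.
apply: nearW => N; rewrite big_mkord; apply: (@le_trans _ _ (\sum_(n < N) ((V n).2)%:E)%E).
  apply: lee_sum => n _; case: (VP n) => [->|[i [v [_ _ ->]]]]/=.
    by rewrite /diam_pow; case: asboolP.
  by apply: diam_pow_le => //; [exact: ltW|exact: radI].
by rewrite sumEFin lee_fin.
Qed.

(* A cover by sets U n is turned into levels l n and integers h n such that every
   point of U n lies in a cylinder of level l n whose index is within 2 of h n. *)
Lemma hausdorff_measure_neq0 s E (b : nat) (e0 : R) : 0 < s -> (1 < b)%N -> 0 < e0 ->
  (forall x, E x -> 0 <= x) ->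
  (forall l h : nat -> nat, (forall N, \sum_(n < N) cyl b s (l n) <= e0) ->
    exists2 x, E x & exists u : nat -> nat,
      (forall k, (u k)%:R / (b ^ k)%:R <= x <= (u k).+1%:R / (b ^ k)%:R) /\
      forall n, ~~ ((u (l n) <= h n + 2)%N && (h n <= u (l n) + 2)%N)) ->
  hausdorff_measure s E <> 0%E.
Proof.
move=> s0 b1 e00 E0 av H0.
have bR : 1 < b%:R :> R by rewrite ltr1n.
have b0 : 0 < b%:R :> R by rewrite (lt_trans ltr01).
have bs0 : 0 < b%:R `^ s by rewrite powR_gt0.
(* Passing to cylinders costs a factor b^s and the padding below a factor 2; the cap 1/2 keeps every
   [y n] at most 1. *)
pose e : R := Num.min (e0 / (b%:R `^ s) / 2) 2^-1.
have e_gt0 : 0 < e by rewrite lt_min !divr_gt0//= invr_gt0.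
have P0 : (hausdorff_premeasure s 1 E <= 0)%E.
  by rewrite -H0; apply: ereal_sup_ubound; exists 1 => //; exact: ltr01.
have [_ [U [Ud UE] <-] Ue] : exists2 y, [set (\sum_(0 <= i <oo) diam_pow s (U i))%E
            | U in delta_cover 1 E] y & (y < e%:E)%E.
  by apply: ereal_inf_lt; apply: le_lt_trans P0 _; rewrite lte_fin.
have dfin n : exists2 t : R, 0 <= t & (diam_pow s (U n) = (t `^ s)%:E \/ U n = set0)%E /\
    forall x y, U n x -> U n y -> `|x - y| <= t.
  have [->|/set0P U0] := eqVneq (U n) set0.
    by exists 0 => //; split; [right|move=> x y []].
  have d0 := diam_ge0 U0; have := Ud n; case dE: (diam (U n)) d0 => [t| |]//.
  rewrite lee_fin => t0 _; exists t => //; split.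
    left; rewrite /diam_pow; case: asboolP => [Un|_]; last by rewrite dE poweR_EFin.
    by case: U0 => x; rewrite Un.
  by move=> x y Ux Uy; rewrite -lee_fin -dE; exact: diam_ge.
pose t n := s2val (cid2 (dfin n)).
have t0 n : 0 <= t n := s2valP (cid2 (dfin n)).
have tP n := s2valP' (cid2 (dfin n)); rewrite -/(t _) in tP.
pose w n : R := if `[< U n = set0 >] then 0 else t n `^ s.
have w0 n : 0 <= w n by rewrite /w; case: ifP => // _; exact: powR_ge0.
have wE n : diam_pow s (U n) = (w n)%:E.
  rewrite /w; case: asboolP => [E'|ne]; first by rewrite /diam_pow; case: asboolP.
  by case: (tP n) => [[//|/ne]].
have wN N : \sum_(n < N) w n < e.
  rewrite -lte_fin; apply: le_lt_trans Ue; rewrite -sumEFin.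
  have := @nneseries_lim_ge R (fun n => diam_pow s (U n)) xpredT 0%N N.
  rewrite big_mkord; under eq_bigr do rewrite wE; apply.
  by move=> n _ _; exact: diam_pow_ge0.
(* The padding keeps the size positive even for a single point, so that some level has b^-l between
   y and b y. *)
pose y n : R := (w n + e * 2^-1 ^+ n.+1) `^ s^-1.
have y0 n : 0 < y n by rewrite powR_gt0// ltr_wpDl// mulr_gt0// exprn_gt0.
have w1 n : w n + e * 2^-1 ^+ n.+1 <= 1.
  have h1 : w n < e.
    by have := wN n.+1; rewrite big_ord_recr/=; apply: le_lt_trans; rewrite lerDr sumr_ge0.
  have h2 : e * 2^-1 ^+ n.+1 <= e * 2^-1.
    by rewrite ler_wpM2l ?(ltW e_gt0)// exprS ler_piMr// exprn_ile1//; lra.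
  have : e <= 2^-1 by rewrite ge_min lexx orbT.
  lra.
have y1 n : y n <= 1.
  have p1 : 1 `^ s^-1 = 1 :> R by rewrite powR1.
  by rewrite -p1 ge0_ler_powR ?nnegrE// ?invr_ge0 ?ltW// ltr_wpDl// mulr_gt0// exprn_gt0.
have ys n : y n `^ s = w n + e * 2^-1 ^+ n.+1.
  rewrite -powRrM mulVf ?gt_eqF// powRr1// ltW// ltr_wpDl// mulr_gt0// exprn_gt0//.
have lev n : exists l, y n <= (b ^ l)%:R^-1 /\ (b ^ l)%:R^-1 <= b%:R * y n.
  have b1' : 0 <= (b%:R^-1 : R) < 1 by rewrite invr_ge0 ler0n/= invf_lt1.
  have [i0 hi] := expr_small b1' (y0 n).
  have ex : exists l, (b ^ l.+1)%:R^-1 <= y n.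
    by exists i0; have := hi i0.+1 (leqnSn _); rewrite exprVn natrX.
  have [l hl lmin] := ex_minnP ex; exists l; split.
    case: l hl lmin => [|l] hl lmin; first by rewrite expn0 invr1.
    by rewrite leNgt; apply/negP => /ltW /lmin; rewrite ltnn.
  by rewrite -ler_pdivrMl//; move: hl; rewrite expnS natrM invfM.
pose l n := projT1 (cid (lev n)).
have lP n := projT2 (cid (lev n)); rewrite -/(l _) in lP.
pose pt n : R := if pselect (exists2 x, U n x & E x) is left ex then s2val (cid2 ex) else 0.
pose h n := Num.trunc (pt n * (b ^ l n)%:R).
have [N|x Ex [u [ux unear]]] := av l h.
  have b2 : \sum_(n < N) cyl b s (l n) <= b%:R `^ s * (2 * e).
    apply: (@le_trans _ _ (\sum_(n < N) b%:R `^ s * (w n + e * 2^-1 ^+ n.+1))).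
      apply: ler_sum => n _; rewrite -ys -powRM ?ler0n// ?(ltW (y0 n))//.
      by rewrite /cyl ge0_ler_powR ?nnegrE ?(ltW s0) ?invr_ge0// ?mulr_ge0 ?(ltW (y0 n))//; case: (lP n).
    rewrite -mulr_sumr ler_wpM2l ?powR_ge0// big_split/= mulr_natl mulr2n lerD ?(ltW (wN N))//.
    rewrite -mulr_sumr ler_piMr ?(ltW e_gt0)//.
    have h2 : 0 <= (2^-1 : R) < 1 by rewrite invr_ge0 ler0n invf_lt1 ?ltr1n.
    by apply: le_trans (sum_geom_tail 1 N h2) _; rewrite expr1 (_ : 1 - 2^-1 = 2^-1) ?divff//; field.
  apply: (le_trans b2); have : e <= e0 / (b%:R `^ s) / 2 by rewrite ge_min lexx.
  by rewrite ler_pdivlMr// ler_pdivlMr// [_ * 2]mulrC [b%:R `^ s * _]mulrC.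
have [n _ Unx] := UE x Ex.
have [Upt Ept] : U n (pt n) /\ E (pt n).
  rewrite /pt; case: pselect => [ex|]; last by case; exists x.
  by case: (cid2 ex).
have tl : t n <= (b ^ l n)%:R^-1.
  apply: le_trans (lP n).1; rewrite -[t n](powRr1 (t0 n)) -(divff (_ : s != 0)) ?gt_eqF//.
  rewrite powRrM ge0_ler_powR ?nnegrE ?powR_ge0 ?invr_ge0 ?(ltW s0)//.
    by rewrite addr_ge0// mulr_ge0 ?exprn_ge0 ?(ltW e_gt0).
  rewrite /w; case: asboolP => [Un|_]; first by move: Unx; rewrite Un.
  by rewrite lerDl mulr_ge0 ?exprn_ge0 ?(ltW e_gt0).
have xpt : `|x - pt n| <= (b ^ l n)%:R^-1 by apply: le_trans tl; case: (tP n) => _; apply.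
have B0 : 0 < (b ^ l n)%:R :> R by rewrite ltr0n expn_gt0 (ltnW b1).
have /negP := unear n; apply.
have := ux (l n); rewrite ler_pdivrMr// ler_pdivlMr// => /andP[u1 u2].
have := trunc_itv (mulr_ge0 (E0 _ Ept) (ltW B0)); rewrite -/(h n) => /andP[h1 h2].
move: xpt; rewrite -(ler_pM2r B0) mulVf ?gt_eqF// => xpt.
(* The rescaled points are at distance at most 1, yet the indices may differ by 2, as closed
   cylinders share end points. *)
have : `|x * (b ^ l n)%:R - pt n * (b ^ l n)%:R| <= 1.
  by rewrite -mulrBl normrM (ger0_norm (ltW B0)).
rewrite ler_norml => /andP[d1 d2].
rewrite -[(u (l n) <= _)%N]ltnS -(ltr_nat R) -[(h n <= _)%N]ltnS -(ltr_nat R).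
rewrite -natr1 natrD -[(u (l n) + 2).+1%:R]natr1 natrD.
move: u2 h2; rewrite -[(u (l n)).+1%:R]natr1 -[(h n).+1%:R]natr1.
move: (x * _) (pt n * _) ((u _)%:R) ((h n)%:R) u1 h1 d1 d2 => a c u' h'.
by clear=> *; apply/andP; split; lra.
Qed.

End HausdorffMeasure.

(** * Digit expansions as nested cylinders *)

Section DigitExpansions.
Context {R : realType}.
Variables (b : nat) (D : {set 'I_b}).
Hypothesis b_gt1 : (1 < b)%N.
Let Dl := digits D.
Let words := words b Dl.
Let K : set R := missing_digit_set R D.
Let b0 : (0 < b)%N. Proof. exact: ltnW. Qed.
Let bR : 0 < b%:R :> R. Proof. by rewrite ltr0n. Qed.
Let bk k : 0 < (b ^ k)%:R :> R. Proof. by rewrite ltr0n expn_gt0 b0. Qed.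

Definition cylinder k v : set R := [set x | v%:R / (b ^ k)%:R <= x <= v.+1%:R / (b ^ k)%:R].

Lemma cylinder_dist k v x y : cylinder k v x -> cylinder k v y ->
  `|x - y| <= (b ^ k)%:R^-1.
Proof.
move=> /andP[x1 x2] /andP[y1 y2]; move: x2 y2; rewrite -natr1 mulrDl mul1r => x2 y2.
by rewrite ler_norml; apply/andP; split; lra.
Qed.

Lemma digit_series (d u : nat -> nat) : (forall n, d n < b)%N -> u 0%N = 0%N ->
  (forall n, u n.+1 = u n * b + d n)%N ->
  exists2 x : R, series (fun n => (d n)%:R / b%:R ^+ n.+1 : R) @ \oo --> x &
    forall k, cylinder k (u k) x.
Proof.
move=> db u0 uS.
have sE k : series (fun n => (d n)%:R / b%:R ^+ n.+1 : R) k = (u k)%:R / (b ^ k)%:R.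
  elim: k => [|k ih]; first by rewrite /series/= big_geq// u0 mul0r.
  rewrite seriesSr ih uS natrD natrM -natrX expnSr natrM.
  by field; rewrite !gt_eqF ?bk.
have nd : nondecreasing_seq (series (fun n => (d n)%:R / b%:R ^+ n.+1 : R)).
  apply/nondecreasing_seqP => n; rewrite seriesSr lerDl divr_ge0// exprn_ge0//.
have ub k m : (u (k + m))%:R / (b ^ (k + m))%:R <= (u k).+1%:R / (b ^ k)%:R :> R.
  have : (u (k + m)%N < (u k).+1 * b ^ m)%N.
    elim: m => [|m ih]; first by rewrite addn0 expn0 muln1.
    rewrite addnS uS expnSr mulnA; have := db (k + m)%N; nia.
  move=> h; rewrite expnD natrM ler_pdivrMr ?mulr_gt0// mulrA divfK ?gt_eqF//.
  by rewrite -natrM ler_nat ltnW.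
have cv : cvgn (series (fun n => (d n)%:R / b%:R ^+ n.+1 : R)).
  apply: nondecreasing_is_cvgn => //; exists 1 => _ [n _ <-].
  by rewrite sE; have := ub 0%N n; rewrite add0n u0 expn0 divr1.
exists (limn (series (fun n => (d n)%:R / b%:R ^+ n.+1 : R))) => // k.
apply/andP; split; first by rewrite -sE; apply: nondecreasing_cvgn_le.
apply: limr_le => //; exists k => // n /= kn.
by rewrite sE -(subnKC kn) ub.
Qed.

Lemma missing_digit_prefix x : K x -> exists u : nat -> nat,
  (forall k, u k \in words k) /\ forall k, cylinder k (u k) x.
Proof.
move=> [_ [d dD cvx]].
pose u := fix u n := if n is n'.+1 then (u n' * b + d n')%N else 0%N.
have [y cvy uy] := digit_series (fun n => ltn_ord (d n)) (erefl : u 0%N = 0%N) (fun n => erefl).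
have -> : x = y by exact: (cvg_unique _ cvx cvy).
exists u; split=> //; elim=> [|k ih] //.
apply/allpairsP; exists (u k, val (d k)); split=> //=.
by apply/mapP; exists (d k); rewrite ?mem_enum.
Qed.

Lemma prefix_missing_digit (u : nat -> nat) : (forall k, u k \in words k) ->
  (forall k, u k.+1 %/ b = u k)%N ->
  exists2 x, K x & forall k, cylinder k (u k) x.
Proof.
move=> uw uS.
have dD n : {i : 'I_b | i \in D & (u n.+1 %% b)%N = i}.
  have := uw n.+1; rewrite mem_wordsS//; last exact: digits_lt.
  move=> /andP[_ /mapP h]; apply: cid2; case: h => i.
  by rewrite mem_enum => iD E; exists i.
pose d n := s2val (dD n).
have dE n : (u n.+1 %% b)%N = d n := s2valP' (dD n).
have u0 : u 0%N = 0%N by apply/eqP; have := uw 0%N; rewrite inE.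
have [x cvx ux] := digit_series (fun n => ltn_ord (d n)) u0
  (fun n => etrans (divn_eq (u n.+1) b) (congr2 (fun p q => p * b + q)%N (uS n) (dE n))).
exists x => //; split; first by have := ux 0%N; rewrite /cylinder/= u0 expn0 !divr1.
by exists d => // n; exact: (s2valP (dD n)).
Qed.

(** A cheap cover becomes a list of bad words. The words chosen by [avoid] are prefixes of a single
    expansion; its value lies in [K], is good at infinitely many scales, and its prefixes are never
    bad. *)
Lemma scale_measure_neq0 (s A : R) (Good : nat -> nat -> nat -> Prop) (E : set R) :
  0 < s -> 1 <= A ->
  (forall M, exists k (om : nat -> R),
  [/\ (0 < k)%N, forall v, 0 <= om v,
      0 < \sum_(v <- words k) om v,
      forall j z, (j <= k)%N -> \sum_(v <- words k | (v %/ b ^ (k - j) == z)%N) om v <=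
         A * (\sum_(v <- words k) om v) * cyl b s j &
      forall v, v \in words k -> om v <= (\sum_(v <- words k) om v) * cyl b s k / 4 /\
        (0 < om v -> Good M k v)]) ->
  (forall x, E x -> 0 <= x) ->
  (forall x, K x -> (forall i, exists M k W v, [/\ (i <= M)%N, Good M k v &
     cylinder (M + k) (W * b ^ k + v) x]) -> E x) ->
  hausdorff_measure s E <> 0%E.
Proof.
move=> s0 A1 step E0 EK.
have A0 : 0 < A by apply: lt_le_trans A1.
apply: (@hausdorff_measure_neq0 _ s E b ((4 * A)^-1 / 5)) => //.
  by rewrite divr_gt0// invr_gt0 mulr_gt0.
move=> l h sl.
have [st [st0 stS nb]] := avoid b_gt1 (digits_uniq D) (@digits_lt _ D) A1 h step sl.
have stM i : (i <= (st i).1)%N.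
  elim: i => // i ih; have [k [v [k0 _ _ ->]]] := stS i; rewrite /=; lia.
have stw i : (st i).2 \in words (st i).1.
  elim: i => [|i ih]; first by rewrite st0.
  have [k [v [k0 vk _ ->]]] := stS i.
  by apply: mem_words_cat => //; exact: digits_lt.
have stp i m : ((st i).1 <= (st (i + m)%N).1)%N /\
    ((st (i + m)%N).2 %/ b ^ ((st (i + m)%N).1 - (st i).1) = (st i).2)%N.
  elim: m => [|m [ih1 ih2]]; first by rewrite addn0 subnn expn0 divn1.
  rewrite addnS; have [k [v [k0 vk _ ->]]] := stS (i + m)%N; rewrite /=.
  split; first by rewrite (leq_trans ih1)// leq_addr.
  have -> : ((st (i + m)%N).1 + k - (st i).1 = k + ((st (i + m)%N).1 - (st i).1))%N by lia.
  rewrite expnD divnMA divnMDl ?expn_gt0 ?b0// [(v %/ _)%N]divn_small ?addn0//.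
  by apply: words_lt vk => //; exact: digits_lt.
(* After k rounds the chosen word has length at least k, and its first k letters no longer
   change. *)
pose u k := ((st k).2 %/ b ^ ((st k).1 - k))%N.
have uE i k : (k <= (st i).1)%N -> ((st i).2 %/ b ^ ((st i).1 - k) = u k)%N.
  move=> ki; have [ik|ik] := leqP i k.
    rewrite /u -(subnKC ik); have [h1 <-] := stp i (k - i)%N.
    rewrite -divnMA -expnD; congr (_ %/ b ^ _)%N.
    by rewrite subnKC// in h1 *; lia.
  rewrite /u; have [h1 <-] := stp k (i - k)%N; rewrite subnKC ?(ltnW ik)// in h1 *.
  by rewrite -divnMA -expnD; congr (_ %/ b ^ _)%N; have := stM k; lia.
have uw k : u k \in words k.
  rewrite /u; have h1 := stM k.
  have := stw k; rewrite -{1}(subnKC h1).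
  by move/words_prefix; apply => //; exact: digits_lt.
have uS k : (u k.+1 %/ b = u k)%N.
  rewrite -(uE k.+1 k) ?(leq_trans _ (stM k.+1))// /u -{2}(expn1 b) -divnMA -expnD.
  by congr (_ %/ b ^ _)%N; have := stM k.+1; lia.
have [x Kx ux] := prefix_missing_digit uw uS.
exists x; last first.
  exists u; split=> [k|n]; first exact: ux.
  apply/negP => /andP[n1 n2].
  have c5 : (u (l n) + 2 - h n < 5)%N by lia.
  have := nb (l n) n (Ordinal c5) (stM _); rewrite uE ?stM//=.
  by move/eqP; apply; lia.
apply: EK => // i; have [k [v [k0 vk G stE]]] := stS i.
exists (st i).1, k, (st i).2, v; split=> //.
have := ux (st i.+1).1; rewrite -(uE i.+1)// subnn expn0 divn1 stE.
by [].
Qed.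

End DigitExpansions.

Section HausdorffDimension.
Context {R : realType}.
Implicit Types (s : R) (E F : set R).

(** The infimum defining the dimension includes s = 0, while the avoidance argument takes s > 0. *)
Lemma hausdorff_measure_neq0_zero E : E !=set0 -> hausdorff_measure 0 E <> 0%E.
Proof.
move=> [x Ex] H0.
have P0 : (hausdorff_premeasure 0 1 E <= 0)%E.
  by rewrite -H0; apply: ereal_sup_ubound; exists 1 => //; exact: ltr01.
have [_ [U [Ud UE] <-] Ue] : exists2 y, [set (\sum_(0 <= i <oo) diam_pow 0 (U i))%E
            | U in delta_cover 1 E] y & (y < 1)%E.
  by apply: ereal_inf_lt; apply: le_lt_trans P0 _; rewrite lte_fin.
have [n _ Unx] := UE x Ex.
move: Ue; rewrite ltNge => /negP; apply.
apply: (@le_trans _ _ (diam_pow 0 (U n))).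
  rewrite /diam_pow; case: asboolP => [E0|_]; first by move: Unx; rewrite E0.
  by rewrite poweRe0.
have := @nneseries_lim_ge R (fun n => diam_pow 0 (U n)) xpredT 0%N n.+1
  (fun n _ _ => diam_pow_ge0 _ _).
apply: le_trans; rewrite big_mkord big_ord_recr/= leeDr// sume_ge0// => i _.
exact: diam_pow_ge0.
Qed.

Lemma hausdorff_measure_eq0_sub s E F : E `<=` F ->
  hausdorff_measure s F = 0%E -> hausdorff_measure s E = 0%E.
Proof.
move=> EF F0; apply/eqP; rewrite eq_le; apply/andP; split; last first.
  apply: le_trans (hausdorff_premeasure_ge0 s 1 E) _.
  by apply: ereal_sup_ubound; exists 1 => //; exact: ltr01.
rewrite -F0; apply: ge_ereal_sup => _ [d d0 <-].
apply: (@le_trans _ _ (hausdorff_premeasure s d F)); last first.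
  by apply: ereal_sup_ubound; exists d.
apply: ereal_inf_le_tmp => _ [U [U1 U2] <-]; exists U => //; split=> //.
exact: subset_trans U2.
Qed.

Lemma hausdorff_dim_sub E F : E `<=` F -> (hausdorff_dim E <= hausdorff_dim F)%E.
Proof.
move=> EF; apply: ereal_inf_le_tmp => _ [s [s0 sF] <-]; exists s => //; split=> //.
exact: hausdorff_measure_eq0_sub sF.
Qed.

Lemma hausdorff_dim_ge E (s0 : R) : E !=set0 ->
  (forall s, 0 < s < s0 -> hausdorff_measure s E <> 0%E) -> (s0%:E <= hausdorff_dim E)%E.
Proof.
move=> Ene h; apply: le_ereal_inf_tmp => _ [s [s1 sE] <-].
rewrite lee_fin leNgt; apply/negP => ss0.
move: s1; rewrite le_eqVlt => /predU1P[s1|s1].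
  by move: sE; rewrite -s1; exact: hausdorff_measure_neq0_zero.
by apply: (h s) => //; rewrite s1.
Qed.

Lemma hausdorff_dim_le E (s0 : R) : 0 <= s0 ->
  (forall s, s0 < s -> hausdorff_measure s E = 0%E) -> (hausdorff_dim E <= s0%:E)%E.
Proof.
move=> s00 h; apply/lee_addgt0Pr => e e0; rewrite -EFinD.
apply: ereal_inf_lbound; exists (s0 + e) => //; split; last by apply: h; rewrite ltrDl.
by rewrite addr_ge0// ltW.
Qed.

End HausdorffDimension.

(** * A weight on words near rationals of a given size *)

Section NearRationals.

(** Distinct fractions would be at least 1 / (q q') > 1 / (4 Q^2) apart, whereas each is within 1 /
    B of its word and the words are within r / B. *)
Lemma near_rational_eq B Q r p q W p' q' W' :
  (q < 2 * Q)%N -> (q' < 2 * Q)%N -> (4 * Q ^ 2 * (r + 2) <= B)%N -> (W' <= W + r)%N ->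
  (W <= W' + r)%N ->
  (q * W < B * p + q)%N -> (B * p < q * W + q)%N ->
  (q' * W' < B * p' + q')%N -> (B * p' < q' * W' + q')%N -> (p * q' = p' * q)%N.
Proof.
have H p1 q1 W1 p2 q2 W2 : (q1 < 2 * Q)%N -> (q2 < 2 * Q)%N ->
    (4 * Q ^ 2 * (r + 2) <= B)%N -> (W2 <= W1 + r)%N ->
    (q1 * W1 < B * p1 + q1)%N -> (B * p2 < q2 * W2 + q2)%N -> (p2 * q1 <= p1 * q2)%N.
  move=> h1 h2 hB hW n1 n2; rewrite leqNgt; apply/negP => lt.
  have a1 : (q1 * (B * p2) <= q1 * (q2 * W2 + q2))%N by rewrite leq_mul2l (ltnW n2) orbT.
  have a2 : (q2 * (q1 * W1) <= q2 * (B * p1 + q1))%N by rewrite leq_mul2l (ltnW n1) orbT.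
  have a3 : (B * (p1 * q2 + 1) <= B * (p2 * q1))%N by rewrite leq_mul2l addn1 lt orbT.
  have a4 : (q1 * q2 * W2 <= q1 * q2 * (W1 + r))%N by rewrite leq_mul2l hW orbT.
  have q10 : (0 < q1)%N by case: q1 n1 h1 {a1 a2 a3 a4} lt => //; rewrite muln0 ltn0.
  have a5 : (B <= q1 * q2 * (r + 2))%N by lia.
  have a6 : (q1 * q2 < 4 * Q ^ 2)%N by nia.
  have a7 : (q1 * q2 * (r + 2) < 4 * Q ^ 2 * (r + 2))%N by rewrite ltn_mul2r a6 addn2.
  lia.
move=> h1 h2 hB w1 w2 n1 n2 n3 n4; apply/eqP; rewrite eqn_leq; apply/andP; split.
  exact: (H p' q' W' p q W).
exact: (H p q W p' q' W').
Qed.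

Lemma near_rational_close B p q W p' q' W' : (0 < q)%N -> (0 < q')%N ->
  (p * q' = p' * q)%N ->
  (q * W < B * p + q)%N -> (B * p' < q' * W' + q')%N -> (W <= W' + 1)%N.
Proof.
move=> q0 q'0 E n1 n2; rewrite leqNgt; apply/negP => lt.
have a1 : (q' * (q * W) < q' * (B * p + q))%N by rewrite ltn_pmul2l.
have a2 : (q * (B * p') < q * (q' * W' + q'))%N by rewrite ltn_pmul2l.
have a3 : (q * q' * (W' + 2) <= q * q' * W)%N by rewrite leq_mul2l orbC; lia.
have a4 : (B * (p * q') = B * (p' * q))%N by rewrite E.
lia.
Qed.

Lemma count_multiples q a n : (0 < q)%N ->
  (count (dvdn q) (iota a n) <= n %/ q + 1)%N.
Proof.
move=> q0; have E : (count (dvdn q) (iota a n) + (a + q.-1) %/ q = (a + n + q.-1) %/ q)%N.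
  elim: n => [|n ih]; first by rewrite /= addn0.
  rewrite -addn1 iotaD count_cat/= addn0 addn1 addnS addSn divnS// -ih.
  have -> : (q %| (a + n + q.-1).+1)%N = (q %| a + n)%N.
    by rewrite -addnS prednK// dvdn_addl.
  lia.
have := leq_divDl q (a + q.-1) n.
have -> : (a + q.-1 + n = a + n + q.-1)%N by lia.
by rewrite -E; lia.
Qed.

End NearRationals.

Section PrefixSums.
Context {R : realType}.
Variables (b : nat) (Dl : seq nat).
Hypothesis b_gt1 : (1 < b)%N.
Hypothesis Dl_uniq : uniq Dl.
Hypothesis Dl_lt : forall d, d \in Dl -> (d < b)%N.
Let words := words b Dl.
Let bl0 l : (0 < b ^ l)%N. Proof. by rewrite expn_gt0 (ltnW b_gt1). Qed.

Lemma sum_words_prefix m l (P : pred nat) (f : nat -> R) :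
  \sum_(v <- words (m + l) | P (v %/ b ^ l)%N) f v =
  \sum_(w <- words m | P w) \sum_(v <- words l) f (w * b ^ l + v)%N.
Proof.
rewrite big_mkcond big_words_add//.
rewrite [RHS]big_mkcond; apply: eq_bigr => w _.
rewrite big_seq; transitivity (\sum_(v <- words l | v \in words l)
    if P w then f (w * b ^ l + v)%N else 0).
  apply: eq_bigr => v vl; rewrite divnMDl// divn_small ?addn0//.
  exact: words_lt vl.
by rewrite -big_seq; case: (P w) => //; rewrite big1.
Qed.

Lemma sum_words_eq m (z : nat) (f : nat -> R) : (forall w, 0 <= f w) ->
  \sum_(w <- words m | w == z) f w <= f z.
Proof.
move=> f0; rewrite -big_filter.
have : (size [seq w <- words m | w == z] <= 1)%N.
  apply: (@uniq_leq_size _ _ [:: z]); first by rewrite filter_uniq// words_uniq.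
  by move=> x; rewrite mem_filter inE => /andP[].
have : {in [seq w <- words m | w == z], forall w, w = z}.
  by move=> w; rewrite mem_filter => /andP[/eqP].
case: [seq _ <- _ | _] => [_ _|x [|//]]; first by rewrite big_nil.
by move=> /(_ x) E _; rewrite big_seq1 E ?inE.
Qed.

Lemma count_prefix m l z : \sum_(v <- words (m + l) | (v %/ b ^ l == z)%N) (1 : R) <=
  (size Dl)%:R ^+ l.
Proof.
rewrite (sum_words_prefix m l (fun w => w == z) (fun=> 1)).
apply: le_trans (sum_words_eq _ _ _) _; first by move=> w; apply: sumr_ge0.
by rewrite big_const_seq count_predT iter_addr_0 size_words natrX.
Qed.

Lemma sum_words_le_ord m (f : nat -> R) : (forall w, 0 <= f w) ->
  \sum_(w <- words m) f w <= \sum_(w < b ^ m) f w.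
Proof.
move=> f0; rewrite -(big_mkord xpredT f) /index_iota subn0.
rewrite [leRHS](bigID (mem (words m)))/= -[leLHS]addr0 lerD//; last exact: sumr_ge0.
rewrite -[leRHS]big_filter; rewrite le_eqVlt; apply/orP; left; apply/eqP.
apply: perm_big; apply: uniq_perm; rewrite ?words_uniq ?filter_uniq ?iota_uniq//.
move=> w; rewrite mem_filter mem_iota/= add0n.
by case: (boolP (w \in words m)) => // /words_lt ->.
Qed.

End PrefixSums.

(** * The dimension of the missing digit set *)

Section DimensionOfK.
Context {R : realType}.
Variables (b : nat) (D : {set 'I_b}).
Hypothesis b_gt2 : (2 < b)%N.
Hypothesis D_card : #|D| = (b - 1)%N.
Let b1 : (1 < b)%N. Proof. exact: ltnW. Qed.
Let bR : 1 < b%:R :> R. Proof. by rewrite ltr1n. Qed.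
Let b0 : 0 < b%:R :> R. Proof. exact: lt_trans ltr01 bR. Qed.
Let Dl := digits D.
Let K : set R := missing_digit_set R D.

Definition kappa : R := ln (b%:R - 1) / ln b%:R.

Lemma ln_b_gt0 : 0 < ln b%:R :> R. Proof. by rewrite ln_gt0. Qed.

Lemma powR_kappa : b%:R `^ kappa = b%:R - 1 :> R.
Proof.
have b10 : 0 < b%:R - 1 :> R by rewrite subr_gt0.
by rewrite /powR gt_eqF// /kappa divfK ?gt_eqF ?ln_b_gt0// lnK.
Qed.

Lemma size_Dl : (size Dl)%:R = b%:R `^ kappa :> R.
Proof. by rewrite size_digits D_card natrB ?powR_kappa// ltnW. Qed.

Lemma kappa_gt0 : 0 < kappa.
Proof.
rewrite divr_gt0 ?ln_b_gt0// ln_gt0// ltrBrDr (_ : 1 + 1 = 2%:R) ?ltr_nat//.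
Qed.

Lemma kappa_lt1 : kappa < 1.
Proof. by rewrite ltr_pdivrMr ?ln_b_gt0// mul1r ltr_ln ?posrE ?subr_gt0// gtrBl. Qed.

Lemma cylE s l : cyl b s l = b%:R `^ (- (s * l%:R)) :> R.
Proof.
rewrite /cyl natrX -powR_mulrn ?(ltW b0)// -powR_inv1 ?powR_ge0//.
by rewrite -!powRrM; congr (_ `^ _); ring.
Qed.

Lemma size_words_powR l : (size (words b Dl l))%:R = b%:R `^ (kappa * l%:R) :> R.
Proof. by rewrite size_words natrX size_Dl powRrM powR_mulrn// powR_ge0. Qed.

Lemma sum_words1 l : \sum_(v <- words b Dl l) (1 : R) = b%:R `^ (kappa * l%:R).
Proof. by rewrite -size_words_powR big_const_seq count_predT iter_addr_0. Qed.

Lemma powR_bD x y : b%:R `^ (x + y) = b%:R `^ x * b%:R `^ y :> R.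
Proof. by rewrite powRD// (gt_eqF b0) implybT. Qed.

Lemma powR_b_le x y : x <= y -> b%:R `^ x <= b%:R `^ y :> R.
Proof. by apply: ler_powR; exact: ltW. Qed.

Lemma powR_b_lt1 x : x < 0 -> 0 <= (b%:R `^ x : R) < 1.
Proof.
move=> x0; rewrite powR_ge0/=.
by rewrite /powR gt_eqF// expR_lt1 nmulr_rlt0// ln_b_gt0.
Qed.

Lemma powR_b_small (x e : R) : x < 0 -> 0 < e -> exists i0, forall i, (i0 <= i)%N ->
  b%:R `^ (x * i%:R) <= e.
Proof.
move=> x0 e0; have [i0 h] := expr_small (powR_b_lt1 x0) e0; exists i0 => i /h.
by rewrite powRrM powR_mulrn ?powR_ge0.
Qed.

Lemma invr_powR_b i : (b ^ i)%:R^-1 = b%:R `^ (- i%:R) :> R.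
Proof. by rewrite powRN natrX powR_mulrn// ltW. Qed.

Lemma missing_digit_set_neq0 : K !=set0.
Proof.
have [d dD] : exists d : 'I_b, d \in D by apply/card_gt0P; rewrite D_card; lia.
pose u := fix u n := if n is n'.+1 then (u n' * b + d)%N else 0%N.
have [x Kx _] : exists2 x : R, K x & forall k, cylinder b k (u k) x.
  apply: prefix_missing_digit => //; last first.
    by move=> k; rewrite /= divnMDl ?(ltnW b1)// divn_small ?addn0.
  elim=> [|k ih]; first by rewrite inE.
  apply/allpairsP; exists (u k, val d); split=> //=.
  by apply/mapP; exists d; rewrite ?mem_enum.
by exists x.
Qed.

Lemma hausdorff_dim_missing_digit : hausdorff_dim K = kappa%:E.
Proof.
apply/eqP; rewrite eq_le; apply/andP; split.
  apply: hausdorff_dim_le => [|s ks]; first exact/ltW/kappa_gt0.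
  apply: (@hausdorff_measure_limsup0 _ s K (words b Dl) (@cylinder R b)
    (fun i => (b ^ i)%:R^-1) 1 (b%:R `^ (kappa - s))) => //.
  - exact: lt_trans kappa_gt0 ks.
  - by apply: powR_b_lt1; rewrite subr_lt0.
  - by move=> i v x y; exact: cylinder_dist.
  - move=> d d0; have [i0 h] := @powR_b_small (-1) d (ltrN10 _) d0.
    by exists i0 => i /h; rewrite mulN1r invr_powR_b.
  - move=> i; rewrite mul1r size_words_powR invr_powR_b -powRrM -powR_bD.
    by rewrite -powR_mulrn ?powR_ge0// -powRrM; apply: powR_b_le; rewrite mulNr mulrBl [i%:R * s]mulrC.
  - by move=> x /missing_digit_prefix-/(_ b1) [u [uw ux]] i0; exists i0 => //; exists (u i0).
apply: hausdorff_dim_ge; first exact: missing_digit_set_neq0.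
move=> s /andP[s0 sk]; have ks : s - kappa < 0 by rewrite subr_lt0.
have e4 : 0 < 4^-1 :> R by rewrite invr_gt0.
have [k0 hk] := powR_b_small ks e4.
(* No approximation is required here: the weight is uniform, and k is large enough to give the
   factor 1/4. *)
apply: (@scale_measure_neq0 _ b D b1 s 1 (fun _ _ _ => True)) => //.
- move=> _; exists k0.+1, (fun=> 1); split=> //.
  + by rewrite sum_words1 powR_gt0.
  + move=> j z jk; rewrite sum_words1 mul1r cylE.
    have -> : words b (digits D) k0.+1 = words b Dl (j + (k0.+1 - j)) by rewrite subnKC.
    apply: le_trans (count_prefix b1 (digits_uniq D) (@digits_lt _ D) _ _ _) _.
    rewrite size_Dl -powR_mulrn ?powR_ge0// -powRrM -powR_bD.
    apply: powR_b_le; rewrite natrB// mulrBr lerD2l lerN2 ler_wpM2r//.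
    exact: ltW.
  + move=> v _; split=> //; rewrite sum_words1 cylE -powR_bD.
    rewrite ler_pdivlMr// mul1r -[leLHS]invrK -[leRHS]invrK lef_pV2 ?posrE ?invr_gt0 ?powR_gt0//.
    rewrite -powRN (le_trans _ (hk k0.+1 (leqnSn _)))//; apply: powR_b_le.
    by rewrite opprD opprK mulrBl addrC.
- by move=> x [/andP[]].
Qed.

End DimensionOfK.

Section Weight.
Context {R : realType}.
Implicit Types (Q B W : nat).

Definition weight Q B W : R := \sum_(q <- iota Q Q) (tent (1 * q) B (q * W))%:R / q%:R ^+ 2.

Lemma weight_ge0 Q B W : 0 <= weight Q B W.
Proof. by apply: sumr_ge0 => q _; rewrite divr_ge0. Qed.

(** All q in [Q, 2 Q) whose tent sees [W] give the same fraction, hence are multiples of its reduced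
    denominator; that is the q obtained here, possibly far below Q. There are at most Q / q + 1 of
    them, each contributing at most 1 / Q, so only a small reduced denominator makes the weight
    large. *)
Lemma weight_gt0 Q B W : (0 < Q)%N -> (8 * Q ^ 2 <= B)%N -> 0 < weight Q B W ->
  exists p q, [/\ (0 < q < 2 * Q)%N, (q * W < B * p + q)%N, (B * p < q * W + q)%N &
    weight Q B W <= (Q %/ q + 1)%:R / Q%:R].
Proof.
move=> Q0 QB w0.
have QB' q : (q < 2 * Q)%N -> (1 * q <= B)%N by nia.
have [q1 q1Q t1] : exists2 q, q \in iota Q Q & (0 < tent (1 * q) B (q * W))%N.
  apply: contrapT => nex; move: w0; rewrite /weight big_seq big1 ?ltxx// => q qQ.
  case: (posnP (tent (1 * q) B (q * W))) => [->|h]; first by rewrite mul0r.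
  by exfalso; apply: nex; exists q.
have iQ q : q \in iota Q Q -> (Q <= q < 2 * Q)%N by rewrite mem_iota; lia.
have [p1 [n1 n2]] := tent_gt0 (QB' _ (proj2 (andP (iQ _ q1Q)))) t1.
have q10 : (0 < q1)%N by have := iQ _ q1Q; lia.
rewrite mul1n in n1 n2.
have [d [p [q [d0 pE qE cpq]]]] : exists d p q,
    [/\ (0 < d)%N, (p1 = p * d)%N, (q1 = q * d)%N & coprime p q].
  have d0 : (0 < gcdn p1 q1)%N by rewrite gcdn_gt0 q10 orbT.
  exists (gcdn p1 q1), (p1 %/ gcdn p1 q1)%N, (q1 %/ gcdn p1 q1)%N.
  split; rewrite ?divnK ?dvdn_gcdl ?dvdn_gcdr//.
  by rewrite /coprime -(eqn_pmul2r d0) mul1n muln_gcdl !divnK ?dvdn_gcdl ?dvdn_gcdr.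
have dl1 : (1 <= d)%N by [].
have qlt : (q * 1 <= q1)%N by rewrite qE leq_mul2l dl1 orbT.
have q1lt := iQ _ q1Q.
exists p, q; split.
- by apply/andP; split; [rewrite qE muln_gt0 in q10; case/andP: q10 | lia].
- rewrite -(ltn_pmul2r d0) ; move: n1; rewrite pE qE; nia.
- rewrite -(ltn_pmul2r d0) ; move: n2; rewrite pE qE; nia.
have dvd q2 : q2 \in iota Q Q -> (0 < tent (1 * q2) B (q2 * W))%N -> (q %| q2)%N.
  move=> q2Q t2; have h2 := iQ _ q2Q.
  have [p2 [n3 n4]] := tent_gt0 (QB' _ (proj2 (andP h2))) t2.
  rewrite mul1n in n3 n4.
  have E : (p1 * q2 = p2 * q1)%N.
    apply: (@near_rational_eq B Q 0 p1 q1 W p2 q2 W) => //; lia.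
  rewrite -(@Gauss_dvdr _ p) 1?coprime_sym//; apply/dvdnP; exists p2.
  by apply/eqP; rewrite -(eqn_pmul2r d0) mulnAC -pE E qE mulnA.
apply: (@le_trans _ _ (\sum_(q2 <- iota Q Q) (q %| q2)%:R / Q%:R)).
  rewrite /weight big_seq [leRHS]big_seq; apply: ler_sum => q2 q2Q; have h2 := iQ _ q2Q.
  case: (posnP (tent (1 * q2) B (q2 * W))) => [->|t2]; first by rewrite mul0r divr_ge0.
  have q20 : 0 < q2%:R :> R by rewrite ltr0n; lia.
  rewrite (dvd _ q2Q t2) ler_pdivrMr ?exprn_gt0//.
  rewrite mul1r ler_pdivlMl ?ltr0n// -natrX -natrM ler_nat.
  have := tent_le (q2 * W) (QB' _ (proj2 (andP h2))); move: (tent _ _ _) => t; nia.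
rewrite -mulr_suml ler_wpM2r ?invr_ge0//.
rewrite -natr_sum ler_nat; apply: leq_trans (count_multiples _ _ _); last first.
  by rewrite qE muln_gt0 in q10; case/andP: q10.
by rewrite -sum1_count [leqRHS]big_mkcond/=; apply: leq_sum => i _; case: dvdn.
Qed.

End Weight.

Section SingleScale.
Context {R : realType}.
Variables (b : nat) (Dl : seq nat).
Hypothesis b_gt1 : (1 < b)%N.
Hypothesis Dl_uniq : uniq Dl.
Hypothesis Dl_lt : forall d, d \in Dl -> (d < b)%N.
Variable Phi : R.
Hypothesis digit_sum_le : forall x : R,
  \sum_(a < b) nm (digit_sum Dl ((x + a%:R) / b%:R)) <= Phi.
Let words := words b Dl.
Let n := (size Dl)%:R : R.
Let bl0 l : (0 < b ^ l)%N. Proof. by rewrite expn_gt0 (ltnW b_gt1). Qed.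

(** All these words are near the same fraction, hence pairwise within 1 of each other. *)
Lemma sum_weight_close Q k l W : (0 < Q)%N -> (4 * Q ^ 2 * (b ^ l + 2) <= b ^ k)%N ->
  (size [seq v <- words l | (0 < weight (R := R) Q (b ^ k) (W + v))%R] <= 3)%N.
Proof.
move=> Q0 hQ.
have hQ8 : (8 * Q ^ 2 <= b ^ k)%N by apply: leq_trans hQ; nia.
set s := [seq _ <- _ | _].
have su : uniq s by rewrite filter_uniq// words_uniq.
have close v1 v2 : v1 \in s -> v2 \in s -> (v1 <= v2 + 1)%N.
  rewrite !mem_filter => /andP[w1 /(words_lt b_gt1 Dl_lt) lt1].
  move=> /andP[w2 /(words_lt b_gt1 Dl_lt) lt2].
  have [p1 [q1 [/andP[q10 q1Q] n1 n2 _]]] := weight_gt0 Q0 hQ8 w1.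
  have [p2 [q2 [/andP[q20 q2Q] n3 n4 _]]] := weight_gt0 Q0 hQ8 w2.
  have E : (p1 * q2 = p2 * q1)%N.
    by apply: (near_rational_eq q1Q q2Q hQ _ _ n1 n2 n3 n4); lia.
  have := near_rational_close q10 q20 E n1 n4; lia.
case sE : s => [//|x s']; rewrite -sE.
apply: (@uniq_leq_size _ s [:: x.-1; x; x.+1]) => // y ys.
have xs : x \in s by rewrite sE inE eqxx.
have h1 := close _ _ xs ys; have h2 := close _ _ ys xs.
rewrite !inE; lia.
Qed.

Lemma sum_prefix_le (f : nat -> R) c t j z : (j <= t)%N ->
  (forall w, w \in words t -> f w <= c) -> 0 <= c ->
  \sum_(w <- words t | (w %/ b ^ (t - j) == z)%N) f w <= c * n ^+ (t - j).
Proof.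
move=> jt fc c0; apply: (@le_trans _ _ (\sum_(w <- words t | (w %/ b ^ (t - j) == z)%N) c)).
  by rewrite big_seq_cond [leRHS]big_seq_cond; apply: ler_sum => w /andP[wt _]; exact: fc.
have -> : \sum_(w <- words t | (w %/ b ^ (t - j) == z)%N) c =
    c * \sum_(w <- words t | (w %/ b ^ (t - j) == z)%N) 1.
  by rewrite mulr_sumr; apply: eq_bigr => w _; rewrite mulr1.
apply: ler_wpM2l => //.
have := count_prefix (R := R) b_gt1 Dl_uniq Dl_lt j (t - j) z.
by rewrite subnKC.
Qed.

Variables (m l nn Q : nat) (Delta : R).
Hypothesis Q_gt0 : (0 < Q)%N.
Hypothesis Q_le : (16 * Q ^ 2 <= b ^ (m + l))%N.
Hypothesis Q_le_nn : (8 * Q ^ 2 <= b ^ nn)%N.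
Hypothesis nn_le : (nn <= m + l)%N.
Hypothesis Delta_ge0 : 0 <= Delta.
Hypothesis divisors_le : forall N, (0 < N < b ^ (m + l) * (2 * Q))%N ->
  (size (divisors N))%:R <= Delta.
Hypothesis variance_le :
  ((b ^ m)%:R * (6 * Delta * Phi ^+ l)) ^+ 2 <= (Q%:R * n ^+ l) ^+ 2 * n ^+ m / 16.
Hypothesis heavy_le : 44 * Delta * Phi ^+ (m + l) <= Q%:R * n ^+ (m + l) / 8.
Let B := (b ^ (m + l))%N.
Let wt := weight (R := R) Q B.
Let TC := tent_count (R := R) b Dl m l 1 (iota Q Q).
Let E := Q%:R * n ^+ l / B%:R.
(** By [weight_gt0], a weight above 145 / Q forces a denominator of at most Q / 144. *)
Let light W := wt W <= 145 / Q%:R.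
Let om W := if light W && (TC (W %/ b ^ l) <= 2 * E) then wt W else 0.

Let B0 : 0 < B%:R :> R. Proof. by rewrite ltr0n bl0. Qed.
Let Q0 : 0 < Q%:R :> R. Proof. by rewrite ltr0n. Qed.
Let n0 : 0 <= n. Proof. exact: ler0n. Qed.
Let Q8 : (8 * Q ^ 2 <= B)%N. Proof. by rewrite /B; apply: leq_trans Q_le; nia. Qed.

Let om_ge0 W : 0 <= om W.
Proof. by rewrite /om; case: ifP => // _; exact: weight_ge0. Qed.

Let om_le_wt W : om W <= wt W.
Proof. by rewrite /om; case: ifP => // _; exact: weight_ge0. Qed.

Let om_le W : om W <= 145 / Q%:R.
Proof. by rewrite /om; case: ifP => [/andP[]//|_]; rewrite divr_ge0 ?ler0n. Qed.

Let om_gt0 W : 0 < om W -> 0 < wt W.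
Proof. by rewrite /om; case: ifP => //; rewrite ltxx. Qed.

Let TCE w : TC w = \sum_(v <- words l) wt (w * b ^ l + v)%N.
Proof. by rewrite /TC /tent_count exchange_big. Qed.

Let E_ge0 : 0 <= E.
Proof. by rewrite divr_ge0 ?mulr_ge0 ?exprn_ge0. Qed.

Let E2_ge0 : 0 <= 2 * E. Proof. exact: mulr_ge0 E_ge0. Qed.

Let meanE : mean_count b Dl m l 1 (iota Q Q) = E.
Proof. by rewrite /mean_count expr1n mul1r size_iota. Qed.

Let om_prefix w : \sum_(v <- words l) om (w * b ^ l + v)%N <= 2 * E.
Proof.
have [h|h] := leP (TC w) (2 * E).
  by apply: le_trans h; rewrite TCE; apply: ler_sum => v _.
rewrite big_seq big1 ?E2_ge0// => v /(words_lt b_gt1 Dl_lt) vl.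
by rewrite /om divnMDl// divn_small// addn0 leNgt h andbF.
Qed.

Let om_short j z : (j <= m)%N ->
  \sum_(v <- words (m + l) | (v %/ b ^ (m + l - j) == z)%N) om v <= 2 * E * n ^+ (m - j).
Proof.
move=> jm; have -> : (m + l - j = l + (m - j))%N by clear -jm; lia.
under eq_bigl do rewrite expnD divnMA.
rewrite (sum_words_prefix b_gt1 Dl_lt m l (fun w => w %/ b ^ (m - j) == z)%N om).
by apply: sum_prefix_le.
Qed.

(** 435 = 3 * 145: at most three words of positive weight, each of them light. *)
Let om_close t w : (nn <= t)%N -> (t <= m + l)%N ->
  \sum_(v <- words (m + l - t)) om (w * b ^ (m + l - t) + v)%N <= 435 / Q%:R.
Proof.
move=> nt tk.
have h : (4 * Q ^ 2 * (b ^ (m + l - t) + 2) <= b ^ (m + l))%N.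
  have : (b ^ nn * b ^ (m + l - t) <= b ^ (m + l))%N.
    by rewrite -expnD leq_pexp2l ?(ltnW b_gt1)//; clear -nt tk; lia.
  have := bl0 (m + l - t); move: (b ^ (m + l - t))%N => x x0.
  have : (8 * Q ^ 2 * x <= b ^ nn * x)%N by rewrite leq_mul2r Q_le_nn orbT.
  by rewrite mulnDr; move: Q_le; clear; lia.
have := sum_weight_close (w * b ^ (m + l - t)) Q_gt0 h.
rewrite -/wt => sz.
apply: (@le_trans _ _ (\sum_(v <- words (m + l - t) |
    0 < wt (w * b ^ (m + l - t) + v)%N) 145 / Q%:R)).
  rewrite [leRHS]big_mkcond/=; apply: ler_sum => v _.
  case: ifPn => // h'; rewrite leNgt; apply/negP => /om_gt0 h2; by rewrite h2 in h'.
rewrite -big_filter big_const_seq count_predT iter_addr_0 -[_ *+ size _]mulr_natr mulrAC.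
rewrite ler_wpM2r ?invr_ge0//.
apply: (@le_trans _ _ (145 * 3%:R)); last by lra.
by rewrite ler_wpM2l ?ler0n// ler_nat.
Qed.

Let om_long j z : (j <= m + l)%N ->
  \sum_(v <- words (m + l) | (v %/ b ^ (m + l - j) == z)%N) om v <= 435 / Q%:R * n ^+ (nn - j).
Proof.
move=> jk; pose t := maxn nn j.
have [nt jt tk] : [/\ (nn <= t)%N, (j <= t)%N & (t <= m + l)%N].
  by rewrite leq_maxl leq_maxr geq_max nn_le jk.
have -> : (nn - j = t - j)%N by rewrite /t; clear; lia.
have -> : words (m + l) = words (t + (m + l - t)) by rewrite subnKC.
have -> : (m + l - j = (m + l - t) + (t - j))%N by clear -jt tk; lia.
under eq_bigl do rewrite expnD divnMA.
rewrite (sum_words_prefix b_gt1 Dl_lt t (m + l - t) (fun w => w %/ b ^ (t - j) == z)%N om).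
have c0 : 0 <= 435 / Q%:R :> R by rewrite divr_ge0 ?ler0n.
by refine (sum_prefix_le z jt _ c0) => w _; exact: om_close nt tk.
Qed.

(* Heavy words are close to a rational of denominator at most Q / 144; the
   count of such words is bounded by [tent_count_l2] at level 0. *)
Let sum_heavy : \sum_(W <- words (m + l) | ~~ light W) wt W <= E * n ^+ m / 4.
Proof.
pose g := (Q %/ 144)%N.
pose TH := tent_count (R := R) b Dl 0 (m + l) 3 (iota 1 g) 0.
have hv W : ~~ light W -> wt W <=
    2 * \sum_(q <- iota 1 g) (tent (3 * q) B (q * W))%:R / q%:R ^+ 2.
  rewrite /light -ltNge => hw.
  have w0 : 0 < wt W by apply: le_lt_trans hw; rewrite divr_ge0 ?ler0n.
  have [p [q [/andP[q0 qQ] n1 n2 wle]]] := weight_gt0 Q_gt0 Q8 w0; rewrite -/wt in wle.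
  have g1 : (144 < Q %/ q)%N.
    by have := lt_le_trans hw wle; rewrite ltr_pM2r ?invr_gt0// ltr_nat addn1 ltnS.
  have qg : (q <= g)%N.
    rewrite /g leq_divRL//; apply: leq_trans (leq_divM Q q).
    by rewrite mulnC leq_mul2r (ltnW g1) orbT.
  have q0' : 0 < q%:R :> R by rewrite ltr0n.
  have w2 : wt W <= 2 / q%:R.
    apply: (le_trans wle); rewrite ler_pdivrMr// mulrAC ler_pdivlMr// -!natrM ler_nat.
    have := leq_divM Q q; move: (Q %/ q)%N g1 => c; clear; nia.
  apply: (le_trans w2); rewrite ler_pM2l//.
  rewrite (bigD1_seq q)/= ?iota_uniq ?mem_iota//; last by rewrite q0 add1n ltnS.
  apply: ler_wpDr; first by apply: sumr_ge0 => i _; rewrite divr_ge0.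
  rewrite ler_pdivlMr ?exprn_gt0// expr2 mulKf ?gt_eqF// ler_nat.
  by apply: (@tent_ge q B (q * W) p); [move: n1|move: n2]; clear -q0; lia.
have sTH : \sum_(W <- words (m + l) | ~~ light W) wt W <= 2 * TH.
  have -> : TH = \sum_(W <- words (m + l)) \sum_(q <- iota 1 g)
      (tent (3 * q) B (q * W))%:R / q%:R ^+ 2 by rewrite /TH /tent_count exchange_big.
  rewrite mulr_sumr [leLHS]big_mkcond/=; apply: ler_sum => W _.
  case: ifP => [/hv //|_].
  by rewrite mulr_ge0// sumr_ge0// => i _; rewrite divr_ge0.
(* The 9 is h^2. Twice 9/144 is 1/8, half of the quarter allowed; [heavy_le] bounds the deviation by
   the other half. *)
have mTH : mean_count b Dl 0 (m + l) 3 (iota 1 g) <= 9 / 144 * (E * n ^+ m).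
  rewrite /mean_count size_iota -/n add0n -/B /E [(n ^+ (m + l))]exprD.
  have g144 : g%:R <= Q%:R / 144 :> R.
    rewrite ler_pdivlMr// -natrM ler_nat; exact: leq_divM.
  have -> : 9 / 144 * (Q%:R * n ^+ l / B%:R * n ^+ m) =
     3%:R ^+ 2 * (Q%:R / 144) * (n ^+ m * n ^+ l) / B%:R by field; rewrite gt_eqF.
  by rewrite ler_wpM2r ?invr_ge0// ler_wpM2r ?mulr_ge0 ?exprn_ge0// ler_wpM2l.
have dTH : TH - mean_count b Dl 0 (m + l) 3 (iota 1 g) <= 22 * Delta * Phi ^+ (m + l) / B%:R.
  have := tent_count_l2 b_gt1 digit_sum_le 3 (iota_uniq 1 g) (m := 0) (l := m + l)
    (L := (2 * Q)%N) (Delta := Delta).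
  have h1 q : q \in iota 1 g -> (0 < q <= 2 * Q)%N.
    by rewrite mem_iota /g; have := leq_div Q 144; move: (Q %/ 144)%N; clear; lia.
  move=> /(_ h1 divisors_le Delta_ge0); rewrite expn0 big_ord1 mul1r add0n -/B.
  rewrite -/TH; set x := TH - _ => h; apply: le_trans (ler_norm x) _.
  have Phi0 := Phi_ge0 digit_sum_le.
  have y0 : 0 <= 22 * Delta * Phi ^+ (m + l) / B%:R.
    by rewrite divr_ge0// !mulr_ge0 ?exprn_ge0.
  rewrite -ler_sqr ?nnegrE// real_normK ?num_real//.
  apply: le_trans h _; rewrite le_eqVlt; apply/orP; left; apply/eqP; congr (_ ^+ 2).
  by field; rewrite gt_eqF.
have h44 : 44 * Delta * Phi ^+ (m + l) / B%:R <= E * n ^+ m / 8.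
  rewrite ler_pdivrMr//; apply: le_trans heavy_le _.
  by rewrite /E exprD le_eqVlt; apply/orP; left; apply/eqP; field; rewrite gt_eqF.
apply: (le_trans sTH); clear sTH hv.
move: TH (mean_count b Dl 0 _ _ _) mTH dTH h44 => TH mc mTH dTH h44.
have e1 : 44 * Delta * Phi ^+ (m + l) / B%:R = 2 * (22 * Delta * Phi ^+ (m + l) / B%:R) by ring.
rewrite e1 in h44; move: (22 * _ * _ / _) dTH h44 => y dTH h44; move: (E * n ^+ m) mTH h44 => e mTH h44.
lra.
Qed.

(** The count, replaced by 0 where it exceeds 2 E, is at least E - |TC - E|, and |x| <= 2 x^2 / E +
    E / 8. After summation the variance and the constant cost an eighth each. *)
Let sum_dense : E * n ^+ m * (3 / 4) <= \sum_(w <- words m | TC w <= 2 * E) TC w.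
Proof.
have TC0 w : 0 <= TC w by rewrite TCE; apply: sumr_ge0 => v _; exact: weight_ge0.
have [E0|E0] := eqVneq E 0.
  by rewrite E0 !mul0r; apply: sumr_ge0 => w _.
have {}E0 : 0 < E by rewrite lt_neqAle eq_sym E0.
have l2 : \sum_(w <- words m) (TC w - E) ^+ 2 <= E ^+ 2 * n ^+ m / 16.
  apply: le_trans (sum_words_le_ord b_gt1 Dl_uniq Dl_lt _ _) _; first by move=> w; exact: sqr_ge0.
  have := tent_count_l2 b_gt1 digit_sum_le 1 (iota_uniq Q Q) (m := m) (l := l)
    (L := (2 * Q)%N) (Delta := Delta).
  have h1 q : q \in iota Q Q -> (0 < q <= 2 * Q)%N by rewrite mem_iota; clear; lia.
  move=> /(_ h1 divisors_le Delta_ge0); rewrite meanE -/TC -/B.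
  move=> h; apply: le_trans h _.
  have -> : E ^+ 2 * n ^+ m / 16 = (Q%:R * n ^+ l) ^+ 2 * n ^+ m / 16 / B%:R ^+ 2.
    by rewrite /E; field; rewrite gt_eqF.
  rewrite ler_pdivlMr ?exprn_gt0// -exprMn; apply: le_trans variance_le.
  rewrite le_eqVlt; apply/orP; left; apply/eqP; congr (_ ^+ 2).
  by field; rewrite gt_eqF.
have pw w : E - (2 / E * (TC w - E) ^+ 2 + E / 8) <= (if TC w <= 2 * E then TC w else 0).
  have h x : `|x| <= 2 / E * x ^+ 2 + E / 8.
    have -> : 2 / E * x ^+ 2 + E / 8 = (4 * `|x| - E) ^+ 2 / (8 * E) + `|x|.
      by rewrite -real_normK ?num_real//; field; rewrite gt_eqF.
    by rewrite lerDr divr_ge0 ?sqr_ge0// mulr_ge0// ltW.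
  have := h (TC w - E); move: (2 / E * _ + _) => S; rewrite ler_norml => /andP[h1 h2].
  case: ifPn => h3; first by lra.
  rewrite -ltNge in h3.
  by rewrite subr_le0 (le_trans _ h2)// lerBrDr -mulr2n -mulr_natl ltW.
have := @ler_sum _ _ (words m) xpredT _ _ (fun w _ => pw w).
rewrite -big_mkcond/=; apply: le_trans.
rewrite sumrB big_split/=.
have cst (c : R) : \sum_(w <- words m) c = c * n ^+ m.
  by rewrite big_const_seq count_predT iter_addr_0 /words size_words -mulr_natr natrX.
rewrite !cst -mulr_sumr.
have : 2 / E * \sum_(w <- words m) (TC w - E) ^+ 2 <= 2 / E * (E ^+ 2 * n ^+ m / 16).
  by rewrite ler_wpM2l// divr_ge0// ltW.
have -> : 2 / E * (E ^+ 2 * n ^+ m / 16) = E * n ^+ m / 8 by field; rewrite gt_eqF.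
move: (2 / E * _) => y yle; rewrite [E / 8 * _]mulrAC.
by move: (E * n ^+ m) yle => e; lra.
Qed.

Let sum_om : E * n ^+ m / 2 <= \sum_(v <- words (m + l)) om v.
Proof.
have h : \sum_(w <- words m | TC w <= 2 * E) TC w =
    \sum_(v <- words (m + l) | TC (v %/ b ^ l)%N <= 2 * E) wt v.
  rewrite (sum_words_prefix b_gt1 Dl_lt m l (fun w => TC w <= 2 * E) wt).
  by apply: eq_bigr => w _; exact: TCE.
have h2 : \sum_(v <- words (m + l) | TC (v %/ b ^ l)%N <= 2 * E) wt v <=
    \sum_(v <- words (m + l)) om v + \sum_(W <- words (m + l) | ~~ light W) wt W.
  rewrite big_mkcond/= [X in _ <= _ + X]big_mkcond/= -big_split/=; apply: ler_sum => v _.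
  rewrite /om; have := weight_ge0 (R := R) Q B v; rewrite -/wt.
  by case: (light v); case: (TC _ <= _); rewrite /= ?addr0 ?add0r.
have := sum_heavy; have := sum_dense; move: h2; rewrite h.
move: (\sum_(_ <- _) om _) (\sum_(_ <- _ | ~~ _) _) (\sum_(_ <- _ | _) _) (E * n ^+ m).
by move=> a c d e *; lra.
Qed.

(** The first prefix bound comes from the variance and stops at level m; the second comes from the
    separation of fractions alone and serves beyond m. *)
Lemma single_scale : exists om : nat -> R,
  [/\ forall v, 0 <= om v,
      Q%:R * n ^+ (m + l) / (b ^ (m + l))%:R / 2 <= \sum_(v <- words (m + l)) om v,
      forall j z, (j <= m)%N ->
        \sum_(v <- words (m + l) | (v %/ b ^ (m + l - j) == z)%N) om v <=
        2 * (Q%:R * n ^+ (m + l - j) / (b ^ (m + l))%:R),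
      forall j z, (j <= m + l)%N ->
        \sum_(v <- words (m + l) | (v %/ b ^ (m + l - j) == z)%N) om v <=
        435 / Q%:R * n ^+ (nn - j) &
      forall v, om v <= 145 / Q%:R /\ (0 < om v -> exists p q,
        [/\ (0 < q < 2 * Q)%N, (q * v < b ^ (m + l) * p + q)%N &
            (b ^ (m + l) * p < q * v + q)%N])].
Proof.
exists om; split=> //.
- apply: le_trans sum_om; rewrite le_eqVlt; apply/orP; left; apply/eqP.
  by rewrite /E -/B exprD; field; rewrite gt_eqF.
- move=> j z jm; apply: le_trans (om_short z jm) _; rewrite le_eqVlt; apply/orP; left; apply/eqP.
  have -> : (m + l - j = l + (m - j))%N by clear -jm; lia.
  by rewrite /E -/B exprD; field; rewrite gt_eqF.
- move=> v; split=> // /om_gt0 /(weight_gt0 Q_gt0 Q8) [p [q [h1 h2 h3 _]]].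
  by exists p, q.
Qed.

End SingleScale.

(** * Dimension of the well approximable points *)

Section Numerics.
Variable R : realFieldType.
Let rat : R := 123 / 125.

(** The case b = 7 of b^11 <= (b - 1)^12, which is the worst one since b / (b - 1) decreases. *)
Lemma expr_7_6 : (7 / 6 : R) ^+ 11 <= 6.
Proof.
have -> : (7 / 6 : R) ^+ 11 = ((7 / 6) ^+ 2) ^+ 4 * (7 / 6) ^+ 2 * (7 / 6) by ring.
have -> : (7 / 6 : R) ^+ 2 = 49 / 36 by field.
have -> : (49 / 36 : R) ^+ 4 = ((49 / 36) ^+ 2) ^+ 2 by ring.
have h3 : (49 / 36 : R) ^+ 2 <= 19 / 10 by rewrite expr2; lra.
have h4 : ((49 / 36 : R) ^+ 2) ^+ 2 <= (19 / 10) ^+ 2 by rewrite lerXn2r ?nnegrE ?sqr_ge0//; lra.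
have h5 : (19 / 10 : R) ^+ 2 <= 37 / 10 by rewrite expr2; lra.
move: (_ ^+ 2 ^+ 2) h4 => y *; lra.
Qed.

Let sqr_le (x y z : R) : 0 <= x -> x <= y -> y * y <= z -> x ^+ 2 <= z.
Proof. by move=> x0 xy; apply: le_trans; rewrite expr2 ler_pM. Qed.

Lemma expr_rat_le : rat ^+ 11 <= 419 / 500.
Proof.
have -> : rat ^+ 11 = ((rat ^+ 2) ^+ 2) ^+ 2 * rat ^+ 2 * rat by ring.
have r0 : 0 <= rat by rewrite /rat; lra.
have h2 : rat ^+ 2 <= 397 / 410 by apply: sqr_le r0 (lexx _) _; rewrite /rat; lra.
have h20 := sqr_ge0 rat.
have h4 : (rat ^+ 2) ^+ 2 <= 451 / 481 by apply: sqr_le h20 h2 _; lra.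
have h40 := sqr_ge0 (rat ^+ 2).
have h8 : ((rat ^+ 2) ^+ 2) ^+ 2 <= 502 / 571 by apply: sqr_le h40 h4 _; lra.
have h80 := sqr_ge0 ((rat ^+ 2) ^+ 2).
apply: (@le_trans _ _ (502 / 571 * (397 / 410) * rat)); last by rewrite /rat; lra.
apply: (ler_wpM2r r0); exact: ler_pM h80 h20 h8 h2.
Qed.

(** The growth rate per m in the variance condition: 7/6 bounds b / (b - 1), the power of [rat] is
    the gain over a suffix of length 11 m, and 101/100 is lost once through Q^2 and once through the
    squared divisor bound. *)
Definition variance_base : R := 7 / 6 * rat ^+ 11 * (101 / 100) ^+ 2.
Lemma variance_base_lt : 0 <= variance_base < 1.
Proof.
have h := expr_rat_le; have h0 : 0 <= rat ^+ 11 by rewrite exprn_ge0// /rat; lra.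
by rewrite /variance_base [(101 / 100) ^+ 2]expr2; apply/andP; split; [nra|lra].
Qed.

Definition heavy_base : R := (101 / 100) * rat ^+ 6.
Lemma heavy_base_lt : 0 <= heavy_base < 1.
Proof.
have h2 : rat ^+ 2 <= 97 / 100 by rewrite /rat expr2; lra.
have h20 := sqr_ge0 rat.
have h6 : rat ^+ 6 <= 97 / 100.
  have -> : rat ^+ 6 = rat ^+ 2 * (rat ^+ 2 * rat ^+ 2) by ring.
  move: (rat ^+ 2) h2 h20 => y h2 h20.
  have y1 : y <= 1 by lra.
  by apply: le_trans (ler_piMr h20 _) h2; apply: mulr_ile1.
have h0 : 0 <= rat ^+ 6 by rewrite exprn_ge0// /rat; lra.
by rewrite /heavy_base; apply/andP; split; lra.
Qed.

End Numerics.

Section WellApproximable.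
Context {R : realType}.
Variables (b : nat) (D : {set 'I_b}).
Hypothesis b_ge7 : (7 <= b)%N.
Hypothesis D_card : #|D| = (b - 1)%N.
Let b2 : (2 < b)%N. Proof. exact: leq_trans b_ge7. Qed.
Let b1 : (1 < b)%N. Proof. exact: ltnW. Qed.
Let b0 : 0 < b%:R :> R. Proof. by rewrite ltr0n (ltnW b1). Qed.
Let Dl := digits D.
Let K : set R := missing_digit_set R D.
Let kap : R := kappa b.
Let P (x : R) : R := b%:R `^ x.
Let n : R := (size Dl)%:R.

Let nE : n = b%:R - 1.
Proof. by rewrite /n size_digits D_card natrB ?(ltnW b1). Qed.

Let nP : n = P kap. Proof. exact: size_Dl. Qed.
Let PD x y : P (x + y) = P x * P y. Proof. exact: powR_bD. Qed.
Let P_gt0 x : 0 < P x. Proof. exact: powR_gt0. Qed.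
Let P_le x y : x <= y -> P x <= P y. Proof. exact: powR_b_le. Qed.
Let PX x i : P (x * i%:R) = P x ^+ i. Proof. by rewrite /P powRrM powR_mulrn// powR_ge0. Qed.
Let Pnat i : P i%:R = (b ^ i)%:R. Proof. by rewrite /P powR_mulrn ?natrX// ltW. Qed.
Let PN x : P (- x) = (P x)^-1. Proof. exact: powRN. Qed.

(* Equivalent to [b ^ 11 <= (b - 1) ^ 12]; this is why the scales below are
   multiples of 12. *)
Lemma kappa_ge : 11 / 12 <= kap.
Proof.
have t0 : 0 < b%:R - 1 :> R by rewrite subr_gt0 ltr1n.
have b7 : 7 <= b%:R :> R by rewrite ler_nat.
have h : b%:R ^+ 11 <= (b%:R - 1) ^+ 12 :> R.
  have h1 : b%:R <= 7 / 6 * (b%:R - 1) :> R by lra.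
  have h2 : (b%:R : R) ^+ 11 <= (7 / 6 * (b%:R - 1)) ^+ 11 by rewrite lerXn2r ?nnegrE ?(le_trans _ h1)// ltW.
  apply: (le_trans h2); rewrite exprMn [leRHS]exprS ler_wpM2r ?exprn_ge0 ?(ltW t0)//.
  apply: le_trans (expr_7_6 R) _; lra.
rewrite /kap /kappa ler_pdivlMr ?ln_b_gt0// mulrAC ler_pdivrMr//.
have : ln (b%:R ^+ 11) <= ln ((b%:R - 1) ^+ 12) :> R by rewrite ler_ln ?posrE ?exprn_gt0.
by rewrite !lnXn// => h'; rewrite mulr_natl mulr_natr.
Qed.

(* The loss in Q that the numerical slack in [variance_base] and [heavy_base] can absorb:
   [b `^ ln101 = 1.01]. *)
Definition ln101 : R := ln (101 / 100) / ln b%:R.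

Let gam := ln101.
Let Pgam : P gam = 101 / 100.
Proof.
rewrite /P /powR gt_eqF// /gam /ln101 divfK ?gt_eqF ?ln_b_gt0// lnK// posrE; lra.
Qed.

Lemma ln101_lt1 : gam < 1.
Proof.
rewrite ltr_pdivrMr ?ln_b_gt0// mul1r ltr_ln ?posrE//.
have b7 : 7 <= b%:R :> R by rewrite ler_nat.
by lra.
Qed.

Let small (C x : R) : x < 0 -> \forall i \near \oo, C * P (x * i%:R) <= 1.
Proof.
move=> x0; have e0 : 0 < (`|C| + 1)^-1 by rewrite invr_gt0 ltr_wpDl.
have [i0 h] := powR_b_small b2 x0 e0; exists i0 => // i /= /h h1.
apply: le_trans (ler_norm _) _; rewrite normrM (ger0_norm (ltW (P_gt0 _))).
apply: (@le_trans _ _ ((`|C| + 1) * (`|C| + 1)^-1)); last by rewrite divff ?gt_eqF// ltr_wpDl.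
by apply: ler_pM => //; [exact: ltW | rewrite lerDl].
Qed.

Let small_exp (C r : R) : 0 <= r < 1 -> \forall i \near \oo, C * r ^+ i <= 1.
Proof.
move=> r01; have e0 : 0 < (`|C| + 1)^-1 by rewrite invr_gt0 ltr_wpDl.
have [i0 h] := expr_small r01 e0; exists i0 => // i /= /h h1.
have r0 : 0 <= r ^+ i by rewrite exprn_ge0//; case/andP: r01.
apply: le_trans (ler_norm _) _; rewrite normrM (ger0_norm r0).
apply: (@le_trans _ _ ((`|C| + 1) * (`|C| + 1)^-1)); last by rewrite divff ?gt_eqF// ltr_wpDl.
by apply: ler_pM => //; rewrite lerDl.
Qed.


Let Phi : R := (b%:R - 1) * Num.sqrt (123 / 125 * b%:R).

Let Phi_le x : \sum_(a < b) nm (digit_sum Dl ((x + a%:R) / b%:R)) <= Phi.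
Proof. exact: fiber_sum_le x b_ge7 D_card. Qed.

Let n_gt0 : 0 < n. Proof. by rewrite nP. Qed.

Let Phi_sqr i : (Phi ^+ i) ^+ 2 = (n ^+ 2 * (123 / 125 * b%:R)) ^+ i.
Proof.
have <- : Phi ^+ 2 = n ^+ 2 * (123 / 125 * b%:R).
  rewrite /Phi -nE [LHS]exprMn; congr (_ * _); rewrite sqr_sqrtr//.
by rewrite -!exprM mulnC.
Qed.

(** With B = b^(12 m), Q is the integer part of B^beta, and nn is the first level that separates
    fractions of denominator below 2 Q, whence the factor 8 b. *)
Lemma scale_choice (beta : R) (m : nat) : 0 < beta < 1 / 2 ->
  16 * P ((24 * beta - 12) * m%:R) <= 1 ->
  exists Q nn : nat,
  [/\ (0 < Q)%N, P (12 * beta * m%:R) / 2 <= Q%:R <= P (12 * beta * m%:R),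
      (16 * Q ^ 2 <= b ^ (m + 11 * m))%N, (8 * Q ^ 2 <= b ^ nn)%N &
      (nn <= m + 11 * m)%N /\ (b ^ nn)%:R <= 8 * b%:R * P (24 * beta * m%:R)].
Proof.
move=> /andP[be0 be1] h16; set X := P _.
have X1 : 1 <= X by rewrite -(powRr0 b%:R) P_le// !mulr_ge0// ltW.
have X0 : 0 <= X by apply: le_trans X1.
pose Q := Num.trunc X.
have /andP[q1 q2] := trunc_itv X0; rewrite -/Q in q1 q2.
have Q0 : (0 < Q)%N.
  by rewrite -ltnS -(ltr_nat R); apply: le_lt_trans q2.
have XX : X ^+ 2 = P (24 * beta * m%:R).
  by rewrite expr2 -PD; congr P; ring.
have Q2 : (Q ^ 2)%:R <= P (24 * beta * m%:R) :> R.
  by rewrite natrX -XX lerXn2r ?nnegrE.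
have hB : (16 * Q ^ 2 <= b ^ (m + 11 * m))%N.
  rewrite -(ler_nat R) natrM -Pnat.
  apply: le_trans (_ : _ <= 16 * P (24 * beta * m%:R)) _; first by rewrite ler_wpM2l ?ler0n.
  have -> : P (24 * beta * m%:R) = P ((24 * beta - 12) * m%:R) * P (m + 11 * m)%:R.
    by rewrite -PD natrD natrM; congr P; ring.
  by rewrite mulrA ler_piMl// ltW.
have ex : exists i, (8 * Q ^ 2 <= b ^ i)%N.
  by exists (m + 11 * m)%N; apply: leq_trans hB; rewrite leq_mul2r orbT.
have [nn h8 nmin] := ex_minnP ex.
exists Q, nn; split=> //.
  rewrite q1 andbT ler_pdivrMr//; apply/ltW; apply: lt_le_trans q2 _.
  by rewrite -natrM ler_nat; clear -Q0; lia.
split; first by apply: nmin; apply: leq_trans hB; rewrite leq_mul2r orbT.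
case: nn h8 nmin => [|i] h8 nmin.
  have Q2' : (0 < Q ^ 2)%N by rewrite expn_gt0 Q0.
  exfalso; move: h8 Q2'; rewrite expn0; clear; lia.
have : (b ^ i < 8 * Q ^ 2)%N by rewrite ltnNge; apply/negP => /nmin; rewrite ltnn.
rewrite -(ltr_nat R) natrM => /ltW h; rewrite expnS natrM [8 * b%:R]mulrC.
rewrite -[leRHS]mulrA; apply: ler_wpM2l (ltW b0) _ _ _.
by apply: (le_trans h); rewrite ler_wpM2l ?ler0n.
Qed.

(** Putting a word of length M in front divides distances by b^M and multiplies the denominator by
    b^M, so this becomes the inequality defining [W alpha] with denominator b^M q. It is asked on
    the whole closed cylinder because later letters are still free. *)
Let Good (alpha : R) M k v := exists p q, (0 < q)%N /\
  forall y : R, v%:R <= y <= v.+1%:R ->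
    `|y / (b ^ k)%:R - p%:R / q%:R| < (b ^ M)%:R * ((b ^ M)%:R * q%:R) `^ (- alpha).

(** The denominators b^M q are unbounded, so no finite set of pairs contains these
    approximations. *)
Let W_of_Good alpha x : 0 < alpha -> K x ->
  (forall i, exists M k w v, [/\ (i <= M)%N, @Good alpha M k v &
     cylinder b (M + k) (w * b ^ k + v) x]) -> W alpha x.
Proof.
move=> al0 Kx h; rewrite /W/= => fin.
have [N hN] : exists N, forall pq : int * nat, (0 < pq.2)%N /\
      `|x - pq.1%:~R / pq.2%:R| < pq.2%:R `^ (- alpha) -> (pq.2 <= N)%N.
  have /finite_seqP[F FE] := fin.
  exists (\max_(pq <- F) pq.2)%N => pq hpq.
  have pqF : pq \in F by have : [set` F] pq by rewrite -FE.
  exact: (@leq_bigmax_seq _ F xpredT (fun pq => pq.2) pq).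
have [M [k [w [v [NM [p [q [q0 G]]] cx]]]]] := h N.+1.
have bM0 : 0 < (b ^ M)%:R :> R by rewrite ltr0n expn_gt0 (ltnW b1).
have bk0 : 0 < (b ^ k)%:R :> R by rewrite ltr0n expn_gt0 (ltnW b1).
have qR : 0 < q%:R :> R by rewrite ltr0n.
pose y : R := x * (b ^ (M + k))%:R - (w * b ^ k)%:R.
have yE : x = (y / (b ^ k)%:R + w%:R) / (b ^ M)%:R.
  by rewrite /y expnD !natrM; field; rewrite !gt_eqF.
have yv : v%:R <= y <= v.+1%:R.
  have B0 : 0 < (b ^ (M + k))%:R :> R by rewrite expnD natrM mulr_gt0.
  move: cx; rewrite /cylinder/= ler_pdivrMr// ler_pdivlMr// => /andP[c1 c2].
  rewrite /y lerBrDl -natrD c1/= lerBlDl -natrD addnS; exact: c2.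
have q'E : (b ^ M * q)%:R = (b ^ M)%:R * q%:R :> R by rewrite natrM.
have := hN (Posz (w * q + p), (b ^ M * q)%N).
move=> /=; rewrite muln_gt0 q0 expn_gt0 (ltnW b1)/= q'E.
have -> : x - (Posz (w * q + p))%:~R / ((b ^ M)%:R * q%:R) =
    (y / (b ^ k)%:R - p%:R / q%:R) / (b ^ M)%:R.
  rewrite yE -pmulrn natrD natrM; move: (y / _) => z.
  by field; rewrite !gt_eqF.
rewrite normrM [`|(b ^ M)%:R^-1|]ger0_norm ?invr_ge0 ?(ltW bM0)//.
rewrite ltr_pdivrMr// [_ * (b ^ M)%:R]mulrC => /(_ (conj isT (G y yv))).
have : (M < b ^ M)%N by rewrite ltn_expl.
by move: (b ^ M)%N => t; clear -NM q0; nia.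
Qed.

Let variance_arith (B C U r nm N Q b3 : R) : 0 < B -> 0 < U -> 0 <= nm -> 0 <= N ->
  B ^+ 12 / U / 4 <= Q -> r * U ^+ 2 * B <= b3 * nm -> 48 * 48 * C ^+ 2 * b3 <= 1 ->
  B ^+ 2 * (36 * C ^+ 2 * U) * (N * r * B ^+ 11) <= Q * N * nm / 16.
Proof.
move=> B0 U0 nm0 N0 hQ hr h3.
apply: (@le_trans _ _ (B ^+ 12 / U / 4 * N * nm / 16)); last first.
  by rewrite ler_pM2r ?invr_gt0// ler_wpM2r// ler_wpM2r.
have -> : B ^+ 2 * (36 * C ^+ 2 * U) * (N * r * B ^+ 11) =
   B ^+ 12 / U / 4 * N / 16 * (48 * 48 * C ^+ 2 * (r * U ^+ 2 * B)).
  by field; rewrite gt_eqF.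
have -> : B ^+ 12 / U / 4 * N * nm / 16 = B ^+ 12 / U / 4 * N / 16 * nm by rewrite mulrAC.
apply: ler_wpM2l; first by rewrite !mulr_ge0 ?invr_ge0 ?exprn_ge0// ltW.
apply: (@le_trans _ _ (48 * 48 * C ^+ 2 * b3 * nm)).
  rewrite -[48 * 48 * C ^+ 2 * b3 * nm]mulrA; apply: ler_wpM2l => //.
  by rewrite mulr_ge0 ?sqr_ge0// mulr_ge0 ?ler0n.
exact: ler_piMl.
Qed.

Let heavy_arith (B C V r N Q b4 : R) : 0 < B -> 0 < V -> 0 <= N ->
  B ^+ 6 / V / 2 <= Q -> b4 = V ^+ 2 * r -> 88 * 8 * C * b4 <= 1 ->
  44 * (C * V) * (N * (r * B ^+ 6)) <= Q * N / 8.
Proof.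
move=> B0 V0 N0 hQ -> h4.
apply: (@le_trans _ _ (B ^+ 6 / V / 2 * N / 8)); last first.
  by rewrite ler_pM2r ?invr_gt0// ler_wpM2r.
have -> : 44 * (C * V) * (N * (r * B ^+ 6)) =
   B ^+ 6 / V / 2 * N / 8 * (88 * 8 * C * (V ^+ 2 * r)).
  by field; rewrite gt_eqF.
by apply: ler_piMr => //; rewrite !mulr_ge0 ?invr_ge0 ?exprn_ge0// ltW.
Qed.

Let Pgam2 i : (P (gam / 2) ^+ i) ^+ 2 = (101 / 100) ^+ i.
Proof. by rewrite -exprM mulnC exprM expr2 -PD -splitr Pgam. Qed.

Let b_le_n : b%:R <= 7 / 6 * n.
Proof.
have b7 : 7 <= b%:R :> R by rewrite ler_nat.
by rewrite nE; lra.
Qed.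

Let Q_lower (beta : R) m (Q : R) : 12 - 24 * beta <= gam -> P (12 * beta * m%:R) / 2 <= Q ->
  (b%:R ^+ m) ^+ 6 / P (gam / 2) ^+ m / 2 <= Q.
Proof.
move=> hb; apply: le_trans; rewrite ler_pM2r ?invr_gt0//.
rewrite -exprM -natrX -Pnat -PX -PN -PD.
by apply: P_le; rewrite natrM; have := ler0n R m; nra.
Qed.

Lemma scale_variance (beta C : R) m Q : 12 - 24 * beta <= gam -> 0 <= C ->
  P (12 * beta * m%:R) / 2 <= Q -> 48 * 48 * C ^+ 2 * variance_base R ^+ m <= 1 ->
  ((b ^ m)%:R * (6 * (C * P (gam / 2) ^+ m) * Phi ^+ (11 * m))) ^+ 2 <=
  (Q * n ^+ (11 * m)) ^+ 2 * n ^+ m / 16.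
Proof.
move=> hb C0 /(Q_lower hb) hQ h3; set V := P _ ^+ m in hQ *.
have V0 : 0 < V by rewrite exprn_gt0.
have U : V ^+ 2 = (101 / 100) ^+ m := Pgam2 m.
have -> : ((b ^ m)%:R * (6 * (C * V) * Phi ^+ (11 * m))) ^+ 2 =
   (b%:R ^+ m) ^+ 2 * (36 * C ^+ 2 * V ^+ 2) * ((n ^+ (11 * m)) ^+ 2 *
   ((123 / 125) ^+ 11) ^+ m * (b%:R ^+ m) ^+ 11).
  have <- : (Phi ^+ (11 * m)) ^+ 2 = (n ^+ (11 * m)) ^+ 2 *
      ((123 / 125) ^+ 11) ^+ m * (b%:R ^+ m) ^+ 11.
    rewrite Phi_sqr [LHS]exprMn [X in _ * X]exprMn mulrA -!exprM.
    by rewrite [(2 * _)%N]mulnC [(m * 11)%N]mulnC.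
  by rewrite natrX; move: (Phi ^+ _) (b%:R ^+ m) V {V0 U hQ} => F B V; ring.
rewrite [(Q * _) ^+ 2]exprMn; apply: (variance_arith (b3 := variance_base R ^+ m)).
- exact: exprn_gt0.
- exact: exprn_gt0.
- by rewrite exprn_ge0// ltW.
- exact: sqr_ge0.
- have -> : (b%:R ^+ m) ^+ 12 / V ^+ 2 / 4 = ((b%:R ^+ m) ^+ 6 / V / 2) ^+ 2.
    by field; rewrite gt_eqF.
  rewrite lerXn2r ?nnegrE// ?(le_trans _ hQ)//; rewrite !mulr_ge0 ?invr_ge0 ?exprn_ge0// ltW//.
- have c0 : 0 <= (123 / 125 : R) ^+ 11 by apply: exprn_ge0; rewrite divr_ge0 ?ler0n.
  have u0 : 0 <= (101 / 100 : R) ^+ 2 by exact: sqr_ge0.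
  have -> : (V ^+ 2) ^+ 2 = ((101 / 100) ^+ 2) ^+ m by rewrite U -!exprM mulnC.
  rewrite -!exprMn; apply: lerXn2r; rewrite ?nnegrE.
  + exact: mulr_ge0 (mulr_ge0 c0 u0) (ltW b0).
  + by rewrite mulr_ge0 ?(ltW n_gt0)//; case/andP: (variance_base_lt R).
  have g (x y z w : R) : x * y * z * w = y * z * (x * w) by ring.
  have -> : variance_base R * n = (123 / 125) ^+ 11 * (101 / 100) ^+ 2 * (7 / 6 * n) by exact: g.
  apply: (ler_wpM2l (mulr_ge0 c0 u0)); exact: b_le_n.
- exact: h3.
Qed.

Lemma scale_heavy (beta C : R) m Q : 12 - 24 * beta <= gam -> 0 <= C ->
  P (12 * beta * m%:R) / 2 <= Q -> 88 * 8 * C * heavy_base R ^+ m <= 1 ->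
  44 * (C * P (gam / 2) ^+ m) * Phi ^+ (m + 11 * m) <= Q * n ^+ (m + 11 * m) / 8.
Proof.
move=> hb C0 /(Q_lower hb) hQ h4; set V := P _ ^+ m in hQ *.
have V0 : 0 < V by rewrite exprn_gt0.
have U : V ^+ 2 = (101 / 100) ^+ m := Pgam2 m.
have -> : Phi ^+ (m + 11 * m) = n ^+ (m + 11 * m) * (((123 / 125) ^+ 6) ^+ m * (b%:R ^+ m) ^+ 6).
  have -> : (m + 11 * m = m * 6 * 2)%N by clear; lia.
  rewrite [LHS]exprM Phi_sqr exprMn -[(n ^+ 2) ^+ _]exprM [(2 * _)%N]mulnC; congr (_ * _).
  by rewrite exprMn -!exprM [(6 * m)%N]mulnC.
apply: (heavy_arith (b4 := heavy_base R ^+ m)) => //.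
- exact: exprn_gt0.
- by rewrite exprn_ge0// ltW.
- by rewrite U /heavy_base exprMn.
Qed.

(** The exponent gam / 48 turns N < b^(24 m) into a loss of at most b^(gam m / 2), the same as the
    loss in Q. *)
Let divisors_scale (C : R) m B L : 0 <= C ->
  (forall N, (0 < N)%N -> (size (divisors N))%:R <= C * N%:R `^ (gam / 48)) ->
  (B * L <= b ^ (24 * m))%N -> forall N, (0 < N < B * L)%N ->
  (size (divisors N))%:R <= C * P (gam / 2) ^+ m.
Proof.
move=> C0 hC hQ N /andP[N0 Nlt]; apply: le_trans (hC _ N0) _; apply: ler_wpM2l => //.
have g0 : 0 <= gam / 48.
  rewrite divr_ge0// ltW// divr_gt0 ?ln_b_gt0// ln_gt0//; lra.
have -> : P (gam / 2) ^+ m = P (24 * m%:R) `^ (gam / 48).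
  by rewrite -PX /P -[RHS]powRrM; congr (_ `^ _); field.
apply: ge0_ler_powR => //; rewrite ?nnegrE ?(ltW (P_gt0 _))//.
have -> : 24 * m%:R = (24 * m)%:R :> R by rewrite natrM.
by rewrite Pnat ler_nat (leq_trans (ltnW Nlt)).
Qed.

(** The left end of the cylinder is within 1 / B of p / q, hence all of it within 2 / B. The
    inequality with 2 * 2^alpha makes this good enough; for alpha beta < 1 it holds once m is large
    in terms of M. *)
Let close_good (alpha beta : R) M m Q q p v : 0 < alpha -> (0 < q)%N -> (q < 2 * Q)%N ->
  Q%:R <= P (12 * beta * m%:R) ->
  2 * 2 `^ alpha * P (M%:R * (alpha - 1)) * P (12 * (alpha * beta - 1) * m%:R) <= 1 ->
  (q * v < b ^ (m + 11 * m) * p + q)%N -> (b ^ (m + 11 * m) * p < q * v + q)%N ->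
  @Good alpha M (m + 11 * m) v.
Proof.
move=> al0 q0 qQ hQ h8 n1 n2; exists p, q; split=> // y /andP[y1 y2].
have B0 : 0 < (b ^ (m + 11 * m))%:R :> R by rewrite -Pnat.
have qR : 0 < q%:R :> R by rewrite ltr0n.
have BP : (b ^ (m + 11 * m))%:R = P (12 * m%:R).
  by rewrite -Pnat; congr P; rewrite natrD natrM; ring.
have lt2 : `|y / (b ^ (m + 11 * m))%:R - p%:R / q%:R| < 2 / (b ^ (m + 11 * m))%:R.
  have -> : y / (b ^ (m + 11 * m))%:R - p%:R / q%:R =
      (q%:R * y - (b ^ (m + 11 * m))%:R * p%:R) / q%:R / (b ^ (m + 11 * m))%:R.
    by field; rewrite !gt_eqF.
  rewrite normrM [`|_^-1|]gtr0_norm ?invr_gt0// ltr_pM2r ?invr_gt0//.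
  rewrite normrM [`|_^-1|]gtr0_norm ?invr_gt0// ltr_pdivrMr// ltr_norml.
  move: n1 n2; rewrite -!(ltr_nat R) !natrD !natrM => n1 n2.
  rewrite -natr1 in y2.
  have e1 : q%:R * v%:R <= q%:R * y by rewrite ler_pM2l.
  have e2 : q%:R * y <= q%:R * v%:R + q%:R by rewrite -[X in _ + X]mulr1 -mulrDr ler_pM2l.
  by move: (_ * p%:R) (q%:R * v%:R) (q%:R * y) n1 n2 e1 e2 => *; apply/andP; split; lra.
apply: (lt_le_trans lt2).
have Mpos : 0 < (b ^ M)%:R :> R by rewrite -Pnat.
have PM := Pnat M.
apply: (@le_trans _ _ (P M%:R * (P M%:R * (2 * P (12 * beta * m%:R))) `^ (- alpha))).
  have -> : (P M%:R * (2 * P (12 * beta * m%:R))) `^ (- alpha) =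
     2 `^ (- alpha) * P (- (M%:R * alpha) - 12 * beta * alpha * m%:R).
    rewrite powRM ?mulr_ge0 ?(ltW (P_gt0 _))// powRM ?(ltW (P_gt0 _))// /P.
    rewrite -!powRrM mulrCA -/(P _) -PD; congr (_ * P _); ring.
  rewrite BP ler_pdivrMr// powRN.
  have t0 : 0 < (2 : R) `^ alpha by exact: powR_gt0.
  rewrite -[leLHS]mulr1; move: h8; set T := 2 `^ alpha in t0 *.
  set Z := P (_ - _).
  have -> : P M%:R * (T^-1 * Z) * P (12 * m%:R) =
     T^-1 * (P M%:R * Z * P (12 * m%:R)) by ring.
  rewrite mulr1 ler_pdivlMl// => h8.
  have -> : P M%:R * Z * P (12 * m%:R) =
     (P (M%:R * (alpha - 1)) * P (12 * (alpha * beta - 1) * m%:R))^-1.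
    by rewrite -PD -PN -!PD; congr P; ring.
  rewrite -[leRHS]mul1r ler_pdivlMr ?mulr_gt0//.
  by apply: le_trans h8; rewrite le_eqVlt; apply/orP; left; apply/eqP; ring.
rewrite PM; apply: ler_wpM2l; first exact: ltW.
rewrite !powRN lef_pV2 ?posrE ?powR_gt0 ?mulr_gt0//.
apply: ge0_ler_powR; rewrite ?nnegrE ?(ltW al0)// ?mulr_ge0 ?(ltW Mpos)//.
  by rewrite (ltW (P_gt0 _)).
rewrite ler_pM2l//; apply: (@le_trans _ _ (2 * Q%:R)); first by rewrite -natrM ler_nat ltnW.
by rewrite ler_pM2l.
Qed.

(** The separation bound falls short of the exponent kappa by 12 (1 - kap) (1 - 2 beta) m <= (1 - 2
    beta) m. The Frostman bound is only asked with s, and (kap - s) j > (1 - 2 beta) j makes up for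
    it when j >= m > 0. *)
Let exponent_le (beta s m j : R) : 11 / 12 <= kap -> kap < 1 -> beta < 1 / 2 ->
  s < 2 * beta + kap - 1 -> 0 <= m -> m <= j ->
  kap * (24 * beta * m) + - (kap * j) <=
  2 * (12 * beta * m) - 12 * m + kap * (12 * m) - s * j.
Proof.
move=> k1 k2 be1 sb m0 mj.
have e1 : (1 - 2 * beta) * j <= (kap - s) * j.
  by apply: ler_wpM2r; [exact: le_trans mj | lra].
have e2 : (1 - 2 * beta) * m <= (1 - 2 * beta) * j by apply: ler_wpM2l => //; lra.
have e3 : 12 * (1 - kap) * ((1 - 2 * beta) * m) <= (1 - 2 * beta) * m.
  by apply: ler_piMl; [apply: mulr_ge0 => //; lra|lra].
have e4 := le_trans e3 (le_trans e2 e1); rewrite -subr_ge0.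
move: e4; rewrite -subr_ge0; congr (0 <= _); ring.
Qed.

Let exponent_ge0 (beta s m t : R) : t <= s * (12 * m) ->
  12 * (s + 1 - kap - 2 * beta) * m <= 0 ->
  0 <= 2 * (12 * beta * m) - 12 * m + kap * (12 * m) - t.
Proof. lra. Qed.

(** [beta] stands for a number slightly below 1 / alpha: the strict inequalities leave negative
    powers of b^m that absorb all constants. *)
Lemma W_measure_neq0 (alpha beta s : R) : 0 < s -> 0 < alpha -> alpha * beta < 1 ->
  0 < beta < 1 / 2 -> 12 - 24 * beta <= ln101 -> s < 2 * beta + kap - 1 ->
  hausdorff_measure s (W alpha `&` K) <> 0%E.
Proof.
move=> s0 al0 ab be hb sb; have /andP[be0 be1] := be.
have kap1 : kap < 1 := kappa_lt1 b2.
have kap11 := kappa_ge.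
have kap0 : 0 <= kap by lra.
have skap : s <= kap by lra.
(* 870 = 2 * 435, with 2 from rounding Q down; 32 b = 4 * 8 b, with 4 from the lower bound for T and
   8 b from the choice of nn. *)
pose A : R := 870 * (32 * b%:R).
have bR1 : 1 <= b%:R :> R by rewrite ler1n (ltnW b1).
have A4 : 4 <= A by rewrite /A; lra.
have b8 : 1 <= 8 * b%:R :> R by lra.
apply: (@scale_measure_neq0 R b D b1 s A (@Good alpha)) => //.
- lra.
- move=> M; have gam0 : 0 < gam.
    rewrite divr_gt0 ?ln_b_gt0// ln_gt0//; lra.
  have [C C0 hC] : exists2 C : R, 0 <= C & forall N, (0 < N)%N ->
     (size (divisors N))%:R <= C * N%:R `^ (gam / 48) by apply: divisor_bound; rewrite divr_gt0.
  have n1 : 24 * beta - 12 < 0 by lra.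
  have n7 : 12 * (s + 1 - kap - 2 * beta) < 0 by lra.
  have n8 : 12 * (alpha * beta - 1) < 0 by lra.
  have [N1 _ E1] := small 16 n1.
  have [N3 _ E3] := small_exp (48 * 48 * C ^+ 2) (variance_base_lt R).
  have [N4 _ E4] := small_exp (88 * 8 * C) (heavy_base_lt R).
  have [N7 _ E7] := small (16 * 290) n7.
  have [N8 _ E8] := small (2 * 2 `^ alpha * P (M%:R * (alpha - 1))) n8.
  (* m is chosen after M: the threshold [N8] depends on the length of the prefix already built. *)
  have [m [m0 m1 m3 m4 [m7 m8]]] : exists m, [/\ (0 < m)%N, (N1 <= m)%N, (N3 <= m)%N,
      (N4 <= m)%N & (N7 <= m)%N /\ (N8 <= m)%N].
    by exists (N1 + N3 + N4 + N7 + N8).+1; split; [| | | |split]; clear; lia.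
  have h1 := E1 m m1; have h3 := E3 m m3; have h4 := E4 m m4; have h7 := E7 m m7.
  have h8 := E8 m m8; rewrite /= in h1 h3 h4 h7 h8.
  have [Q [nn [Q0 /andP[QX1 QX2] QB Qnn [nnk nnle]]]] := scale_choice be h1.
  have H2 := scale_variance hb C0 QX1 h3.
  have H3 := scale_heavy hb C0 QX1 h4.
  have QL : (b ^ (m + 11 * m) * (2 * Q) <= b ^ (24 * m))%N.
    have -> : (24 * m = (m + 11 * m) + (m + 11 * m))%N by clear; lia.
    rewrite [leqRHS]expnD leq_mul2l; apply/orP; right; apply: leq_trans QB.
    by clear; case: Q => // Q; nia.
  have De0 : 0 <= C * P (gam / 2) ^+ m by rewrite mulr_ge0 ?exprn_ge0 ?(ltW (P_gt0 _)).
  have [om [om0 sumom short long omgood]] := single_scale b1 (digits_uniq D) (@digits_lt _ D)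
    Phi_le Q0 QB Qnn nnk De0 (divisors_scale C0 hC QL) H2 H3.
  exists (m + 11 * m)%N, om.
  set k := (m + 11 * m)%N in QB nnk H3 sumom short long omgood *.
  set T := \sum_(v <- _) om v in sumom *.
  have kR : k%:R = 12 * m%:R :> R by rewrite /k natrD natrM; ring.
  have Bk : (b ^ k)%:R = P k%:R by rewrite Pnat.
  have mR : 0 < m%:R :> R by rewrite ltr0n.
  have nk i : n ^+ i = P (kap * i%:R) by rewrite PX -nP.
  rewrite -/n Bk in sumom short.
  have QR : 0 < Q%:R :> R by rewrite ltr0n.
  have T0 : 0 < T.
    by apply: lt_le_trans sumom; rewrite !mulr_gt0 ?invr_gt0 ?exprn_gt0.
  have XT : P (12 * beta * m%:R + kap * k%:R - k%:R) / 4 <= T.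
    apply: le_trans sumom; rewrite nk PD PD PN.
    have -> : P (12 * beta * m%:R) * P (kap * k%:R) / P k%:R / 4 =
      P (12 * beta * m%:R) / 2 * (P (kap * k%:R) / P k%:R / 2) by field; rewrite gt_eqF.
    have -> : Q%:R * P (kap * k%:R) / P k%:R / 2 = Q%:R * (P (kap * k%:R) / P k%:R / 2).
      by rewrite !mulrA.
    by apply: ler_wpM2r QX1; rewrite !mulr_ge0 ?invr_ge0 ?(ltW (P_gt0 _)).
  have QX c : 0 <= c -> c / Q%:R <= 2 * c * P (- (12 * beta * m%:R)).
    move=> c0; rewrite PN; move: (P _) (P_gt0 (12 * beta * m%:R)) QX1 => X X0 QX1.
    have -> : 2 * c / X = c * (2 / X) by ring.
    apply: ler_wpM2l => //.
    have -> : 2 / X = (X / 2)^-1 by rewrite invfM invrK mulrC.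
    by rewrite lef_pV2 ?posrE ?divr_gt0.
  have A0 : 0 <= A by exact: le_trans A4.
  split=> //.
  + by rewrite /k addn_gt0 m0.
  + move=> j z jk; rewrite (cylE b2) -/(P _).
    have [jm|mj] := leqP j m.
      apply: le_trans (short _ _ jm) _.
      have -> : n ^+ (k - j) = n ^+ k * P (- (kap * j%:R)).
        by rewrite !nk natrB// mulrBr PD.
      apply: (@le_trans _ _ (A * T * P (- (kap * j%:R)))); last first.
        apply: ler_wpM2l; first exact: mulr_ge0 A0 (ltW T0).
        by apply: P_le; rewrite lerN2 ler_wpM2r.
      have -> : 2 * (Q%:R * (n ^+ k * P (- (kap * j%:R))) / P k%:R) =
        4 * (Q%:R * n ^+ k / P k%:R / 2) * P (- (kap * j%:R)) by field; rewrite gt_eqF.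
      apply: ler_wpM2r; first exact: ltW.
      by apply: ler_pM => //; rewrite !mulr_ge0 ?invr_ge0 ?exprn_ge0 ?(ltW (P_gt0 _)) ?(ltW n_gt0).
    apply: le_trans (long _ _ jk) _.
    apply: (@le_trans _ _ (2 * 435 * P (- (12 * beta * m%:R)) *
        (8 * b%:R * P (2 * (12 * beta * m%:R) - k%:R + kap * k%:R - s * j%:R)))); last first.
      apply: (@le_trans _ _ (A * (P (12 * beta * m%:R + kap * k%:R - k%:R) / 4) *
          P (- (s * j%:R)))); last first.
        by apply: ler_wpM2r; [exact: ltW|exact: ler_wpM2l].
      have -> : P (2 * (12 * beta * m%:R) - k%:R + kap * k%:R - s * j%:R) =
         P (12 * beta * m%:R) * P (12 * beta * m%:R + kap * k%:R - k%:R) * P (- (s * j%:R)).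
        by rewrite -!PD; congr P; ring.
      rewrite PN /A le_eqVlt; apply/orP; left; apply/eqP; field.
      by rewrite gt_eqF.
    apply: ler_pM; rewrite ?divr_ge0 ?exprn_ge0 ?ler0n ?(ltW n_gt0)//.
      exact: QX 435 (ler0n _ _).
    have [jnn|nnj] := leqP j nn.
      have nnn : n ^+ nn <= 8 * b%:R * P (kap * (24 * beta * m%:R)).
        rewrite nk -[kap * nn%:R]mulrC /P [leLHS]powRrM -/(P _) Pnat.
        apply: (@le_trans _ _ ((8 * b%:R * P (24 * beta * m%:R)) `^ kap)).
          apply: ge0_ler_powR => //; rewrite ?nnegrE ?mulr_ge0 ?ler0n ?(ltW (P_gt0 _))//.
        have P0 x := ltW (P_gt0 x).
        rewrite powRM ?mulr_ge0 ?ler0n// /P -powRrM [24 * beta * m%:R * kap]mulrC -/(P _).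
        apply: ler_wpM2r => //.
        have -> : 8 * b%:R = (8 * b%:R) `^ 1 :> R by rewrite powRr1// mulr_ge0 ?ler0n.
        by rewrite -powRrM mul1r; apply: ler_powR => //; exact: ltW.
      have -> : n ^+ (nn - j) = n ^+ nn * P (- (kap * j%:R)).
        by rewrite !nk natrB// mulrBr PD.
      apply: (@le_trans _ _ (8 * b%:R * P (kap * (24 * beta * m%:R)) * P (- (kap * j%:R)))).
        by apply: ler_wpM2r => //; exact: ltW.
      rewrite -mulrA -PD; apply: ler_wpM2l; first by rewrite mulr_ge0 ?ler0n.
      apply: P_le; rewrite kR.
      by apply: exponent_le => //; rewrite ler_nat ltnW.
    have -> : (nn - j = 0)%N by apply/eqP; rewrite subn_eq0 ltnW.
    rewrite expr0; apply: (@le_trans _ _ (8 * b%:R * P 0)); last first.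
      apply: ler_wpM2l; first by rewrite mulr_ge0 ?ler0n.
      apply: P_le; rewrite kR.
      have jk' : s * j%:R <= s * k%:R by rewrite ler_pM2l// ler_nat.
      rewrite kR in jk'; have : 12 * (s + 1 - kap - 2 * beta) * m%:R <= 0.
        by rewrite pmulr_lle0// ltW.
      exact: exponent_ge0 jk'.
    by rewrite /P powRr0 mulr1.
  + move=> v vk; have [le145 gd] := omgood v; split; last first.
      by move=> /gd [p [q [/andP[q0 qQ] n9 n10]]]; exact: (close_good al0 q0 qQ QX2 h8 n9 n10).
    apply: (le_trans le145); apply: le_trans (QX 145 _) _; first by rewrite ler0n.
    apply: (@le_trans _ _ (P (12 * beta * m%:R + kap * k%:R - k%:R) / 4 * cyl b s k / 4)); last first.
      rewrite ler_pM2r ?invr_gt0//; apply: ler_wpM2r XT; exact/ltW/cyl_gt0.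
    rewrite (cylE b2) -/(P _).
    have -> : P (12 * beta * m%:R + kap * k%:R - k%:R) / 4 * P (- (s * k%:R)) / 4 =
       P (- (12 * beta * m%:R)) * (P (12 * (s + 1 - kap - 2 * beta) * m%:R))^-1 / 16.
      have -> : P (12 * beta * m%:R + kap * k%:R - k%:R) =
         P (- (12 * beta * m%:R)) * (P (12 * (s + 1 - kap - 2 * beta) * m%:R))^-1 / P (- (s * k%:R)).
        by rewrite -!PN -!PD kR; congr P; ring.
      by field; rewrite !gt_eqF.
    move: h7; set Z := P (12 * (s + _ - _ - _) * _).
    have Z0 : 0 < Z by exact: P_gt0.
    rewrite -[X in _ <= X -> _](mulVf (lt0r_neq0 Z0)) ler_pM2r// => h7.
    rewrite [leLHS]mulrC -[leRHS]mulrA; apply: ler_wpM2l; first exact: ltW.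
    rewrite ler_pdivlMr//; apply: le_trans h7; rewrite le_eqVlt; apply/orP; left; apply/eqP.
    by rewrite mulrC; congr (_ * _); rewrite -natrM.
- by move=> x [_ [/andP[]]].
- by move=> x Kx h; split=> //; exact: W_of_Good.
Qed.

(** For alpha >= 1 and x in [0, 1] each q admits finitely many p, none negative. *)
Lemma W_denominator_unbounded (alpha x : R) N : 1 <= alpha -> 0 <= x <= 1 -> W alpha x ->
  exists p q : nat, [/\ (N < q)%N & `|x - p%:R / q%:R| < q%:R `^ (- alpha)].
Proof.
move=> al1 /andP[x0 x1] Wx; apply: contrapT => nex; apply: Wx.
pose s := [seq (Posz p, q) | p <- iota 0 N.+2, q <- iota 0 N.+1].
apply: (@sub_finite_set _ _ [set` s]); last by apply/finite_seqP; exists s.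
move=> [p q] /= [q0 h].
have qR : 0 < q%:R :> R by rewrite ltr0n.
have q1 : q%:R * q%:R `^ (- alpha) <= 1 :> R.
  rewrite powRN ler_pdivrMr ?powR_gt0// mul1r -[leLHS]powRr1 ?ler0n//.
  by apply: ler_powR => //; rewrite ler1n.
have : `|q%:R * x - p%:~R| < 1.
  apply: lt_le_trans q1; rewrite -ltr_pdivrMl// -[X in X * _]gtr0_norm ?invr_gt0// -normrM.
  by rewrite mulrBr mulKf ?gt_eqF// [_^-1 * _]mulrC.
rewrite ltr_norml => /andP[h1 h2].
have qx : q%:R * x <= q%:R by rewrite ler_piMr// ler0n.
have qx0 : 0 <= q%:R * x by rewrite mulr_ge0// ler0n.
case: p h h1 h2 => [p|p] h h1 h2; last first.
  exfalso; move: h2; rewrite NegzE rmorphN/= -pmulrn opprK -natr1.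
  have := ler0n R p; lra.
rewrite -pmulrn in h h1 h2.
have qN : (q <= N)%N by rewrite leqNgt; apply/negP => Nq; apply: nex; exists p, q.
apply/allpairsP; exists (p, q); split=> //; rewrite mem_iota add0n ltnS// leq0n/=.
rewrite -(ler_nat R) -natr1.
have : p%:R < q%:R + 1 :> R by lra.
have : q%:R <= N%:R :> R by rewrite ler_nat.
lra.
Qed.

Let dim_ge0 (z g k : R) : 12 - 24 * z <= g -> g < 1 -> 11 / 12 <= k -> 0 <= 2 * z + k - 1.
Proof. lra. Qed.

(** Denominators are sorted into ranges starting at X m = b^(12 m / alpha), so that q^-alpha is at
    most the length b^(-12 m) of a cylinder. The deviation bound keeps the number of words near such
    fractions within a constant of X m^2 (b - 1)^(12 m) / b^(12 m), and the costs form a geometric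
    series. *)
Lemma W_measure_eq0 (alpha s : R) : 2 < alpha -> 12 - 24 / alpha <= ln101 ->
  2 / alpha + kap - 1 < s -> hausdorff_measure s (W alpha `&` K) = 0%E.
Proof.
move=> al2 hb sb; pose beta := alpha^-1.
have al0 : 0 < alpha by lra.
have be0 : 0 < beta by rewrite invr_gt0.
have be1 : beta < 1 / 2 by rewrite mul1r ltf_pV2 ?posrE.
have ab : alpha * beta = 1 by rewrite divff ?gt_eqF.
have [C C0 hC] : exists2 C : R, 0 <= C & forall N, (0 < N)%N ->
    (size (divisors N))%:R <= C * N%:R `^ (gam / 48).
  apply: divisor_bound; rewrite divr_gt0// divr_gt0 ?ln_b_gt0// ln_gt0//; lra.
have [m0 _ h4] := small_exp (88 * 8 * C) (heavy_base_lt R).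
pose k m := (m + 11 * m)%N.
have kR m : (k m)%:R = 12 * m%:R :> R by rewrite /k natrD natrM; ring.
pose X m := P (12 * beta * m%:R).
have X1 m : 1 <= X m by rewrite -(powRr0 b%:R) P_le// !mulr_ge0// ltW.
have XS m : X m.+1 = P (12 * beta) * X m by rewrite -PD -natr1; congr P; ring.
pose Y m := Num.trunc (X m.+1).
have Y1 m : (Y m)%:R <= X m.+1 /\ X m.+1 < (Y m).+1%:R.
  by apply/andP; apply: trunc_itv; apply: le_trans (X1 _).
pose near m v : R := \sum_(q <- iota 1 (Y m)) (tent (3 * q) (b ^ k m) (q * v))%:R / q%:R ^+ 2.
(* A denominator q <= Y m whose tent at v is at least q contributes at least 1 / Y m to [near], so
   [L m] misses no such word, and Markov bounds its size. *)
pose L m := [seq v <- words b Dl (k m) | 1 <= (Y m)%:R * near m v].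
have near0 m v : 0 <= near m v by apply: sumr_ge0 => q _; rewrite divr_ge0.
have sizeL m : (m0 + 2 <= m)%N -> (size (L m))%:R <= 10 * P (24 * beta) *
    P (12 * (2 * beta + kap - 1) * m%:R).
  move=> mm; pose TC := \sum_(v <- words b Dl (k m)) near m v.
  have s1 : (size (L m))%:R <= (Y m)%:R * TC.
    rewrite /L size_filter -sum1_count natr_sum /TC mulr_sumr [leLHS]big_mkcond/=.
    by apply: ler_sum => v _; case: ifP => // _; rewrite mulr_ge0.
  have hH := scale_heavy hb C0 (_ : P (12 * beta * m%:R) / 2 <= X m) (h4 m _).
  have Bk : (b ^ k m)%:R = P (12 * m%:R) by rewrite -Pnat kR.
  have dv N : (0 < N < b ^ (0 + k m) * Y m)%N ->
      (size (divisors N))%:R <= C * P (gam / 2) ^+ m.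
    apply: divisors_scale => //; rewrite -(ler_nat R) natrM add0n Bk -Pnat.
    apply: le_trans (_ : _ <= P (12 * m%:R) * X m.+1) _.
      by apply: ler_wpM2l (proj1 (Y1 m)); exact: ltW.
    rewrite -PD; apply: P_le; rewrite natrM -[m.+1%:R]natr1.
    have m2 : 2 <= m%:R :> R by rewrite ler_nat (leq_trans _ mm)// leq_addl.
    have b6 : 12 * beta <= 6 by lra.
    have : 12 * beta * (m%:R + 1) <= 6 * (m%:R + 1) by rewrite ler_wpM2r// addr_ge0.
    by clear h4; move: (12 * beta * _) m2 => z; lra.
  have De0 : 0 <= C * P (gam / 2) ^+ m by rewrite mulr_ge0 ?exprn_ge0 ?(ltW (P_gt0 _)).
  have h1 q : q \in iota 1 (Y m) -> (0 < q <= Y m)%N by rewrite mem_iota add1n ltnS.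
  have := tent_count_l2 b1 Phi_le 3 (iota_uniq 1 (Y m)) h1 dv De0.
  rewrite expn0 big_ord1 mul1r add0n.
  have -> : tent_count b Dl 0 (k m) 3 (iota 1 (Y m)) 0 = TC.
    by rewrite /TC /near /tent_count exchange_big.
  rewrite /mean_count size_iota add0n -/n Bk => hTC.
  have y0 : 0 <= 22 * (C * P (gam / 2) ^+ m) * Phi ^+ k m / P (12 * m%:R).
    by rewrite divr_ge0 ?(ltW (P_gt0 _))// mulr_ge0 ?exprn_ge0 ?(Phi_ge0 Phi_le)// mulr_ge0 ?ler0n.
  have TCle : TC <= 3%:R ^+ 2 * (Y m)%:R * n ^+ k m / P (12 * m%:R) +
      22 * (C * P (gam / 2) ^+ m) * Phi ^+ k m / P (12 * m%:R).
    rewrite -lerBlDl; apply: le_trans (ler_norm _) _.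
    rewrite -ler_sqr ?nnegrE// real_normK ?num_real//; apply: (le_trans hTC).
    rewrite le_eqVlt; apply/orP; left; apply/eqP; congr (_ ^+ 2).
    by field; rewrite gt_eqF.
  have XY : X m <= X m.+1.
    by apply: P_le; rewrite ler_wpM2l ?ler_nat// mulr_ge0 ?ler0n// ltW.
  have n12 : n ^+ k m = P (12 * kap * m%:R).
    by rewrite nP -PX kR; congr P; ring.
  have TCle2 : TC <= 10 * X m.+1 * (n ^+ k m / P (12 * m%:R)).
    apply: (le_trans TCle); rewrite -mulrDl [leRHS]mulrA ler_wpM2r ?invr_ge0 ?(ltW (P_gt0 _))//.
    have e1 : 44 * (C * P (gam / 2) ^+ m) * Phi ^+ k m <= X m * n ^+ k m / 8.
      by apply: hH;
        [rewrite ler_pdivrMr ?ltr0n// ler_peMr ?ler1n// ?(le_trans _ (X1 _))//|exact: leq_trans (leq_addr _ _) mm].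
    have e2 : X m * n ^+ k m <= X m.+1 * n ^+ k m by rewrite ler_wpM2r ?exprn_ge0 ?ler0n.
    have e3 : (Y m)%:R * n ^+ k m <= X m.+1 * n ^+ k m.
      by rewrite ler_wpM2r ?exprn_ge0 ?ler0n//; case: (Y1 m).
    have e4 : 0 <= X m.+1 * n ^+ k m.
      by rewrite mulr_ge0 ?exprn_ge0 ?ler0n// (le_trans _ (X1 _)).
    rewrite -[3%:R ^+ 2 * _ * _]mulrA -[10 * _ * _]mulrA -[22 * _ * _]mulrA.
    rewrite -[44 * _ * _]mulrA in e1.
    move: (C * _ * Phi ^+ _) ((Y m)%:R * _) (X m * _) (X m.+1 * _) e1 e2 e3 e4.
    by clear h4 hH; move=> u1 u2 u3 u4; rewrite expr2; lra.
  apply: (le_trans s1); apply: (@le_trans _ _ (X m.+1 * (10 * X m.+1 * (n ^+ k m / P (12 * m%:R))))).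
    by apply: ler_pM => //; [exact: sumr_ge0|case: (Y1 m)].
  rewrite n12 -PN XS.
  have -> : P (24 * beta) = P (12 * beta) * P (12 * beta) by rewrite -PD; congr P; ring.
  have -> : P (12 * (2 * beta + kap - 1) * m%:R) = X m * X m * (P (12 * kap * m%:R) * P (- (12 * m%:R))).
    by rewrite -!PD; congr P; ring.
  by rewrite le_eqVlt; apply/orP; left; apply/eqP; ring.
pose r := P (12 * (2 * beta + kap - 1 - s)).
have r01 : 0 <= r < 1 by apply: powR_b_lt1 => //; rewrite /beta; lra.
have s0 : 0 < s.
  apply: le_lt_trans sb.
  exact: dim_ge0 hb ln101_lt1 kappa_ge.
pose M i := (i + (m0 + 2))%N.
apply: (@hausdorff_measure_limsup0 _ s _ (fun i => L (M i)) (fun i => @cylinder R b (k (M i)))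
    (fun i => (b ^ k (M i))%:R^-1) (10 * P (24 * beta) * r ^+ (m0 + 2)) r) => //.
- by rewrite !mulr_ge0 ?ler0n ?(ltW (P_gt0 _))// exprn_ge0//; case/andP: r01.
- by move=> i v x y; exact: cylinder_dist.
- move=> d d0; have [i0 h] := @powR_b_small R b b2 (-1) d (ltrN10 _) d0.
  exists i0 => i ii; rewrite -Pnat -PN -mulN1r; apply: h.
  by rewrite (leq_trans ii)// /M /k -addnA leq_addr.
- move=> i; have := sizeL (M i) (leq_addl _ _); set m := M i => hL.
  have rE : ((b ^ k m)%:R^-1) `^ s = P (- (12 * s * m%:R)).
    by rewrite -Pnat -PN /P -powRrM kR; congr (_ `^ _); ring.
  rewrite rE; apply: le_trans (ler_wpM2r (ltW (P_gt0 _)) hL) _.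
  have -> : 10 * P (24 * beta) * r ^+ (m0 + 2) * r ^+ i = 10 * P (24 * beta) * r ^+ m.
    by rewrite -[LHS]mulrA -exprD [(_ + i)%N]addnC.
  rewrite /r -PX -[leLHS]mulrA -PD; apply: ler_wpM2l.
    by rewrite mulr_ge0 ?ler0n// ltW.
  by apply: P_le; rewrite le_eqVlt; apply/orP; left; apply/eqP; ring.
move=> x [Wx Kx] i0.
have x01 : 0 <= x <= 1 by case: Kx.
have al1 : 1 <= alpha by lra.
have [p [q [qN hpq]]] := W_denominator_unbounded (Y (M i0)) al1 x01 Wx.
have [m [mi mq qm]] : exists m, [/\ (M i0 <= m)%N, X m <= q%:R & (q <= Y m)%N].
  have q0 : 0 < q%:R :> R by rewrite ltr0n (leq_ltn_trans _ qN).
  have qi0 : 0 < q%:R^-1 :> R by rewrite invr_gt0.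
  have nb : - (12 * beta) < 0 by rewrite oppr_lt0 mulr_gt0.
  have ex : exists m, (q <= Y m)%N.
    have [m1 h] := powR_b_small b2 nb qi0; exists m1.
    rewrite -ltnS -(ltr_nat R); apply: le_lt_trans (proj2 (Y1 m1)).
    have := h m1.+1 (leqnSn _); rewrite mulNr -/(P _) PN lef_pV2 ?posrE//.
  have [m qm mmin] := ex_minnP ex; exists m; split=> //.
    rewrite leqNgt; apply/negP => mM.
    have YM : (Y m <= Y (M i0))%N.
      rewrite -ltnS -(ltr_nat R); apply: le_lt_trans (proj2 (Y1 (M i0))).
      apply: le_trans (proj1 (Y1 m)) _; apply: P_le.
      by rewrite ler_wpM2l ?ler_nat ?(leq_trans mM)//; rewrite mulr_ge0 ?ler0n// ltW.
    by move: qN; rewrite ltnNge (leq_trans qm YM).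
  case: m mmin {qm} => [|m] mmin.
    rewrite /X mulr0 /P powRr0 ler1n; by rewrite ltr0n in q0.
  apply: ltW; apply: lt_le_trans (proj2 (Y1 m)) _.
  by rewrite ler_nat ltnNge; apply/negP => /mmin; rewrite ltnn.
have [u [uw ux]] := missing_digit_prefix b1 Kx.
exists (m - (m0 + 2))%N; first by rewrite leq_subRL ?[(m0 + 2 + _)%N]addnC// (leq_trans _ mi)// leq_addl.
have Mm : M (m - (m0 + 2))%N = m by rewrite /M subnK// (leq_trans _ mi)// leq_addl.
rewrite Mm; exists (u (k m)); last exact: ux.
rewrite mem_filter uw andbT.
have q0 : (0 < q)%N by exact: leq_ltn_trans qN.
have qR : 0 < q%:R :> R by rewrite ltr0n.
have B0 : 0 < (b ^ k m)%:R :> R by rewrite -Pnat.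
have hB : q%:R `^ (- alpha) <= (b ^ k m)%:R^-1.
  rewrite powRN lef_pV2 ?posrE ?powR_gt0//.
  apply: (@le_trans _ _ (X m `^ alpha)).
    rewrite -Pnat kR /X /P -powRrM; apply: P_le.
    have -> : 12 * beta * m%:R * alpha = 12 * m%:R * (alpha * beta) by ring.
    by rewrite ab mulr1.
  by apply: ge0_ler_powR => //; rewrite ?nnegrE ?(ltW al0) ?(ltW (P_gt0 _)) ?ler0n.
have := ux (k m); rewrite /cylinder/= ler_pdivrMr// ler_pdivlMr// -natr1 => /andP[c1 c2].
have hd : `|q%:R * (x * (b ^ k m)%:R) - (b ^ k m)%:R * p%:R| < q%:R.
  have -> : q%:R * (x * (b ^ k m)%:R) - (b ^ k m)%:R * p%:R =
    (x - p%:R / q%:R) * (q%:R * (b ^ k m)%:R) by field; rewrite gt_eqF.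
  rewrite normrM [X in _ * X]gtr0_norm ?mulr_gt0// mulrCA.
  rewrite -[ltRHS]mulr1 ltr_pM2l// -ltr_pdivlMr// mul1r.
  exact: lt_le_trans hpq hB.
have tq : (q <= tent (3 * q) (b ^ k m) (q * u (k m)))%N.
  apply: (@tent_ge q (b ^ k m) (q * u (k m)) p); rewrite -(ltr_nat R) !natrD !natrM;
  move: hd; rewrite ltr_norml => /andP[d1 d2];
  have e1 : q%:R * (u (k m))%:R <= q%:R * (x * (b ^ k m)%:R) by rewrite ler_pM2l.
  - by move: (_ * p%:R) (q%:R * (u _)%:R) (q%:R * _) d1 d2 e1 => *; lra.
  - have e2 : q%:R * (x * (b ^ k m)%:R) <= q%:R * (u (k m))%:R + q%:R.
      by rewrite -[X in _ + X]mulr1 -mulrDr ler_pM2l.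
    by move: (_ * p%:R) (q%:R * (u _)%:R) (q%:R * _) d1 d2 e1 e2 => *; lra.
rewrite /near (bigD1_seq q) ?iota_uniq ?mem_iota//=; last by rewrite q0 add1n ltnS.
rewrite mulrDr; apply: ler_wpDr.
  by rewrite mulr_ge0// sumr_ge0// => i _; rewrite divr_ge0.
rewrite mulrA ler_pdivlMr ?exprn_gt0// mul1r expr2 -!natrM ler_nat.
exact: leq_mul.
Qed.

End WellApproximable.

(** * Computability of the gap above 2 *)

Section RecursiveFunctions.

Lemma recursive_ext k (f g : k.-tuple nat -> nat) : f =1 g -> recursive f -> recursive g.
Proof. by move=> /funext ->. Qed.

Lemma recursive_comp1 k (f : 1.-tuple nat -> nat) (g : k.-tuple nat -> nat) :
  recursive f -> recursive g -> recursive (fun x => f [tuple g x]).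
Proof.
move=> rf rg; apply: recursive_ext (recursive_comp rf (fun _ : 'I_1 => rg)) => x.
by congr f; apply: eq_from_tnth => i; rewrite tnth_mktuple (tnth_nth 0%N) ord1.
Qed.

Lemma recursive_comp2 k (f : 2.-tuple nat -> nat) (g1 g2 : k.-tuple nat -> nat) :
  recursive f -> recursive g1 -> recursive g2 -> recursive (fun x => f [tuple g1 x; g2 x]).
Proof.
move=> rf r1 r2; pose g (i : 'I_2) := if i == ord0 then g1 else g2.
have rg i : recursive (g i) by rewrite /g; case: ifP.
apply: recursive_ext (recursive_comp rf rg) => x.
congr f; apply: eq_from_tnth => i; rewrite tnth_mktuple (tnth_nth 0%N) /g.
by case: i => [[|[|//]] lt].
Qed.

Lemma recursive_succ_comp k (g : k.-tuple nat -> nat) :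
  recursive g -> recursive (fun x => (g x).+1).
Proof.
by move=> rg; apply: recursive_ext (recursive_comp1 recursive_succ rg) => x; rewrite theadE.
Qed.

Lemma recursive_add : recursive (fun x : 2.-tuple nat => tnth x ord0 + tnth x ord_max)%N.
Proof.
apply: (@recursive_primrec 1 (fun x => tnth x ord0) (fun x => (tnth x (inord 1)).+1)).
- exact: recursive_proj.
- exact/recursive_succ_comp/recursive_proj.
- by move=> x; rewrite !(tnth_nth 0%N).
- by move=> n x; rewrite !(tnth_nth 0%N)/= inordK.
Qed.

Lemma recursive_exp2 : recursive (fun x : 1.-tuple nat => 2 ^ thead x)%N.
Proof.
apply: (@recursive_primrec 0 (fun x => 1%N)
  (fun x => tnth x ord_max + tnth x ord_max)%N).
- exact/recursive_succ_comp/recursive_zero.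
- have r : recursive (fun x : 2.-tuple nat => tnth x ord_max) by exact: recursive_proj.
  by apply: recursive_ext (recursive_comp2 recursive_add r r) => x; rewrite !(tnth_nth 0%N).
- by move=> x; rewrite theadE.
- by move=> n x; rewrite !(tnth_nth 0%N)/= !theadE expnS mul2n addnn.
Qed.

Lemma recursive_pred : recursive (fun x : 1.-tuple nat => (thead x).-1).
Proof.
apply: (@recursive_primrec 0 (fun x => 0%N) (fun x => tnth x ord0)).
- exact: recursive_zero.
- exact: recursive_proj.
- by move=> x; rewrite theadE.
- by move=> n x; rewrite !(tnth_nth 0%N).
Qed.

(** Primitive recursion runs on the first argument, so the subtrahend comes first. *)
Lemma recursive_sub : recursive (fun x : 2.-tuple nat => tnth x ord_max - tnth x ord0)%N.
Proof.
apply: (@recursive_primrec 1 (fun x => tnth x ord0) (fun x => (tnth x (inord 1)).-1)).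
- exact: recursive_proj.
- apply: recursive_ext (recursive_comp1 recursive_pred (recursive_proj (inord 1))) => x.
  by rewrite theadE.
- by move=> x; rewrite !(tnth_nth 0%N)/= subn0.
- by move=> n x; rewrite !(tnth_nth 0%N)/= inordK//= subnS.
Qed.

End RecursiveFunctions.

(** An explicit dyadic number below [ln101] / 6, hence exactly computable from b. *)
Definition gap (R : realType) b (D : {set 'I_b}) : R := (2 ^+ (b + 9))^-1.

Lemma gap_computable (R : realType) : effectively_computable one_missing_digit (@gap R).
Proof.
exists (fun t => 2 ^ (tnth t ord_max - (tnth t ord0 + 9)))%N, (fun=> 0%N); split.
- have r0 : recursive (fun t : 3.-tuple nat => tnth t ord0 + 9)%N.
    apply: (@recursive_ext _ (fun t => (tnth t ord0).+4.+4.+1)) => [t|].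
      by rewrite addnC.
    by do 9!apply: recursive_succ_comp; exact: recursive_proj.
  have rn : recursive (fun t : 3.-tuple nat => tnth t ord_max) by exact: recursive_proj.
  apply: recursive_ext (recursive_comp1 recursive_exp2 (recursive_comp2 recursive_sub r0 rn)) => t.
  by rewrite theadE !(tnth_nth 0%N).
- exact: recursive_zero.
move=> b D _ n /=; rewrite !(tnth_nth 0%N)/= subr0 /gap natrX.
have p2 i : 0 < (2 : R) ^+ i by rewrite exprn_gt0.
have [bn|nb] := leqP (b + 9) n.
  have -> : (2 : R) ^+ n = 2 ^+ (n - (b + 9)) * 2 ^+ (b + 9) by rewrite -exprD subnK.
  rewrite invfM mulrA divff ?gt_eqF// mul1r subrr normr0.
  by rewrite mulr_ge0 ?invr_ge0 ?exprn_ge0.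
(* Below precision b + 9 the truncated subtraction yields 2^-n instead of [gap], still within 2^-n
   of it. *)
have -> : (n - (b + 9) = 0)%N by lia.
rewrite expr0 mul1r distrC ger0_norm ?subr_ge0.
  by rewrite gerBl invr_ge0 ltW.
by rewrite lef_pV2 ?posrE// ler_eXn2l ?ltr1n// ltnW.
Qed.

(** From ln b <= b - 1 and ln (101/100) >= 1/101 > 1/128, it remains to see 6 (b - 1) <= 4 * 2^b.
    The 6 is 12 / 2, from 12 - 24 / alpha = 12 (alpha - 2) / alpha with alpha >= 2. *)
Lemma gap_le (R : realType) b (D : {set 'I_b}) : (7 <= b)%N -> 6 * gap R D <= ln101 b.
Proof.
move=> b7; have bR : 7 <= b%:R :> R by rewrite ler_nat.
have l0 : 0 < ln b%:R :> R by rewrite ln_gt0//; lra.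
have lb : ln b%:R <= b%:R - 1 :> R.
  have := @le_ln1Dx R (b%:R - 1); rewrite (_ : 1 + (b%:R - 1) = b%:R); last by ring.
  by apply; lra.
have l101 : 1 / 128 <= ln (101 / 100) :> R.
  have h : ln (100 / 101) <= - (1 / 101) :> R.
    have := @le_ln1Dx R (- (1 / 101)); rewrite (_ : 1 - 1 / 101 = 100 / 101); last by field.
    by apply; lra.
  have -> : 101 / 100 = (100 / 101)^-1 :> R by field.
  rewrite lnV ?posrE; lra.
rewrite ler_pdivlMr// /gap.
apply: (@le_trans _ _ (6 * (2 ^+ (b + 9))^-1 * (b%:R - 1))).
  by rewrite ler_wpM2l// mulr_ge0// invr_ge0 exprn_ge0.
apply: le_trans l101; rewrite mulrAC ler_pdivrMr ?exprn_gt0//.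
have b2 : 2 * b%:R <= 2 ^+ b :> R.
  move: b7; clear; case: b => // b _.
  by rewrite exprS ler_pM2l// -natrX ler_nat ltn_expl.
have -> : 1 / 128 * 2 ^+ (b + 9) = 4 * 2 ^+ b :> R.
  rewrite exprD (_ : 2 ^+ 9 = 128 * 4); last by rewrite -natrM -natrX.
  by field.
lra.
Qed.

Lemma hausdorff_measure_set0 (R : realType) (s : R) : 0 < s -> hausdorff_measure s set0 = 0%E.
Proof.
move=> s0; apply: (@hausdorff_measure_limsup0 R s set0 (fun=> [::]) (fun _ _ => set0)
  (fun=> 0) 0 0) => //=.
- by rewrite lexx ltr01.
- by move=> d d0; exists 0%N => i _; exact: ltW.
- by move=> i; rewrite !mul0r.
Qed.

Theorem theorem1p8 (R : realType) :
  exists rho : forall b : nat, {set 'I_b} -> R,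
    effectively_computable one_missing_digit rho /\
    forall (b : nat) (D : {set 'I_b}), one_missing_digit D ->
      let K := missing_digit_set R D in
      let kappa := hausdorff_dim K in
      [/\ 0 < rho b D,
          forall alpha : R, 2 <= alpha < 2 + rho b D ->
            hausdorff_dim (W alpha `&` K) = ((2 / alpha)%:E + kappa - 1)%E
        & hausdorff_dim (VWA R `&` K) = hausdorff_dim K].
Proof.
exists (@gap R); split; first exact: gap_computable.
move=> b D [b7 cD] /=; have b2 : (2 < b)%N by exact: leq_trans b7.
have g0 : 0 < gap R D by rewrite invr_gt0 exprn_gt0.
have gl := gap_le R D b7.
have k11 := kappa_ge (R := R) b7.
have k1 := kappa_lt1 (R := R) b2.
have l1 : ln101 b < 1 := ln101_lt1 (R := R) b7.
set K := missing_digit_set R D.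
have dimK : hausdorff_dim K = (kappa b)%:E by exact: hausdorff_dim_missing_digit.
(* Both inequalities are strict at [z], which will be 1 / alpha or 1/2, so they persist slightly
   below it. *)
have choose_beta (s z : R) : s < 2 * z + kappa b - 1 -> 12 - 24 * z < ln101 b ->
    exists2 beta, 0 < beta < z & 12 - 24 * beta <= ln101 b /\ s < 2 * beta + kappa b - 1.
  move=> sz lz; pose t := Num.max ((s + 1 - kappa b) / 2) ((12 - ln101 b) / 24).
  have t1 : (s + 1 - kappa b) / 2 <= t by rewrite le_max lexx.
  have t2 : (12 - ln101 b) / 24 <= t by rewrite le_max lexx orbT.
  have tz : t < z by rewrite gt_max; apply/andP; split; lra.
  exists ((t + z) / 2); first by apply/andP; split; lra.
  by split; lra.
have alpha_small alpha : 2 <= alpha < 2 + gap R D -> 12 - 24 * alpha^-1 < ln101 b.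
  move=> /andP[a2 a3]; have a0 : 0 < alpha by lra.
  have -> : 12 - 24 * alpha^-1 = 12 * (alpha - 2) / alpha by field; rewrite gt_eqF.
  rewrite ltr_pdivrMr//; apply: (@lt_le_trans _ _ (6 * gap R D * 2)); first by lra.
  apply: ler_pM => //; lra.
split=> //.
- move=> alpha al; have := alpha_small _ al; case/andP: al => a2 a3 lz.
  have a0 : 0 < alpha by lra.
  have E : ((2 / alpha)%:E + hausdorff_dim K - 1)%E = (2 / alpha + kappa b - 1)%:E.
    by rewrite dimK.
  rewrite E; apply/eqP; rewrite eq_le; apply/andP; split.
    (* At alpha = 2 the claimed value is the dimension of [K], and inclusion suffices. *)
    rewrite le_eqVlt in a2; case/orP: a2 => [/eqP a2|a2].
      rewrite -a2 divff// addrAC subrr add0r -dimK.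
      by apply: hausdorff_dim_sub; exact: subIsetr.
    apply: hausdorff_dim_le => [|s sa]; first by move: (alpha^-1) lz => z lz; lra.
    by apply: W_measure_eq0 => //; exact: ltW.
  have ne s : 0 < s < 2 / alpha + kappa b - 1 -> hausdorff_measure s (W alpha `&` K) <> 0%E.
    move=> /andP[s0 sa]; have [beta /andP[be0 be1] [h1 h2]] := choose_beta _ _ sa lz.
    apply: (@W_measure_neq0 R b D b7 cD alpha beta s) => //.
      by rewrite -ltr_pdivlMl// mulr1.
    rewrite be0/=; apply: (lt_le_trans be1).
    by rewrite mul1r lef_pV2 ?posrE.
  apply: hausdorff_dim_ge (ne); apply/set0P/eqP => E0.
  have s0 : 0 < 2 / alpha + kappa b - 1 by move: (alpha^-1) lz => z lz; lra.
  apply: (ne ((2 / alpha + kappa b - 1) / 2)); first by apply/andP; split; lra.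
  by rewrite E0 hausdorff_measure_set0// divr_gt0.
- apply/eqP; rewrite eq_le hausdorff_dim_sub/=; last exact: subIsetr.
  have ne s : 0 < s < kappa b -> hausdorff_measure s (VWA R `&` K) <> 0%E.
    move=> /andP[s0 sk]; have e1 : s < 2 * (1 / 2) + kappa b - 1 by lra.
    have e2 : 12 - 24 * (1 / 2) < ln101 b :> R by lra.
    have [beta /andP[be0 be1] [h1 h2]] := choose_beta _ _ e1 e2.
    (* Halfway between 2 and 1 / beta, so that alpha > 2 and alpha beta < 1. *)
    pose alpha := (2 + beta^-1) / 2.
    have b2' : 2 < beta^-1 by rewrite -[2]invrK ltf_pV2 ?posrE ?invr_gt0//; lra.
    have bb : beta^-1 * beta = 1 by rewrite mulVf ?gt_eqF.
    have h : hausdorff_measure s (W alpha `&` K) <> 0%E.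
      apply: (@W_measure_neq0 R b D b7 cD alpha beta s) => //.
      - by rewrite /alpha; lra.
      - by rewrite /alpha mulrAC mulrDl bb; lra.
      - by rewrite be0.
    move/hausdorff_measure_eq0_sub => h0; apply: h; apply: h0.
    by apply: setSI => x Wx; exists alpha => //=; rewrite /alpha; lra.
  rewrite dimK; apply: hausdorff_dim_ge (ne); apply/set0P/eqP => E0.
  apply: (ne (kappa b / 2)); first by apply/andP; split; lra.
  by rewrite E0 hausdorff_measure_set0//; lra.
Qed.
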